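(* Let $\tau\subset\mathbb Z^2$ be a polyomino (a finite set with at least two elements) with characteristic polynomial $p(z,u)=\sum_{(i,j)\in\tau}z^iu^j$. Suppose that all roots $\{(z_j,u_j)\}_{j=1,\dots,k}$ of $p$ on $\mathbb T^2=S^1\times S^1\subset\mathbb C^2$ are simple, i.e. $\frac{z\,p_z}{u\,p_u}\notin\mathbb R$ at each of them. Consider multinomial tilings of the torus $\mathbb Z^2/n\mathbb Z^2$, $n\to\infty$, with constant multiplicities, with translates of $\tau$ and of the singleton $\tau_0$, with a fixed small ratio $\varepsilon=w_0/w$ of critical weights of singletons and translates of $\tau$. For $(a,b)\in\mathbb Z^2$ let $X_{a,b}$ be the number of copies of the translate $\tau+(a,b)$ in the random tiling, and let $K$ be the total number of tiles. Then for each fixed $(a,b)\ne(0,0)$, to leading order as $K\to\infty$ and then $n\to\infty$, the covariance function is, up to a multiplicative factor $1+o_\varepsilon(1)$ (i.e. tending to $1$ as $\varepsilon\to0$), $$\mathrm{Cov}(X_{0,0},X_{a,b})=Kw_0\sum_{j=1}^k\frac{z_j^{a}u_j^{b}}{(2\pi)^2}\int_{\mathbb R^2}\frac{e^{i(ax+by)}\,dx\,dy}{\varepsilon+\big|z_jp_z(z_j,u_j)\,x+u_jp_u(z_j,u_j)\,y\big|^2}.$$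
   Context: Subscripts $p_z,p_u$ denote partial derivatives. The integral over $\mathbb R^2$ is not absolutely convergent; it is understood as a Fourier transform (improper integral): for a positive definite quadratic form $\alpha x^2+\beta xy+\gamma y^2$ and $(a,b)\neq(0,0)$, $$\frac1{2\pi}\int_{\mathbb R^2}\frac{e^{i(ax+by)}dx\,dy}{\varepsilon+\alpha x^2+\beta xy+\gamma y^2}=\frac1{\sqrt{\alpha\gamma-\beta^2/4}}\,B\!\left(\sqrt{\frac{\varepsilon(\gamma a^2-\beta ab+\alpha b^2)}{\alpha\gamma-\beta^2/4}}\right),$$ where $B=K_0$ is the modified Bessel function of the second kind. Model. Let $A=|\tau|$. The graph has vertex set $V=(\mathbb Z^2/n\mathbb Z^2)\cup\{v_0\}$, with $v_0$ a dummy vertex. The tiles are the $n^2$ translates $\tau+(a,b)$ of $\tau$ (reduced mod $n$), and for each $v\in\mathbb Z^2/n\mathbb Z^2$ the singleton $\{v\}$ augmented by $v_0$ with multiplicity $A-1$, so that all tiles have size $A$. The multiplicities are $N_v\equiv N$ for $v\neq v_0$ and $N_{v_0}=N_0$, with $N_0+n^2N=AK$, where $K$ is the total number of tiles. An $\mathbf N$-fold tiling is a partition of a set consisting of $N_v$ labelled points above each $v\in V$ into subsets, each of which is a lift of a tile $t$ (it has exactly $t_v$ points above each $v$, where $t_v$ is the multiplicity of $v$ in $t$). All tiles are given weight $1$, so the random tiling is uniform among $\mathbf N$-fold tilings. Let $\alpha=N/K$, $\alpha_0=N_0/K$ be the (asymptotic) ratios as $K\to\infty$ with $n$ fixed. The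 critical weights $w_0$ (of each singleton) and $w$ (of each translate of $\tau$) are the asymptotic fractions among the $K$ tiles of each singleton and of each translate of $\tau$, respectively; they are determined by $w_0+Aw=\alpha$ and $(A-1)n^2w_0=\alpha_0$ (so $n^2(w_0+w)=1$). The ratios are chosen so that $w_0/w=\varepsilon$ is a fixed constant independent of $n$.
   Formalization: The single factor 1+o_ε(1) is claimed only if Σ_j z_j^a u_j^b/|Im(conj(z_j p_z) u_j p_u)| ≠ 0; otherwise, for k≥1, each root's term gets its own factor tending to 1. For k=0 or cancelling leading terms the literal claim can fail. *)

(* Defs.v *)
From HB Require Import structures.
From mathcomp Require Import all_boot all_order all_algebra finmap.
From mathcomp Require Import complex.
From mathcomp Require Import all_classical all_reals all_analysis.
Set Implicit Arguments.
Unset Strict Implicit.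
Unset Printing Implicit Defensive.
Import Order.TTheory GRing.Theory Num.Theory.
Import numFieldNormedType.Exports.
Local Open Scope complex_scope.
Local Open Scope ring_scope.

Definition polyomino := {fset (int * int)}.

Section CharacteristicPolynomial.
Variables (R : realType) (tau : polyomino).

Definition charpoly (z u : R[i]) : R[i] := \sum_(q <- tau) z ^ q.1 * u ^ q.2.

(* Formal partial derivatives of the Laurent polynomial [charpoly]; they are
   only used at points with z and u nonzero. *)
Definition charpoly_z (z u : R[i]) : R[i] :=
  \sum_(q <- tau) q.1%:~R * z ^ (q.1 - 1) * u ^ q.2.
Definition charpoly_u (z u : R[i]) : R[i] :=
  \sum_(q <- tau) q.2%:~R * z ^ q.1 * u ^ (q.2 - 1).

Definition torus_root (z u : R[i]) : Prop :=
  [/\ `|z| = 1, `|u| = 1 & charpoly z u = 0].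

(* A root with [charpoly_u z u = 0] is not simple: the ratio is infinite in the
   informal reading, and is 0, hence real, here. *)
Definition simple_root (z u : R[i]) : Prop :=
  (z * charpoly_z z u) / (u * charpoly_u z u) \isn't Num.real.

End CharacteristicPolynomial.

Section Tilings.
Variables (n N N0 : nat) (tau : polyomino).

(* [None] is the dummy vertex v_0. *)
Definition vertex := option ('I_n * 'I_n).

Definition multiplicity (v : vertex) : nat := if v is Some _ then N else N0.

Definition point := {v : vertex & 'I_(multiplicity v)}.

(* A tile is given by the number t_v of points that it has above each v. *)
Definition tile := vertex -> nat.

Definition translate (a b : int) : tile := fun v =>
  if v is Some (x, y) then
    count (fun q : int * int =>
      (q.1 + a == (x : nat)%:Z %[mod n%:Z])%Z &&
      (q.2 + b == (y : nat)%:Z %[mod n%:Z])%Z) tau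
  else 0%N.

Definition singleton (p : 'I_n * 'I_n) : tile := fun v =>
  if v is Some p' then nat_of_bool (p' == p) else #|` tau|.-1.

Definition is_lift (t : tile) (B : {set point}) : bool :=
  [forall v : vertex, #|[set q in B | tag q == v]| == t v].

Definition tilings : {set {set {set point}}} :=
  [set P | finset.partition P [set: point] &
    [forall B in P, [exists p : 'I_n * 'I_n,
       is_lift (translate (p.1 : nat)%:Z (p.2 : nat)%:Z) B
       || is_lift (singleton p) B]]].

Definition copies (a b : int) (P : {set {set point}}) : nat :=
  #|[set B in P | is_lift (translate a b) B]|.

End Tilings.

Section Uniform.
Variables (R : realType) (T : finType) (A : {set T}).

Definition unif_mean (f : T -> R) : R := (\sum_(x in A) f x) / #|A|%:R.

Definition unif_cov (f g : T -> R) : R :=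
  unif_mean (fun x => f x * g x) - unif_mean f * unif_mean g.

End Uniform.

Local Open Scope classical_set_scope.

Section Model.
Variables (R : realType) (tau : polyomino).

(* Cov(X_{0,0}, X_{a,b}) for the uniform random tiling. *)
Definition covariance_copies (n N N0 : nat) (a b : int) : R :=
  unif_cov (tilings n N N0 tau)
    (fun P => (copies tau 0 0 P)%:R) (fun P => (copies tau a b P)%:R).

(* Multiplicities (N m, N0 m), with K m tiles in total, for which tilings exist,
   and such that K m tends to infinity with limiting ratios alpha, alpha0. *)
Definition multiplicity_regime (n : nat) (N N0 K : nat -> nat)
    (alpha alpha0 : R) : Prop :=
  [/\ forall m, (N0 m + n ^ 2 * N m = #|` tau| * K m)%N,
      forall m, (0 < #|tilings n (N m) (N0 m) tau|)%N,
      K m @[m --> \oo] --> \oo,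
      (N m)%:R / (K m)%:R @[m --> \oo] --> alpha &
      (N0 m)%:R / (K m)%:R @[m --> \oo] --> alpha0].

(* w0 and w are the critical weights of each singleton and of each translate of
   tau for the ratios alpha, alpha0. *)
Definition critical_weights (n : nat) (alpha alpha0 w0 w : R) : Prop :=
  w0 + #|` tau|%:R * w = alpha /\
  (#|` tau|%:R - 1) * n%:R ^+ 2 * w0 = alpha0.

(* [C n] is the limit of Cov(X_{0,0}, X_{a,b}) / (K w0) as K tends to infinity
   with n fixed and w0 / w = eps; it is only required to exist once n is large
   enough, since for small n the translates of tau need not be distinct. *)
Definition covariance_limit (a b : int) (eps : R) (C : nat -> R) : Prop :=
  \forall n \near \oo,
    forall (N N0 K : nat -> nat) (alpha alpha0 w0 w : R),
    multiplicity_regime n N N0 K alpha alpha0 ->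
    critical_weights n alpha alpha0 w0 w -> w0 / w = eps ->
    covariance_copies n (N m) (N0 m) a b / ((K m)%:R * w0)
      @[m --> \oo] --> C n.

End Model.

Section ImproperIntegral.
Variable R : realType.

Definition expi (t : R) : R[i] := cos t +i* sin t.

Definition lebesgue2 :=
  (@lebesgue_measure R \x @lebesgue_measure R)%E.

Definition integral2 (D : set (R * R)) (f : R * R -> R[i]) : R[i] :=
  Rintegral lebesgue2 D (fun x => complex.Re (f x))
  +i* Rintegral lebesgue2 D (fun x => complex.Im (f x)).

(* The integrals of f over [-T, T]^2 converge as T tends to infinity. *)
Definition improper_converges (f : R * R -> R[i]) : Prop :=
  let I T := integral2 (`[- T, T] `*` `[- T, T]) f in
  cvg (complex.Re (I T) @[T --> +oo]) /\ cvg (complex.Im (I T) @[T --> +oo]).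

Definition improper_integral (f : R * R -> R[i]) : R[i] :=
  let I T := integral2 (`[- T, T] `*` `[- T, T]) f in
  lim (complex.Re (I T) @[T --> +oo]) +i* lim (complex.Im (I T) @[T --> +oo]).

End ImproperIntegral.

Section RootContribution.
Variables (R : realType) (tau : polyomino) (a b : int).

Definition root_integrand (eps : R) (z u : R[i]) (x : R * R) : R[i] :=
  expi (a%:~R * x.1 + b%:~R * x.2) /
  (eps%:C + `| z * charpoly_z tau z u * x.1%:C
             + u * charpoly_u tau z u * x.2%:C | ^+ 2).

Definition root_term (eps : R) (z u : R[i]) : R[i] :=
  z ^ a * u ^ b / ((2 * pi) ^+ 2)%:C
  * improper_integral (root_integrand eps z u).

(* The coefficient of log (1 / eps) in [root_term eps z u] as eps tends to 0,
   up to a factor independent of the root: the determinant of the quadratic form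
   |P x + Q y|^2, with P = z p_z and Q = u p_u, is (Im (P^* Q))^2. *)
Definition root_coefficient (z u : R[i]) : R[i] :=
  z ^ a * u ^ b /
  `|complex.Im ((z * charpoly_z tau z u)^* * (u * charpoly_u tau z u))|%:C.

End RootContribution.

(* Main.v *)
(**
Recording only the number of tiles of each type turns the uniform random tiling
into a random vector c with weight \prod_t 1 / (c t)! on the solutions of the
linear balance equations. Moves that trade the tiles of one set of types for
those of another preserve the balance and give Stein identities; since c is
concentrated at scale sqrt K around the critical point, these identities
determine the covariances to leading order as the inverse of a translation
invariant quadratic form, which the discrete Fourier transform diagonalises:
Cov / (K w0) tends to n^-2 \sum cos (a x + b y) / (eps + |p|^2) over the nonzero
grid points of the torus, a Riemann sum of a Lipschitz periodic function.

As eps tends to 0 this integral is dominated by small boxes around the roots,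
where |p|^2 is close to |P x + Q y|^2 with P = z p_z and Q = u p_u; the integral
of 1 / (eps + |P x + Q y|^2) over a box is pi / |Im (P^* Q)| ln (1 / eps) + O(1).
The improper integral of a root term has the same singularity, because its part
outside a box is bounded uniformly in eps by oscillation. So both sides are
ln (1 / eps) / (4 pi) times the same coefficients, up to o(ln (1 / eps)). The
roots come in conjugate pairs, hence the sum of the root terms is real.
*)
Require Import Defs.
From HB Require Import structures.
From mathcomp Require Import all_boot all_order all_algebra finmap complex.
From mathcomp Require Import zify ring lra.
Set Implicit Arguments.
Unset Strict Implicit.
Unset Printing Implicit Defensive.
Import Order.TTheory GRing.Theory Num.Theory.

(** * Counting tilings with given type counts *)

(** The dummy vertex fixes the number of singletons, and the covering of the torus then fixes the
    number of copies of [tau]. A single copy can therefore not be inserted, only relocated, with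
    singletons exchanged on the two footprints; the conserved total is also the reason why the mode
    at zero is missing from the Fourier sum. Concentration rests on crude counting: the weight of a
    state is at most that of an almost critical state times a constant and a Gaussian factor, and
    the number of states is polynomial in N, so the moments of the rescaled deviation are bounded by
    powers of ln N, which the error 1 / sqrt N of the Stein identities absorbs. The phases of
    different roots may cancel in the sum of the coefficients of ln (1 / eps), and then agreement up
    to o(ln (1 / eps)) does not control the quotient of the two sums. Hence the factor 1 + o(1) is
    attached to the roots separately: each term alone is of exact order ln (1 / eps), so the whole
    discrepancy can be charged to one of them. A common factor follows when the coefficients do not
    cancel. *)

Section TypedPartitions.
Variables (Pt V T : finType) (tg : Pt -> V) (ty : T -> V -> nat).
Implicit Types (D B : {set Pt}) (P : {set {set Pt}}) (c : T -> nat).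

Definition fiber D v := [set q in D | tg q == v].
Definition has_type t B := [forall v, #|fiber B v| == ty t v].
Definition typed_partitions D :=
  [set P | partition P D & [forall B in P, [exists t, has_type t B]]].
Definition type_count P t := #|[set B in P | has_type t B]|.

Lemma in_fiber D v q : (q \in fiber D v) = (q \in D) && (tg q == v).
Proof. by rewrite inE. Qed.

(** A block is the same as an independent choice of a subset of prescribed size in each fiber, that
    is, a member of [family F]. *)
Lemma card_typed_blocks D (k : V -> nat) :
  #|[set B : {set Pt} | (B \subset D) && [forall v, #|fiber B v| == k v]]|
  = \prod_v 'C(#|fiber D v|, k v).
Proof.
pose F v : pred {set Pt} := [pred C : {set Pt} | (C \subset fiber D v) && (#|C| == k v)].
have -> : \prod_v 'C(#|fiber D v|, k v) = #|family F|.
  rewrite card_family foldrE big_map big_enum /=; apply: eq_bigr => v _.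
  by rewrite -cards_draws; apply: eq_card => C; rewrite !inE.
pose f B : {ffun V -> {set Pt}} := [ffun v => fiber B v].
have f_inj : injective f.
  move=> B C /ffunP E; apply/setP => q.
  by have /setP/(_ q) := E (tg q); rewrite !ffunE !in_fiber eqxx !andbT.
rewrite -(card_imset _ f_inj); apply: eq_card => g.
apply/imsetP/familyP => [[B + ->] v|gF].
  rewrite inE => /andP[/subsetP BD /forallP /(_ v) Bk]; rewrite ffunE inE Bk andbT.
  by apply/subsetP => q; rewrite !in_fiber => /andP[/BD -> ->].
have gE v : fiber (\bigcup_v g v) v = g v.
  apply/setP => q; rewrite in_fiber; apply/andP/idP => [[/bigcupP[w _ qw] /eqP <-]|qv].
    have := gF w; rewrite inE => /andP[/subsetP/(_ q qw)].
    by rewrite in_fiber => /andP[_ /eqP ->].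
  split; first by apply/bigcupP; exists v.
  by have := gF v; rewrite inE => /andP[/subsetP/(_ q qv)]; rewrite in_fiber => /andP[].
exists (\bigcup_v g v); last by apply/ffunP => v; rewrite ffunE gE.
rewrite inE; apply/andP; split.
  apply/bigcupsP => v _; apply/subsetP => q qv.
  by have := gF v; rewrite inE => /andP[/subsetP/(_ q qv)]; rewrite in_fiber => /andP[].
by apply/forallP => v; rewrite gE; have := gF v; rewrite inE => /andP[].
Qed.

Hypothesis ty_inj : forall t t', ty t =1 ty t' -> t = t'.
Hypothesis ty_neq0 : forall t, exists v, 0 < ty t v.

Lemma has_type_inj B t t' : has_type t B -> has_type t' B -> t = t'.
Proof.
move=> /forallP h /forallP h'; apply: ty_inj => v.
by rewrite -(eqP (h v)) -(eqP (h' v)).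
Qed.

Lemma has_type_neq0 B t : has_type t B -> B != set0.
Proof.
move=> /forallP h; have [v tv] := ty_neq0 t; apply/eqP => B0.
have := h v; rewrite B0 => /eqP E; move: tv; rewrite -E.
by rewrite (_ : fiber _ _ = set0) ?cards0 //; apply/setP => q; rewrite !inE.
Qed.

Lemma fiberD D B v : fiber (D :\: B) v = fiber D v :\: fiber B v.
Proof. by apply/setP => q; rewrite !inE; case: (q \in B); case: (q \in D); case: (tg q == v). Qed.

Definition profile_count D c := #|[set P in typed_partitions D | [forall t, type_count P t == c t]]|.

Lemma card_fiberD D B t v : B \subset D -> has_type t B ->
  #|fiber (D :\: B) v| = #|fiber D v| - ty t v.
Proof.
move=> BD /forallP /(_ v) /eqP <-; rewrite fiberD cardsD (setIidPr _) //.
by apply/subsetP => q; rewrite !inE => /andP[/(subsetP BD) -> ->].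
Qed.

Lemma type_count1 B t t' P : B \notin P -> has_type t B ->
  type_count (B |: P) t' = (t' == t) + type_count P t'.
Proof.
move=> BP Bt; rewrite /type_count; case: eqVneq => [->|ne].
  rewrite (_ : [set _ in _ | _] = B |: [set B in P | has_type t B]); last first.
    by apply/setP => C; rewrite !inE; case: eqVneq => // ->.
  by rewrite cardsU1 inE (negbTE BP).
congr #|pred_of_set _|; apply/setP => C; rewrite !inE; case: eqVneq => //= ->.
rewrite (negbTE BP) /=; apply/negP => Bt'.
by move: ne; rewrite (has_type_inj Bt Bt') eqxx.
Qed.

(* Double counting of the pairs of a partition and one of its blocks of type t. *)
Lemma profile_count_rec D c t : 0 < c t ->
  c t * profile_count D c =
  \sum_(B : {set Pt} | (B \subset D) && has_type t B)
     profile_count (D :\: B) (fun t' => c t' - (t' == t)).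
Proof.
move=> ct; rewrite /profile_count.
set S := [set P in typed_partitions D | _].
have -> : c t * #|S| = \sum_(P in S) \sum_(B in P | has_type t B) 1.
  rewrite mulnC -sum_nat_const; apply: eq_bigr => P; rewrite inE => /andP[_ /forallP /(_ t) /eqP <-].
  by rewrite sum1_card; apply: eq_card => B; rewrite !inE.
rewrite (exchange_big_dep (fun B => (B \subset D) && has_type t B)) /=; last first.
  move=> P B; rewrite !inE => /andP[/andP[PD _] _] /andP[BP ->]; rewrite andbT.
  exact: partitionS PD BP.
apply: eq_bigr => B /andP[BD Bt]; rewrite sum1_card.
set S' := [set _ in _ | _].
have BS' P : P \in S' -> B \notin P.
  rewrite !inE => /andP[/andP[PD _] _]; apply/negP => BP.
  have := partitionS PD BP; have [x xB] := set0Pn _ (has_type_neq0 Bt).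
  by move=> /subsetP /(_ x xB); rewrite inE xB.
(* Adding the block [B] is a bijection from the partitions of the complement of [B] to the
   partitions that contain [B]. *)
have inj : {in S' &, injective (fun P => B |: P)}.
  move=> P Q /BS' BP /BS' BQ /setP E; apply/setP => C.
  have := E C; rewrite !inE; case: eqVneq => // -> _.
  by rewrite (negbTE BP) (negbTE BQ).
rewrite -(card_in_imset inj); apply: eq_card => P; rewrite [LHS]inE /=.
apply/andP/imsetP.
  move=> [PS /andP[BP _]]; exists (P :\ B); last by rewrite setD1K.
  move: PS; rewrite !inE => /andP[/andP[PD /forall_inP Pt'] /forallP Pc].
  rewrite partitionD1 //=; apply/andP; split.
    by apply/forall_inP => C; rewrite inE => /andP[_ /Pt'].
  apply/forallP => t'; rewrite -(eqP (Pc t')) -{2}(setD1K BP) (@type_count1 B t) ?addKn //.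
  by rewrite !inE eqxx.
move=> [Q QS ->]; have BQ := BS' _ QS; move: QS.
rewrite !inE eqxx Bt /= => /andP[/andP[QD /forall_inP Qt] /forallP Qc]; split=> //.
apply/andP; split; [apply/andP; split|].
- have -> : D = B :|: (D :\: B).
    by apply/setP => x; rewrite !inE; case: (boolP (x \in B)) => // /(subsetP BD).
  apply: partitionU1 => //; first exact: has_type_neq0 Bt.
  by rewrite disjoints_subset; apply/subsetP => x xB; rewrite !inE xB.
- apply/forall_inP => C; rewrite !inE => /orP[/eqP ->|/Qt //].
  by apply/existsP; exists t.
- apply/forallP => t'; rewrite (@type_count1 B t) // (eqP (Qc t')).
  by case: (eqVneq t' t) => [->|_] /=; rewrite ?subn0 // add1n subn1 prednK.
Qed.

Lemma prod_fact_decr c t : 0 < c t ->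
  \prod_t' (c t')`! * (\prod_t' (\prod_v (ty t' v)`!) ^ c t') =
  c t * \prod_v (ty t v)`! *
  (\prod_t' (c t' - (t' == t))`! * (\prod_t' (\prod_v (ty t' v)`!) ^ (c t' - (t' == t)))).
Proof.
move=> ct; rewrite -!big_split (bigD1 t) //= [in RHS](bigD1 t) //= eqxx subn1.
rewrite -[c t in LHS](prednK ct) factS expnS prednK //.
rewrite (eq_bigr (fun t' => (c t' - (t' == t))`! * (\prod_v (ty t' v)`!) ^ (c t' - (t' == t)))).
  rewrite !mulnA; congr (_ * _); rewrite -!mulnA; congr (_ * _).
  by rewrite mulnCA.
by move=> t' /negbTE ->; rewrite subn0.
Qed.

(** Multinomial formula, by induction on the number of blocks: [profile_count_rec] removes a block
    of some type [t] that occurs, [card_typed_blocks] counts the candidates for it by binomials, and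
    [bin_fact] turns these into the missing factorials. *)
Lemma profile_countE D c : (forall v, #|fiber D v| = \sum_t c t * ty t v) ->
  profile_count D c * (\prod_t (c t)`! * \prod_t (\prod_v (ty t v)`!) ^ c t) =
  \prod_v (#|fiber D v|)`!.
Proof.
move Em : (\sum_t c t) => m; elim: m D c Em => [|m IH] D c Em Dc.
  have c0 t : c t = 0.
    by apply/eqP; rewrite -leqn0 -Em (bigD1 t) //= leq_addr.
  have D0 : D = set0.
    apply/setP => q; rewrite !inE; apply/negbTE/negP => qD.
    have := Dc (tg q); rewrite big1 => [/eqP|t _]; last by rewrite c0.
    by rewrite cards_eq0 => /eqP/setP/(_ q); rewrite !inE qD eqxx.
  rewrite !big1 => [|v _|t _|t _]; last 3 first.
  - rewrite D0 (_ : fiber _ _ = set0) ?cards0 //.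
    by apply/setP => q; rewrite !inE.
  - by rewrite c0.
  - by rewrite c0.
  rewrite /profile_count (_ : [set _ in _ | _] = [set set0]) ?cards1 //.
  apply/setP => P; rewrite !inE D0 partition_set0; case: eqP => //= ->.
  apply/andP; split; first by apply/forall_inP => B; rewrite inE.
  apply/forallP => t; rewrite c0 cards_eq0; apply/eqP/setP => B; by rewrite !inE.
have [t ct] : exists t, 0 < c t.
  apply/existsP; rewrite -[[exists _, _]]negbK negb_exists; apply/negP => /forallP h.
  by move: Em; rewrite big1 // => t _; apply/eqP; have := h t; rewrite lt0n negbK.
have leDc v : ty t v <= #|fiber D v|.
  by rewrite Dc (bigD1 t) //= -[X in X <= _]mul1n (leq_trans _ (leq_addr _ _)) // leq_mul2r ct orbT.
rewrite (prod_fact_decr ct); set W := \prod_t' _ * \prod_t' _.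
have -> p : p * (c t * \prod_v (ty t v)`! * W) = c t * p * (\prod_v (ty t v)`! * W).
  by rewrite !mulnA (mulnC p).
rewrite profile_count_rec // big_distrl /=.
transitivity (\sum_(B : {set Pt} | (B \subset D) && has_type t B)
    \prod_v ((ty t v)`! * (#|fiber D v| - ty t v)`!)).
  apply: eq_bigr => B /andP[BD Bt]; rewrite mulnCA /W IH; last 2 first.
  - apply: succn_inj; rewrite -Em (bigD1 t) //= [in RHS](bigD1 t) //= eqxx subn1 -addSn prednK //.
    by congr (_ + _); apply: eq_bigr => t' /negbTE ->; rewrite subn0.
  - move=> v; rewrite (card_fiberD _ BD Bt) Dc (bigD1 t) //= [in RHS](bigD1 t) //= eqxx.
    rewrite mulnBl mul1n addnBAC; last by rewrite leq_pmull.
    by congr (_ + _ - _); apply: eq_bigr => t' /negbTE ->; rewrite subn0.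
  by rewrite big_split /=; congr (_ * _); apply: eq_bigr => v _; rewrite (card_fiberD _ BD Bt).
rewrite sum_nat_const -[X in X * _](_ : #|[set B : {set Pt} | (B \subset D) && has_type t B]| = _).
  rewrite card_typed_blocks -big_split; apply: eq_bigr => v _ /=.
  by rewrite bin_fact.
by apply: eq_card => B; rewrite inE.
Qed.

End TypedPartitions.
From mathcomp Require Import all_classical all_reals all_analysis measurable_realfun.
Import numFieldNormedType.Exports.
Local Open Scope ring_scope.

(** * Weighted means and Gaussian bounds for Poisson weights *)

Section WeightedMean.
Variables (R : realType) (S : finType) (P : pred S) (W : S -> R).
Implicit Types (f g : S -> R) (k : R).

Definition wmean f : R := (\sum_(c | P c) W c * f c) / \sum_(c | P c) W c.
Definition wcov f g : R := wmean (fun c => f c * g c) - wmean f * wmean g.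

Hypothesis W_ge0 : forall c, P c -> 0 <= W c.
Hypothesis W_gt0 : 0 < \sum_(c | P c) W c.

Lemma eq_wmean f g : (forall c, P c -> f c = g c) -> wmean f = wmean g.
Proof. by move=> fg; congr (_ / _); apply: eq_bigr => c /fg ->. Qed.

Lemma wmeanD f g : wmean (fun c => f c + g c) = wmean f + wmean g.
Proof. by rewrite /wmean -mulrDl -big_split; congr (_ / _); apply: eq_bigr => c _; rewrite mulrDr. Qed.

Lemma wmeanZ k f : wmean (fun c => k * f c) = k * wmean f.
Proof. by rewrite /wmean mulrA mulr_sumr; congr (_ / _); apply: eq_bigr => c _; rewrite mulrCA. Qed.

Lemma wmeanN f : wmean (fun c => - f c) = - wmean f.
Proof. by rewrite -mulN1r -wmeanZ; apply: eq_wmean => c _; rewrite mulN1r. Qed.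

Lemma wmeanB f g : wmean (fun c => f c - g c) = wmean f - wmean g.
Proof. by rewrite wmeanD wmeanN. Qed.

Lemma wmean_sum (I : finType) (F : I -> S -> R) :
  wmean (fun c => \sum_i F i c) = \sum_i wmean (F i).
Proof.
rewrite /wmean -mulr_suml; congr (_ / _); rewrite exchange_big; apply: eq_bigr => c _ /=.
by rewrite mulr_sumr.
Qed.

Lemma wmean_cst k : wmean (fun=> k) = k.
Proof. by rewrite /wmean -mulr_suml mulrAC divff ?mul1r // gt_eqF. Qed.

Lemma le_wmean f g : (forall c, P c -> f c <= g c) -> wmean f <= wmean g.
Proof.
move=> fg; rewrite ler_pM2r ?invr_gt0 //; apply: ler_sum => c Pc.
by rewrite ler_wpM2l ?W_ge0 ?fg.
Qed.

Lemma wmean_ge0 f : (forall c, P c -> 0 <= f c) -> 0 <= wmean f.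
Proof. by move=> f0; rewrite -(wmean_cst 0); exact: le_wmean. Qed.

Lemma ler_norm_wmean f : `|wmean f| <= wmean (fun c => `|f c|).
Proof.
rewrite ler_norml -wmeanN; apply/andP; split; apply: le_wmean => c _; last exact: ler_norm.
by rewrite lerNl -normrN ler_norm.
Qed.

Lemma wcov_sumr (I : finType) (F : I -> S -> R) (a : I -> R) f :
  wcov f (fun c => \sum_i a i * F i c) = \sum_i a i * wcov f (F i).
Proof.
rewrite /wcov; under [in RHS]eq_bigr do rewrite mulrBr.
rewrite sumrB; congr (_ - _).
  rewrite (_ : wmean _ = wmean (fun c => \sum_i a i * (f c * F i c))).
    by rewrite wmean_sum; apply: eq_bigr => i _; rewrite wmeanZ.
  by apply: eq_wmean => c _; rewrite mulr_sumr; apply: eq_bigr => i _; rewrite mulrCA.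
by rewrite wmean_sum mulr_sumr; apply: eq_bigr => i _; rewrite wmeanZ mulrCA.
Qed.

Lemma wcov_addcr f g k : wcov f (fun c => g c + k) = wcov f g.
Proof.
rewrite /wcov wmeanD wmean_cst (_ : wmean (fun c => f c * (g c + k)) =
  wmean (fun c => f c * g c) + k * wmean f).
  by ring.
by rewrite -wmeanZ -wmeanD; apply: eq_wmean => c _; rewrite mulrDr [k * _]mulrC.
Qed.

Lemma eq_wcov f g f' g' : (forall c, P c -> f c = f' c) -> (forall c, P c -> g c = g' c) ->
  wcov f g = wcov f' g'.
Proof.
move=> ff gg; rewrite /wcov (eq_wmean ff) (eq_wmean gg); congr (_ - _).
by apply: eq_wmean => c Pc; rewrite ff ?gg.
Qed.

End WeightedMean.

Section FactorialBounds.
Variables (R : realType) (b : nat) (lam B kap : R).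
Hypotheses (b_gt0 : (0 < b)%N) (kap_gt0 : 0 < kap) (B_ge0 : 0 <= B).
Hypotheses (lam_ge : kap * b%:R <= lam) (lam_le : lam <= b%:R).

Let pois (x : nat) : R := lam ^+ x / x`!%:R.

Let lam_gt0 : 0 < lam.
Proof. by apply: lt_le_trans lam_ge; rewrite mulr_gt0 ?ltr0n. Qed.

Let bR : 0 < b%:R :> R. Proof. by rewrite ltr0n. Qed.

Let poisS x : pois x.+1 = pois x * (lam / x.+1%:R).
Proof. by rewrite /pois exprS factS natrM invfM; ring. Qed.

Let le_expR (x : R) : x <= expR (x - 1).
Proof. by have := expR_ge1Dx (x - 1); rewrite addrC subrK. Qed.

(** The ratio of consecutive weights is [lam / i], at most [expR (lam / i - 1)]. Each step pays at
    most [B / (kap * b)] for the offset of [y] from [lam], and the drifts [1 / b], ..., [d / b] add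
    up to the quadratic exponent. *)
Let pois_up (y d : nat) : kap * b%:R <= y%:R -> `|y%:R - lam| <= B -> (y + d <= b)%N ->
  pois (y + d) <= pois y * expR (d%:R * (B / (kap * b%:R)) - (d%:R * (d%:R + 1)) / (2 * b%:R)).
Proof.
move=> ky yB; elim: d => [|d IH] yd; first by rewrite addn0 !mul0r subrr expR0 mulr1.
rewrite addnS poisS.
have {}IH := IH (leq_trans (leq_add (leqnn y) (leqnSn d)) yd).
have y_gt0 : 0 < y%:R :> R by apply: lt_le_trans ky; rewrite mulr_gt0.
have i_gt0 : 0 < (y + d).+1%:R :> R by rewrite ltr0n.
have step : lam / (y + d).+1%:R <= expR (B / (kap * b%:R) - (d%:R + 1) / b%:R).
  apply: le_trans (le_expR _) _; rewrite ler_expR.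
  have -> : lam / (y + d).+1%:R - 1 = ((lam - y%:R) - (d%:R + 1)) / (y + d).+1%:R.
    by rewrite -{2}[1](@divff _ (y + d).+1%:R) ?gt_eqF // -mulrBl -addn1 !natrD; congr (_ / _); ring.
  rewrite mulrBl; apply: lerB.
    apply: (@le_trans _ _ (B / (y + d).+1%:R)).
      by rewrite ler_pM2r ?invr_gt0 //; move: yB; rewrite distrC; exact: le_trans (ler_norm _).
    rewrite ler_wpM2l // lef_pV2 ?posrE // ?mulr_gt0 //.
    by apply: le_trans ky _; rewrite ler_nat -addnS leq_addr.
  by rewrite ler_pM2l ?ltr_wpDl // lef_pV2 ?posrE // ler_nat -addnS.
apply: le_trans (ler_pM _ _ IH step) _; rewrite ?mulr_ge0 ?invr_ge0 ?exprn_ge0 ?(ltW lam_gt0) //.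
rewrite -[X in X <= _]mulrA -expRD -natr1 ler_wpM2l ?mulr_ge0 ?invr_ge0 ?exprn_ge0 ?(ltW lam_gt0) //.
rewrite ler_expR le_eqVlt; apply/orP; left; apply/eqP; field.
by rewrite !gt_eqF.
Qed.

(** Same as upwards with the inverse ratios, but the drifts start at 0, so they add up to
    [d * (d - 1) / (2 * b)] only. *)
Let pois_down (y d : nat) : `|y%:R - lam| <= B -> (d <= y)%N ->
  pois (y - d) <= pois y * expR (d%:R * (B / (kap * b%:R)) - (d%:R * (d%:R - 1)) / (2 * b%:R)).
Proof.
move=> yB; elim: d => [|d IH] yd; first by rewrite subn0 !mul0r subrr expR0 mulr1.
have {}IH := IH (ltnW yd).
have ydE : (y - d = (y - d.+1).+1)%N by rewrite subnS prednK // subn_gt0.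
have i_gt0 : 0 < (y - d)%:R :> R by rewrite ydE ltr0n.
have step : (y - d)%:R / lam <= expR (B / (kap * b%:R) - d%:R / b%:R).
  apply: le_trans (le_expR _) _; rewrite ler_expR.
  have -> : (y - d)%:R / lam - 1 = ((y%:R - lam) - d%:R) / lam.
    by rewrite -{2}[1](@divff _ lam) ?gt_eqF // -mulrBl natrB 1?ltnW //; congr (_ / _); ring.
  rewrite mulrBl; apply: lerB.
    apply: (@le_trans _ _ (B / lam)).
      by rewrite ler_pM2r ?invr_gt0 //; exact: le_trans (ler_norm _) yB.
    by rewrite ler_wpM2l // lef_pV2 ?posrE // mulr_gt0.
  by rewrite ler_wpM2l // lef_pV2 ?posrE.
have -> : pois (y - d.+1) = pois (y - d) * ((y - d)%:R / lam).
  by rewrite {1}ydE poisS -ydE; field; rewrite !gt_eqF.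
apply: le_trans (ler_pM _ _ IH step) _;
  rewrite ?mulr_ge0 ?invr_ge0 ?exprn_ge0 ?(ltW lam_gt0) //.
rewrite -[X in X <= _]mulrA -expRD -natr1 ler_wpM2l ?mulr_ge0 ?invr_ge0 ?exprn_ge0 ?(ltW lam_gt0) //.
rewrite ler_expR le_eqVlt; apply/orP; left; apply/eqP; field.
by rewrite !gt_eqF.
Qed.

(** At most [b] steps separate [x] from [y], so the offsets cost [B / kap] in all. The summand 1
    pays for the linear term by which the downward exponent falls short of the square. *)
Lemma poisson_weight_le (x y : nat) : (x <= b)%N -> (y <= b)%N ->
  kap * b%:R <= y%:R -> `|y%:R - lam| <= B ->
  pois x <= pois y * expR (B / kap + 1 - (x%:R - y%:R) ^+ 2 / (2 * b%:R)).
Proof.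
move=> xb yb ky yB.
have py : 0 <= pois y by rewrite mulr_ge0 ?invr_ge0 ?exprn_ge0 ?(ltW lam_gt0).
have bound d : (d <= b)%N -> d%:R * (B / (kap * b%:R)) <= B / kap.
  move=> db; have -> : B / kap = b%:R * (B / (kap * b%:R)) by field; rewrite !gt_eqF.
  by rewrite ler_wpM2r ?ler_nat // mulr_ge0 // invr_ge0 mulr_ge0 // ltW.
have dle d : (d <= b)%N -> d%:R / (2 * b%:R) <= 1 :> R.
  move=> db; rewrite ler_pdivrMr ?mulr_gt0 // mul1r -natrM ler_nat.
  by rewrite mul2n -addnn (leq_trans db) ?leq_addr.
have [yx|xy] := leqP y x.
  have /= := @pois_up y (x - y) ky yB; rewrite subnKC // => /(_ xb) h; apply: le_trans h _.
  rewrite ler_wpM2l // ler_expR natrB //.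
  have := bound (x - y)%N (leq_trans (leq_subr _ _) xb); rewrite natrB // => h.
  apply: lerB; first by apply: le_trans h _; rewrite lerDl.
  rewrite ler_pM2r ?invr_gt0 ?mulr_gt0 // expr2 ler_wpM2l ?subr_ge0 ?ler_nat //.
  by rewrite lerDl.
have /= := @pois_down y (y - x) yB (leq_subr _ _); rewrite subKn 1?ltnW // => h.
apply: le_trans h _; rewrite ler_wpM2l // ler_expR.
have h := bound (y - x)%N (leq_trans (leq_subr _ _) yb).
have h' := dle (y - x)%N (leq_trans (leq_subr _ _) yb).
rewrite -sqrrN opprB -natrB 1?ltnW //.
have -> : (y - x)%:R * ((y - x)%:R - 1) / (2 * b%:R)
   = (y - x)%:R ^+ 2 / (2 * b%:R) - (y - x)%:R / (2 * b%:R) :> R.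
  by field; rewrite gt_eqF.
by move: h h'; lra.
Qed.

End FactorialBounds.

(** * Stein identities for count vectors *)

Section ProductExpansion.
Variables (R : realType) (B : R).
Hypothesis B_ge0 : 0 <= B.

(** The recursion is read off the induction in [prod_expand]: a new factor meets a linear sum of
    [k'] terms and multiplies the previous remainder by at most [1 + B]. *)
Fixpoint prod_remainder (k : nat) : R :=
  if k is k'.+1 then k'%:R + (1 + B) * prod_remainder k' else 0.

Lemma prod_remainder_ge0 k : 0 <= prod_remainder k.
Proof. by elim: k => //= k IH; rewrite addr_ge0 ?ler0n // mulr_ge0 // addr_ge0. Qed.

Lemma prod_remainder_le k l : (k <= l)%N -> prod_remainder k <= prod_remainder l.
Proof.
move=> kl; rewrite -(subnK kl); elim: (l - k)%N => // d IH; apply: le_trans IH _.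
rewrite addSn /= mulrDl mul1r addrCA lerDl addr_ge0 ?ler0n //.
by rewrite mulr_ge0 // prod_remainder_ge0.
Qed.

(** Two bounds on the same numbers: [x0] enters quadratically and will be a random deviation, [B] is
    a crude deterministic bound that affects the constant alone. *)
Lemma prod_expand (I : Type) (s : seq I) (x : I -> R) (x0 : R) :
  (forall i, `|x i| <= x0) -> (forall i, `|x i| <= B) ->
  `|\prod_(i <- s) (1 + x i) - 1 - \sum_(i <- s) x i| <= prod_remainder (size s) * x0 ^+ 2.
Proof.
move=> xx0 xB; elim: s => [|i s IH]; first by rewrite !big_nil subrr subr0 normr0 mul0r.
rewrite !big_cons /=; set p := \prod_(_ <- _) _ in IH *; set q := \sum_(_ <- _) _ in IH *.
have q_le : `|q| <= (size s)%:R * x0.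
  apply: le_trans (ler_norm_sum _ _ _) _.
  rewrite mulr_natl -(count_predT s) -iter_addr_0 -big_const_seq.
  exact: ler_sum.
have -> : (1 + x i) * p - 1 - (x i + q) = x i * q + (1 + x i) * (p - 1 - q) by ring.
apply: le_trans (ler_normD _ _) _; rewrite !normrM mulrDl; apply: lerD.
  apply: le_trans (ler_pM (normr_ge0 _) (normr_ge0 _) (xx0 i) q_le) _.
  by rewrite mulrCA expr2.
rewrite -mulrA; apply: ler_pM => //.
by apply: le_trans (ler_normD _ _) _; rewrite normr1 lerD2l.
Qed.

End ProductExpansion.

Section CountVectors.
Variables (R : realType) (T : finType) (b : nat).
Local Notation state := {ffun T -> 'I_b.+1}.
Variables (feas : pred state) (lam : T -> R) (c0 : state) (kap B : R).
Implicit Types (c : state) (H : {set T}).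

Definition count_weight c : R := \prod_t ((c t)`!%:R)^-1.
Local Notation W := count_weight.
Local Notation E := (wmean feas W).

Hypotheses (b_gt0 : (0 < b)%N) (kap_gt0 : 0 < kap) (B_ge0 : 0 <= B).
Hypotheses (lam_ge : forall t, kap * b%:R <= lam t) (lam_le : forall t, lam t <= b%:R).
Hypotheses (c0_feas : feas c0) (c0_near : forall t, `|(c0 t)%:R - lam t| <= B)
           (c0_ge : forall t, kap * b%:R <= (c0 t)%:R).
(** This makes [lam] critical: multiplying the weight by the powers of [lam] does not change the law
    on feasible states, so inverse factorials may be replaced by Poisson weights of mean [lam]. *)
Hypothesis lam_prod : forall c, feas c ->
  \prod_t lam t ^+ c t = \prod_t lam t ^+ c0 t.

Let bR : 0 < b%:R :> R. Proof. by rewrite ltr0n. Qed.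
Let lam_gt0 t : 0 < lam t. Proof. by apply: lt_le_trans (lam_ge t); rewrite mulr_gt0. Qed.

Lemma count_weight_gt0 c : 0 < W c.
Proof. by apply: prodr_gt0 => t _; rewrite invr_gt0 ltr0n fact_gt0. Qed.

Lemma sum_count_weight_gt0 : 0 < \sum_(c | feas c) W c.
Proof.
rewrite (bigD1 c0) //= ltr_pwDl ?count_weight_gt0 // sumr_ge0 // => c _.
by rewrite ltW ?count_weight_gt0.
Qed.

Let W0 c (_ : feas c) : 0 <= W c. Proof. by rewrite ltW ?count_weight_gt0. Qed.
Let Wg0 := sum_count_weight_gt0.

Definition quad_dev c : R := \sum_t ((c t)%:R - (c0 t)%:R) ^+ 2 / (2 * b%:R).

Lemma count_weight_le c : feas c ->
  W c <= W c0 * expR (#|T|%:R * (B / kap + 1) - quad_dev c).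
Proof.
move=> fc; have Lg : 0 < \prod_t lam t ^+ c0 t by apply: prodr_gt0 => t _; rewrite exprn_gt0.
have WE c' : \prod_t lam t ^+ c' t * W c' = \prod_t (lam t ^+ c' t / (c' t)`!%:R).
  by rewrite -big_split.
rewrite -(ler_pM2l Lg) -{1}(lam_prod fc) mulrA !WE.
rewrite mulr_natl -sumr_const -sumrB expR_sum -big_split /=; apply: ler_prod => t _.
rewrite mulr_ge0 ?invr_ge0 ?exprn_ge0 ?(ltW (lam_gt0 t)) //=.
by apply: (@poisson_weight_le R b) => //; rewrite -ltnS.
Qed.

(** Logarithm of the number [b.+1 ^ #|T|] of all states, plus the constant lost in
    [count_weight_le]. *)
Definition log_state_bound : R := #|T|%:R * (B / kap + 1 + ln b.+1%:R).
Local Notation L := log_state_bound.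

Lemma log_state_bound_ge0 : 0 <= L.
Proof.
rewrite mulr_ge0 // addr_ge0 ?ln_ge0 ?ler1n // addr_ge0 // mulr_ge0 // invr_ge0.
exact: ltW.
Qed.

(** The normalising sum is bounded below by the single term [W c0]; in the numerator each term is at
    most [W c0] divided by the number of states. *)
Lemma wmean_expR_quad_dev : E (fun c => expR (quad_dev c - L)) <= 1.
Proof.
rewrite /wmean ler_pdivrMr // mul1r.
apply: (@le_trans _ _ (W c0)); last first.
  by rewrite (bigD1 c0) //= lerDl sumr_ge0 // => c _; rewrite ltW ?count_weight_gt0.
apply: (@le_trans _ _ (\sum_(c | feas c) W c0 * expR (- (#|T|%:R * ln b.+1%:R)))).
  apply: ler_sum => c fc; apply: le_trans (ler_wpM2r (expR_ge0 _) (count_weight_le fc)) _.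
  rewrite -mulrA -expRD ler_pM2l ?count_weight_gt0 // ler_expR /L.
  by rewrite le_eqVlt; apply/orP; left; apply/eqP; ring.
rewrite -mulr_sumr ger_pMr ?count_weight_gt0 // sumr_const -mulr_natl expRN mulr_natl.
rewrite expRM_natl lnK ?posrE // -natrX -[X in X <= _]mulr_natl ler_pdivrMr ?ltr0n ?expn_gt0 // mul1r.
rewrite ler_nat (leq_trans (max_card _)) //.
by rewrite card_ffun card_ord.
Qed.

(** Below [L] the square is trivially bounded. Above it, with excess x, (L + x)^2 <= 2 L^2 + 2 x^2
    and x^2 <= 4 exp x, and the exponential has mean at most 1. *)
Lemma wmean_quad_dev_sqr : E (fun c => quad_dev c ^+ 2) <= 2 * L ^+ 2 + 8.
Proof.
have qd c : 0 <= quad_dev c.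
  by apply: sumr_ge0 => t _; rewrite mulr_ge0 ?sqr_ge0 // invr_ge0 mulr_ge0.
have h c : quad_dev c ^+ 2 <= 2 * L ^+ 2 + 8 * expR (quad_dev c - L).
  have L0 := log_state_bound_ge0; have [qL|Lq] := leP (quad_dev c) L.
    apply: (@le_trans _ _ (L ^+ 2)); first by rewrite ler_sqr ?nnegrE.
    by have := expR_ge0 (quad_dev c - L); have := sqr_ge0 L; lra.
  set x := quad_dev c - L; have x0 : 0 < x by rewrite subr_gt0.
  have -> : quad_dev c = L + x by rewrite /x addrC subrK.
  have e2 : x ^+ 2 / 4 <= expR x.
    have := expR_ge1Dx (x / 2); have -> : expR x = expR (x / 2) ^+ 2.
      by rewrite expr2 -expRD; congr expR; field.
    move=> h; have : (1 + x / 2) ^+ 2 <= expR (x / 2) ^+ 2 by rewrite ler_sqr ?nnegrE; lra.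
    by nra.
  by have := sqr_ge0 (L - x); nra.
apply: le_trans (le_wmean W0 Wg0 (fun c _ => h c)) _.
rewrite wmeanD wmean_cst // lerD2l wmeanZ -[leRHS]mulr1 ler_pM2l //.
exact: wmean_expR_quad_dev.
Qed.

Definition scaled_dev c : R := Num.sqrt (\sum_t ((c t)%:R - lam t) ^+ 2 / b%:R).
Local Notation v := scaled_dev.

(** Squaring [scaled_dev_sqr] gives v^4 <= 32 [quad_dev]^2 + 8 (#|T| B^2)^2, and 32 (2 L^2 + 8) = 64
    L^2 + 256. *)
Definition fourth_moment_bound : R := 64 * L ^+ 2 + 256 + 8 * (#|T|%:R * B ^+ 2) ^+ 2.
Local Notation Q := fourth_moment_bound.

Lemma scaled_dev_sqr c : v c ^+ 2 <= 4 * quad_dev c + 2 * (#|T|%:R * B ^+ 2).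
Proof.
rewrite sqr_sqrtr; last first.
  by apply: sumr_ge0 => t _; rewrite mulr_ge0 ?sqr_ge0 // invr_ge0 ltW.
rewrite /quad_dev (_ : #|T|%:R * B ^+ 2 = \sum_(t : T) B ^+ 2); last by rewrite sumr_const mulr_natl.
rewrite !mulr_sumr -big_split /=; apply: ler_sum => t _.
rewrite ler_pdivrMr //.
have -> : (4 * (((c t)%:R - (c0 t)%:R) ^+ 2 / (2 * b%:R)) + 2 * B ^+ 2) * b%:R
    = 2 * ((c t)%:R - (c0 t)%:R) ^+ 2 + 2 * B ^+ 2 * b%:R by field; rewrite gt_eqF.
apply: (@le_trans _ _ (2 * ((c t)%:R - (c0 t)%:R) ^+ 2 + 2 * B ^+ 2)); last first.
  by rewrite lerD2l ler_peMr ?mulr_ge0 ?sqr_ge0 // ler1n.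
have : ((c0 t)%:R - lam t) ^+ 2 <= B ^+ 2.
  by rewrite -real_normK ?num_real // ler_sqr ?nnegrE.
have := sqr_ge0 (((c t)%:R - (c0 t)%:R) - ((c0 t)%:R - lam t)).
by nra.
Qed.

Lemma wmean_scaled_dev4 : E (fun c => v c ^+ 4) <= Q.
Proof.
have h c : v c ^+ 4 <= 32 * quad_dev c ^+ 2 + 8 * (#|T|%:R * B ^+ 2) ^+ 2.
  have h := scaled_dev_sqr c.
  have : (v c ^+ 2) ^+ 2 <= (4 * quad_dev c + 2 * (#|T|%:R * B ^+ 2)) ^+ 2.
    by rewrite ler_sqr ?nnegrE ?sqr_ge0 // (le_trans _ h) ?sqr_ge0.
  rewrite -exprM; have := sqr_ge0 (4 * quad_dev c - 2 * (#|T|%:R * B ^+ 2)); nra.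
apply: le_trans (le_wmean W0 Wg0 (fun c _ => h c)) _.
rewrite wmeanD wmeanZ wmean_cst // /Q; have := wmean_quad_dev_sqr; lra.
Qed.

Lemma wmean_scaled_dev j : (j <= 4)%N -> E (fun c => v c ^+ j) <= 1 + Q.
Proof.
move=> j4; have h c : v c ^+ j <= 1 + v c ^+ 4.
  have v0 : 0 <= v c by exact: sqrtr_ge0.
  have [v1|v1] := leP (v c) 1.
    by apply: (@le_trans _ _ 1); rewrite ?exprn_ile1 // lerDl exprn_ge0.
  apply: (@le_trans _ _ (v c ^+ 4)); last by rewrite lerDr.
  by apply: ler_weXn2l => //; exact: ltW.
apply: le_trans (le_wmean W0 Wg0 (fun c _ => h c)) _.
by rewrite wmeanD wmean_cst // lerD2l wmean_scaled_dev4.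
Qed.

Lemma count_dev_le c t : `|(c t)%:R - lam t| <= Num.sqrt b%:R * v c.
Proof.
rewrite -sqrtrM ?ler0n // -sqrtr_sqr ler_sqrt ?mulr_ge0 //; last first.
  by apply: sumr_ge0 => t' _; rewrite mulr_ge0 ?sqr_ge0 // invr_ge0 ltW.
rewrite mulr_sumr (bigD1 t) //= mulrCA divff ?gt_eqF // mulr1 lerDl.
by apply: sumr_ge0 => t' _; rewrite mulr_ge0 ?(ltW bR) // mulr_ge0 ?sqr_ge0 ?invr_ge0 ?(ltW bR).
Qed.

(** Truncated subtraction and [inord] give a meaningless value out of range; [movable] excludes this
    for feasible states in which every type of [Hm] occurs. *)
Definition move (Hp Hm : {set T}) c : state :=
  [ffun t => inord (c t + (t \in Hp) - (t \in Hm))].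

Definition movable (Hp Hm : {set T}) := forall c, feas c -> {in Hm, forall t, (0 < c t)%N} ->
  feas (move Hp Hm c) /\ forall t, (c t + (t \in Hp) - (t \in Hm) <= b)%N.

Variables (Hp Hm : {set T}) (r : T).
Hypotheses (Hpm : [disjoint Hp & Hm]) (mv : movable Hp Hm) (mv' : movable Hm Hp).
Hypothesis lam_bal : \prod_(t in Hp) lam t = \prod_(t in Hm) lam t.

Definition exch t : R := (t \in Hp)%:R - (t \in Hm)%:R.

Let notboth t : t \in Hp -> t \in Hm = false.
Proof. by move=> tp; exact: disjointFr Hpm tp. Qed.

(* The substitution [c |-> move Hp Hm c] maps [W c * \prod_(t in Hm) c t] to
   [W c * \prod_(t in Hp) c t], since the weight is a product of inverse factorials. *)
Lemma exchange_identity (f : R -> R) :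
  \sum_(c | feas c) W c * (f (c r)%:R * \prod_(t in Hm) (c t)%:R) =
  \sum_(c | feas c) W c * (f ((c r)%:R - exch r) * \prod_(t in Hp) (c t)%:R).
Proof.
(* A state that lacks a type of [H] contributes zero; on the remaining states the two moves are
   inverse to each other. *)
have restrict (H : {set T}) (F : state -> R) :
  \sum_(c | feas c) W c * (F c * \prod_(t in H) (c t)%:R) =
  \sum_(c | feas c && [forall t in H, (0 < c t)%N]) W c * (F c * \prod_(t in H) (c t)%:R).
  rewrite [LHS](bigID (fun c : state => [forall t in H, (0 < c t)%N])) /= [X in _ + X]big1 ?addr0 //.
  move=> c /andP[_]; rewrite negb_forall_in => /exists_inP[t tH]; rewrite -eqn0Ngt => /eqP ct.
  by rewrite (bigD1 t) //= ct mul0r mulr0 mulr0.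
rewrite !restrict.
have mvE c (A C : {set T}) : [disjoint A & C] -> movable A C -> feas c ->
    [forall t in C, (0 < c t)%N] ->
  [/\ feas (move A C c), [forall t in A, (0 < move A C c t)%N],
      move C A (move A C c) = c &
      forall t, move A C c t = (c t + (t \in A) - (t \in C))%N :> nat].
  move=> dAC mAC fc /forall_inP cC; have [f1 f2] := mAC c fc cC.
  have nE t : move A C c t = (c t + (t \in A) - (t \in C))%N :> nat.
    by rewrite ffunE inordK // ltnS.
  split=> //.
    by apply/forall_inP => t tA; rewrite nE tA (disjointFr dAC tA) subn0 addn1.
  apply/ffunP => t; apply: val_inj; rewrite ffunE /=.
  have eqc : (move A C c t + (t \in C) - (t \in A) = c t)%N.
    rewrite nE; have [tA|tA] := boolP (t \in A).
      by rewrite (disjointFr dAC tA) /= subn0 addn0 addnK.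
    by have [/cC ct|_] := boolP (t \in C); rewrite /= addn0 subn0 ?addn0 ?subn0 // subnK.
  by rewrite inordK eqc.
have Hmp : [disjoint Hm & Hp] by rewrite disjoint_sym.
rewrite (reindex_onto (move Hm Hp) (move Hp Hm)) /=; last first.
  by move=> c /andP[fc cm]; have [] := mvE c Hp Hm Hpm mv fc cm.
apply: eq_big => [c|c].
  apply/idP/idP => [/andP[/andP[f1 f2] /eqP f3]|/andP[fc cp]].
    by have [] := mvE _ Hp Hm Hpm mv f1 f2; rewrite f3 => -> ->.
  by have [-> -> -> _] := mvE _ Hm Hp Hmp mv' fc cp; rewrite eqxx.
move=> /andP[/andP[f1 f2] /eqP f3].
have [fc cp _ _] := mvE _ Hp Hm Hpm mv f1 f2; rewrite f3 in fc cp.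
have [_ _ _ nE] := mvE _ Hm Hp Hmp mv' fc cp.
have -> : (move Hm Hp c r)%:R = (c r)%:R - exch r :> R.
  rewrite nE /exch; have [rp|rp] := boolP (r \in Hp).
    rewrite (notboth rp) addn0 subr0 natrB //; exact: (forall_inP cp).
  by rewrite subn0 natrD sub0r opprK.
rewrite mulrCA [RHS]mulrCA; congr (_ * _).
rewrite /W [\prod_(t in Hm) _]big_mkcond [\prod_(t in Hp) _]big_mkcond -!big_split /=.
apply: eq_bigr => t _; rewrite nE.
have [tp|tp] := boolP (t \in Hp).
  rewrite (notboth tp) addn0 mulr1; have := forall_inP cp t tp.
  case: (c t : nat) => // k _; rewrite subn1 /= factS natrM invfM mulrAC mulVf ?mul1r //.
have [tm|tm] /= := boolP (t \in Hm); rewrite ?addn0 subn0 // addn1 mulr1.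
by rewrite factS natrM invfM mulrAC mulVf ?mul1r.
Qed.

(** The first term bounds the mean of the linear part; of the 5 remainders, one comes from the mean
    of [Rx Hp] and four from the products of the centred count with [Rx Hm] and [Rx Hp]. *)
Definition stein_constant : R :=
  #|T|%:R / kap + 5 * prod_remainder (1 / kap) #|T| / kap ^+ 2.

Let x c t : R := ((c t)%:R - lam t) / lam t.
Let Sx H c := \sum_(t in H) x c t.
Let Rx H c := \prod_(t in H) (1 + x c t) - 1 - Sx H c.
Let y c := v c / (kap * Num.sqrt b%:R).

Let sb : 0 < Num.sqrt b%:R :> R. Proof. by rewrite sqrtr_gt0. Qed.
Let y0 c : 0 <= y c.
Proof. by rewrite mulr_ge0 ?sqrtr_ge0 // invr_ge0 mulr_ge0 ?sqrtr_ge0 // ltW. Qed.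

Let x_le c t : `|x c t| <= y c.
Proof.
rewrite normrM normfV (gtr0_norm (lam_gt0 t)) ler_pdivrMr //.
apply: le_trans (count_dev_le c t) _; rewrite /y.
apply: (@le_trans _ _ (v c / (kap * Num.sqrt b%:R) * (kap * b%:R))); last first.
  by apply: ler_wpM2l => //; exact: y0.
have := sb; have : b%:R = Num.sqrt b%:R ^+ 2 :> R by rewrite sqr_sqrtr.
move: (Num.sqrt b%:R) => s -> s0; rewrite le_eqVlt; apply/orP; left; apply/eqP.
by field; rewrite !gt_eqF.
Qed.

Let x_le1 c t : `|x c t| <= 1 / kap.
Proof.
rewrite normrM normfV (gtr0_norm (lam_gt0 t)) ler_pdivrMr //.
apply: (@le_trans _ _ (1 / kap * (kap * b%:R))); last first.
  by rewrite ler_wpM2l // mulr_ge0 // invr_ge0 ltW.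
have -> : 1 / kap * (kap * b%:R) = b%:R by field; rewrite gt_eqF.
have := lam_le t; have := lam_gt0 t; have : (c t)%:R <= b%:R :> R by rewrite ler_nat -ltnS.
by rewrite ler_norml; have := ler0n R (c t); lra.
Qed.

Let Sx_le H c : `|Sx H c| <= #|T|%:R * y c.
Proof.
apply: le_trans (ler_norm_sum _ _ _) _.
apply: (@le_trans _ _ (\sum_(t in H) y c)); first exact: ler_sum.
by rewrite sumr_const -[leLHS]mulr_natl ler_wpM2r // ler_nat max_card.
Qed.

Let Rx_le H c : `|Rx H c| <= prod_remainder (1 / kap) #|T| * y c ^+ 2.
Proof.
have kap1 : 0 <= 1 / kap by rewrite mulr_ge0 // invr_ge0 ltW.
rewrite /Rx /Sx -big_enum -[X in _ - X]big_enum /=.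
have h := prod_expand (enum H) (x_le c) (x_le1 c); apply: le_trans h _.
rewrite ler_wpM2r ?sqr_ge0 // prod_remainder_le // -cardE max_card //.
Qed.

Let Q_ge0 : 0 <= Q.
Proof.
rewrite /Q; have := sqr_ge0 L; have := sqr_ge0 (#|T|%:R * B ^+ 2); lra.
Qed.

(** This is [exchange_identity] for the centred count, divided by the product of [lam] that both
    sides share by [lam_bal]; the products of counts become products of [1 + x], hence
    [1 + Sx + Rx]. *)
Lemma stein_identity : let f c := (c r)%:R - E (fun c => (c r)%:R) in
  E (fun c => f c * (1 + Sx Hm c + Rx Hm c)) =
  E (fun c => (f c - exch r) * (1 + Sx Hp c + Rx Hp c)).
Proof.
move=> f; set m := E _ in f *.
have bal (H : {set T}) (F : state -> R) : \prod_(t in H) lam t = \prod_(t in Hm) lam t ->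
  E (fun c => F c * (1 + Sx H c + Rx H c)) =
  (\prod_(t in Hm) lam t)^-1 * E (fun c => F c * \prod_(t in H) (c t)%:R).
  move=> e; rewrite -wmeanZ; apply: eq_wmean => c _.
  have -> : 1 + Sx H c + Rx H c = \prod_(t in H) (1 + x c t) by rewrite /Rx; ring.
  rewrite mulrCA; congr (_ * _); rewrite -e -prodfV -big_split; apply: eq_bigr => t _ /=.
  by rewrite /x; field; rewrite gt_eqF.
rewrite !bal //; congr (_ * (_ / _)).
rewrite (exchange_identity (fun z => z - m)).
by apply: eq_bigr => c _; rewrite /f addrAC.
Qed.

(** The centred count has mean zero, so the constant terms of [stein_identity] leave [exch r] and
    the linear terms leave the covariance. The centred count is of order sqrt b times [v] and the
    remainders of order [v ^+ 2] / b, so their products are of order 1 / sqrt b once third moments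
    are bounded. *)
Theorem exchange_covariance :
  `|wcov feas W (fun c => (c r)%:R) (fun c => \sum_t exch t * ((c t)%:R / lam t)) - exch r|
  <= stein_constant * (1 + Q) ^+ 2 / Num.sqrt b%:R.
Proof.
set m := E (fun c => (c r)%:R); pose f c := (c r)%:R - m.
have Ef : E f = 0 by rewrite wmeanB wmean_cst // subrr.
have covE : wcov feas W (fun c => (c r)%:R) (fun c => \sum_t exch t * ((c t)%:R / lam t)) =
    E (fun c => f c * (Sx Hp c - Sx Hm c)).
  have e c : feas c -> \sum_t exch t * ((c t)%:R / lam t) =
      (Sx Hp c - Sx Hm c) + (#|Hp|%:R - #|Hm|%:R).
    move=> _; have S1 (H : {set T}) : Sx H c + #|H|%:R = \sum_t (t \in H)%:R * ((c t)%:R / lam t).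
      rewrite -sum1_card natr_sum -big_split /= [LHS]big_mkcond /=; apply: eq_bigr => t _.
      by case: (t \in H); rewrite ?mul0r // mul1r /x; field; rewrite gt_eqF.
    rewrite addrACA -opprD !S1 -sumrB; apply: eq_bigr => t _; rewrite /exch; ring.
  rewrite (eq_wcov W (fun c _ => erefl _) e) wcov_addcr // /wcov -/m.
  rewrite -wmeanZ -wmeanB; apply: eq_wmean => c _; rewrite /f; ring.
have key : E (fun c => f c * (Sx Hp c - Sx Hm c)) - exch r =
   exch r * (E (Sx Hp) + E (Rx Hp)) + E (fun c => f c * (Rx Hm c - Rx Hp c)).
  have := stein_identity; rewrite /= -/m -/(f) => id.
  have : E (fun c => f c * (1 + Sx Hm c + Rx Hm c)) =
      E f + E (fun c => f c * Sx Hm c) + E (fun c => f c * Rx Hm c).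
    by rewrite -!wmeanD; apply: eq_wmean => c _; ring.
  have : E (fun c => (f c - exch r) * (1 + Sx Hp c + Rx Hp c)) =
      E f + E (fun c => f c * Sx Hp c) + E (fun c => f c * Rx Hp c)
      - exch r * (1 + E (Sx Hp) + E (Rx Hp)).
    rewrite -[X in _ - _ * (X + _ + _)](@wmean_cst _ _ feas W) // -!wmeanD -wmeanZ -wmeanB.
    by apply: eq_wmean => c _; ring.
  rewrite (_ : E (fun c => f c * (Sx Hp c - Sx Hm c)) =
     E (fun c => f c * Sx Hp c) - E (fun c => f c * Sx Hm c)); last first.
    by rewrite -wmeanB; apply: eq_wmean => c _; ring.
  rewrite (_ : E (fun c => f c * (Rx Hm c - Rx Hp c)) =
     E (fun c => f c * Rx Hm c) - E (fun c => f c * Rx Hp c)); last first.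
    by rewrite -wmeanB; apply: eq_wmean => c _; ring.
  by rewrite /f in id *; rewrite id => -> ; lra.
rewrite covE key; set s := Num.sqrt b%:R; set Kp := prod_remainder (1 / kap) #|T|.
have s1 : 1 <= s by rewrite -(sqrtr1 R) ler_sqrt ?ler1n // ltW.
have s_gt0 : 0 < s by exact: lt_le_trans s1.
have Kp0 : 0 <= Kp by rewrite prod_remainder_ge0 // mulr_ge0 // invr_ge0 ltW.
set q := 1 + Q; have q1 : 1 <= q by rewrite lerDl.
have Ev j : (j <= 4)%N -> E (fun c => v c ^+ j) <= q := @wmean_scaled_dev j.
have Ev1 : E v <= q by apply: le_trans (Ev 1%N isT); exact: le_wmean.
have v0 c : 0 <= v c by exact: sqrtr_ge0.
have Ev0 : 0 <= E v by exact: wmean_ge0.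
have absE (g : state -> R) (h : state -> R) (C : R) : (forall c, `|g c| <= C * h c) ->
    `|E g| <= C * E h.
  move=> gh; apply: le_trans (ler_norm_wmean W0 Wg0 _) _; rewrite -wmeanZ.
  exact: le_wmean.
have bS : `|E (Sx Hp)| <= #|T|%:R / kap * q / s.
  apply: le_trans (absE _ v (#|T|%:R / (kap * s)) _) _.
    by move=> c; apply: le_trans (Sx_le Hp c) _; rewrite /y -mulrA [(_^-1) * _]mulrC.
  rewrite invfM -!mulrA ler_wpM2l // ler_wpM2l ?invr_ge0 ?(ltW kap_gt0) //.
  by rewrite mulrC ler_pM2r ?invr_gt0.
have yE c : y c ^+ 2 = (kap ^+ 2 * s ^+ 2)^-1 * v c ^+ 2.
  by rewrite /y exprMn exprVn exprMn mulrC.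
have bR2 H : `|E (Rx H)| <= Kp / kap ^+ 2 * q / s.
  apply: le_trans (absE _ (fun c => v c ^+ 2) (Kp / (kap ^+ 2 * s ^+ 2)) _) _.
    by move=> c; apply: le_trans (Rx_le H c) _; rewrite yE mulrA.
  rewrite invfM mulrA -!mulrA ler_wpM2l // ler_wpM2l ?invr_ge0 ?exprn_ge0 ?(ltW kap_gt0) //.
  rewrite mulrC; apply: ler_pM; rewrite ?invr_ge0 ?exprn_ge0 ?(ltW s_gt0) ?Ev //.
    by apply: wmean_ge0 => // c _; rewrite exprn_ge0.
  by rewrite lef_pV2 ?posrE ?exprn_gt0 // expr2 ler_peMl // ltW.
have fle c : `|f c| <= s * (v c + E v).
  have -> : f c = ((c r)%:R - lam r) - E (fun c => (c r)%:R - lam r).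
    by rewrite wmeanB wmean_cst // -/m /f; ring.
  rewrite mulrDr; apply: le_trans (ler_normB _ _) _; apply: lerD; first exact: count_dev_le.
  by apply: absE => c'; exact: count_dev_le.
have bF : `|E (fun c => f c * (Rx Hm c - Rx Hp c))| <= 4 * (Kp / kap ^+ 2) * q ^+ 2 / s.
  apply: le_trans (absE _ (fun c => v c ^+ 3 + E v * v c ^+ 2) (2 * Kp / (kap ^+ 2 * s)) _) _.
    move=> c; rewrite normrM.
    have rr : `|Rx Hm c - Rx Hp c| <= 2 * Kp * y c ^+ 2.
      apply: le_trans (ler_normB _ _) _; have := Rx_le Hm c; have := Rx_le Hp c.
      by rewrite -/Kp; lra.
    apply: le_trans (ler_pM (normr_ge0 _) (normr_ge0 _) (fle c) rr) _.
    rewrite yE le_eqVlt; apply/orP; left; apply/eqP; field.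
    by rewrite !gt_eqF.
  rewrite wmeanD wmeanZ.
  apply: (@le_trans _ _ (2 * Kp / (kap ^+ 2 * s) * (2 * q ^+ 2))); last first.
    by rewrite le_eqVlt; apply/orP; left; apply/eqP; field; rewrite !gt_eqF.
  rewrite ler_wpM2l ?mulr_ge0 ?invr_ge0 ?mulr_ge0 ?sqr_ge0 ?(ltW s_gt0) ?(ltW kap_gt0) //.
  have h3 := Ev 3%N isT; have h2 := Ev 2%N isT.
  have h : E v * E (fun c => v c ^+ 2) <= q * q.
    by apply: ler_pM => //; apply: wmean_ge0 => // c _; rewrite exprn_ge0.
  have : q <= q ^+ 2 by rewrite expr2 ler_peMl // (le_trans _ q1).
  by move: h; rewrite -expr2; lra.
have ex : `|exch r| <= 1.
  by rewrite /exch; case: (r \in Hp); case: (r \in Hm); rewrite ?subrr ?subr0 ?sub0r ?normrN ?normr1 ?normr0.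
apply: le_trans (ler_normD _ _) _.
apply: le_trans (lerD _ bF) _.
  rewrite normrM; apply: le_trans (ler_pM (normr_ge0 _) (normr_ge0 _) ex (ler_normD _ _)) _.
  by rewrite mul1r; exact: lerD bS (bR2 Hp).
rewrite /stein_constant -/Kp -/s -!mulrDl ler_pM2r ?invr_gt0 //.
have qq : q <= q ^+ 2 by rewrite expr2 ler_peMl // (le_trans _ q1).
have k0 : 0 <= #|T|%:R / kap by rewrite mulr_ge0 // invr_ge0 ltW.
have k1 : 0 <= Kp / kap ^+ 2 by rewrite mulr_ge0 // invr_ge0 sqr_ge0.
have := ler_wpM2l k0 qq; have := ler_wpM2l k1 qq.
have -> : 5 * Kp / kap ^+ 2 = 5 * (Kp / kap ^+ 2) by rewrite mulrA.
by move: k0 k1 => _ _; move: (#|T|%:R / kap) (Kp / kap ^+ 2) => A1 A2; rewrite !mulrDl; lra.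
Qed.

End CountVectors.

(** * From uniform tilings to count vectors *)

Section UniformCounts.
Variables (R : realType) (Pt V T : finType) (tg : Pt -> V) (ty : T -> V -> nat).
Hypothesis ty_inj : forall t t' : T, ty t =1 ty t' -> t = t'.
Hypothesis ty_neq0 : forall t : T, exists v : V, (0 < ty t v)%N.
Variables (D : {set Pt}) (b kap : nat).

Definition balanced (c : T -> nat) : bool :=
  [forall v, #|fiber tg D v| == \sum_t c t * ty t v]%N.

Hypothesis balanced_le : forall c, balanced c -> forall t, (c t <= b)%N.
Hypothesis kap_gt0 : (0 < kap)%N.
(** The factorials of the multiplicities inside the tiles form one common factor, so that only the
    inverse factorials of the counts remain in the law. *)
Hypothesis balanced_kap : forall c, balanced c ->
  (\prod_t (\prod_v (ty t v)`!) ^ c t)%N = kap.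

Local Notation tps := (typed_partitions tg ty D).

Lemma type_count_balanced P : P \in tps -> balanced (type_count tg ty P).
Proof.
rewrite inE => /andP[PD /forall_inP Pt']; apply/forallP => v; apply/eqP.
transitivity (\sum_(B in P) #|fiber tg B v|)%N.
  rewrite -sum1_card -(cover_partition PD).
  rewrite (eq_bigl (fun q => (q \in finset.cover P) && (tg q == v))); last by move=> q; rewrite in_fiber.
  rewrite finset.big_trivIset_cond; last by case/and3P: PD.
  by apply: eq_bigr => B _; rewrite -sum1_card; apply: eq_bigl => q; rewrite in_fiber.
rewrite (eq_bigr (fun B => \sum_t has_type tg ty t B * ty t v)%N); last first.
  move=> B /Pt'/existsP[t Bt]; rewrite (bigD1 t) //= Bt mul1n big1 ?addn0.
    by move/forallP/(_ v)/eqP: Bt.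
  by move=> t' ne; case: (boolP (has_type _ _ t' B)) => // /(has_type_inj ty_inj Bt) e; rewrite e eqxx in ne.
rewrite exchange_big; apply: eq_bigr => t _ /=; rewrite -big_distrl; congr (_ * _)%N.
rewrite /type_count -sum1_card -big_mkcondr; apply: eq_bigl => B; by rewrite inE.
Qed.

Definition counts_of (P : {set {set Pt}}) : {ffun T -> 'I_b.+1} :=
  [ffun t => inord (type_count tg ty P t)].

Lemma counts_ofE P t : P \in tps -> counts_of P t = type_count tg ty P t :> nat.
Proof. by move=> /type_count_balanced/balanced_le h; rewrite ffunE inordK // ltnS. Qed.

Definition balanced_state (c : {ffun T -> 'I_b.+1}) : bool := balanced (fun t => c t).

(** Partitions are grouped by their counts, and [profile_countE] gives the size of each group. *)
Lemma sum_typed_partitions (F : {ffun T -> 'I_b.+1} -> R) :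
  \sum_(P in tps) F (counts_of P) =
  ((\prod_v (#|fiber tg D v|)`!)%:R / kap%:R) *
  \sum_(c | balanced_state c) count_weight R c * F c.
Proof.
rewrite (partition_big counts_of balanced_state) /=; last first.
  move=> P Ptp; rewrite /balanced_state; have := type_count_balanced Ptp.
  congr (is_true _); apply: eq_forallb => v; congr (_ == _); apply: eq_bigr => t _.
  by rewrite counts_ofE.
rewrite mulr_sumr; apply: eq_bigr => c cb.
rewrite (eq_bigr (fun=> F c)); last by move=> P /andP[_ /eqP ->].
rewrite sumr_const -[LHS]mulr_natl mulrA; congr (_ * _).
have pE : #|[pred P | (P \in tps) && (counts_of P == c)]| = profile_count tg ty D (fun t => c t).
  apply: eq_card => P; rewrite [RHS]inE [LHS]inE; apply: andb_id2l => Ptp.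
  apply/eqP/forallP => [<- t|h]; first by rewrite counts_ofE.
  by apply/ffunP => t; apply: val_inj; rewrite /= (counts_ofE _ Ptp); apply/eqP.
have := @profile_countE _ _ _ tg ty ty_inj ty_neq0 D (fun t => c t) _.
rewrite (balanced_kap cb) => /(_ (fun v => eqP (forallP cb v))) /(congr1 (fun k => k%:R : R)).
rewrite !natrM -pE => <-.
rewrite /count_weight prodfV natr_prod; field.
rewrite pnatr_eq0 -lt0n kap_gt0 andbT; apply/prodf_neq0 => t _.
by rewrite pnatr_eq0 -lt0n fact_gt0.
Qed.

Lemma unif_mean_counts (F : {ffun T -> 'I_b.+1} -> R) :
  unif_mean tps (fun P => F (counts_of P)) = wmean balanced_state (@count_weight R T b) F.
Proof.
rewrite /unif_mean sum_typed_partitions -sum1_card natr_sum.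
rewrite (sum_typed_partitions (fun=> 1)) /wmean.
have -> : \sum_(c | balanced_state c) count_weight R c * 1 = \sum_(c | balanced_state c) count_weight R c.
  by apply: eq_bigr => c _; rewrite mulr1.
rewrite -mulf_div divff ?mul1r // mulf_neq0 ?invr_eq0 ?pnatr_eq0 -?lt0n //.
by rewrite prodn_gt0 // => v; rewrite fact_gt0.
Qed.

Lemma card_tps_gt0 : (0 < #|tps|)%N -> exists c, balanced_state c.
Proof.
rewrite card_gt0 => /set0Pn[P Ptp]; exists (counts_of P); rewrite /balanced_state.
have := type_count_balanced Ptp; congr (is_true _); apply: eq_forallb => v; congr (_ == _).
by apply: eq_bigr => t _; rewrite counts_ofE.
Qed.

End UniformCounts.

Local Open Scope complex_scope.
Local Open Scope ring_scope.

(** * Unit complex numbers and their angles *)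

Section Expi.
Variable R : realType.
Implicit Types t s : R.

Lemma expi0 : expi 0 = 1 :> R[i].
Proof. by rewrite /expi cos0 sin0. Qed.

Lemma expiD t s : expi (t + s) = expi t * expi s.
Proof.
by apply/eqP; rewrite /expi cosD sinD eq_complex /= eqxx /= addrC.
Qed.

Lemma expiMn t (k : nat) : expi (t *+ k) = expi t ^+ k.
Proof. by elim: k => [|k IH]; rewrite ?expi0 // mulrS expiD IH exprS. Qed.

Lemma expiN t : expi (- t) = (expi t)^*.
Proof. by apply/eqP; rewrite /expi cosN sinN eq_complex /= !eqxx. Qed.

Lemma expi_2pi : expi (2 * pi) = 1 :> R[i].
Proof. by rewrite /expi -[2 * pi]addr0 mulr_natl addrC cosD2pi sinD2pi cos0 sin0. Qed.

Lemma expi_eq1 t : 0 <= t -> t < 2 * pi -> expi t = 1 -> t = 0.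
Proof.
move=> t0 t1 /eqP; rewrite eq_complex /= => /andP[/eqP ct _].
apply/eqP; rewrite eq_le t0 andbT leNgt; apply/negP => tgt.
have : 0 < sin (t / 2) by apply: sin_gt0_pi; lra.
have := cos_mulr2n (t / 2); rewrite -[_ *+ 2]mulr_natr divfK ?pnatr_eq0 // ct.
by have := cos2Dsin2 (t / 2); nra.
Qed.

Lemma normr_expi t : `|expi t| = 1.
Proof. by rewrite /expi normc_def /= cos2Dsin2 sqrtr1. Qed.

Lemma expi_neq0 t : expi t != 0.
Proof. by rewrite -normr_eq0 normr_expi oner_neq0. Qed.

Lemma expiV t : expi (- t) = (expi t)^-1.
Proof.
by apply: (mulfI (expi_neq0 t)); rewrite -expiD subrr expi0 divff ?expi_neq0.
Qed.

Lemma expi_exprz t (k : int) : expi (k%:~R * t) = expi t ^ k.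
Proof.
case: k => k; first by rewrite -pmulrn mulr_natl expiMn.
by rewrite NegzE mulrNz mulNr expiV -exprnN -pmulrn mulr_natl expiMn.
Qed.

Lemma Re_expi t : complex.Re (expi t) = cos t. Proof. by []. Qed.

Lemma expi_inj t s : `|t - s| < 2 * pi -> expi t = expi s -> t = s.
Proof.
wlog st : t s / s <= t => [hw h e|].
  by have [/hw/(_ h e)//|/ltW/hw] := leP s t; rewrite distrC => /(_ h (esym e)).
rewrite ger0_norm ?subr_ge0 // => h e; apply/eqP; rewrite -subr_eq0; apply/eqP.
apply: expi_eq1; rewrite ?subr_ge0 //.
by rewrite expiD expiV e divff ?expi_neq0.
Qed.

Lemma expi_surj (z : R[i]) : `|z| = 1 -> exists t, [/\ 0 <= t, t < 2 * pi & expi t = z].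
Proof.
case: z => x y; rewrite normc_def => /eqP; rewrite eq_complex /= eqxx andbT => /eqP h.
have xy : x ^+ 2 + y ^+ 2 = 1.
  by rewrite -[LHS]sqr_sqrtr ?addr_ge0 ?sqr_ge0 // h expr1n.
have x1 : -1 <= x <= 1 by have y2 := sqr_ge0 y; apply/andP; split; nra.
have pi0 := @pi_gt0 R.
have yE : y = sin (acos x) \/ y = - sin (acos x).
  have : y ^+ 2 = sin (acos x) ^+ 2 by rewrite sin2cos2 acosK //; lra.
  by move/eqP; rewrite eqf_sqr => /orP[] /eqP; [left|right].
have a0 : 0 <= acos x by exact: acos_ge0.
have a1 : acos x <= pi by exact: acos_lepi.
have [[e|e]] := (yE, erefl tt).
  by exists (acos x); split=> //; [lra|rewrite /expi acosK // -e].
(* When [acos x = 0] the angle [2 * pi - acos x] would be the excluded endpoint, so 0 is taken. *)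
have [x1E|xn1] := eqVneq (acos x) 0.
  exists 0; split; rewrite ?mulr_gt0 //.
  by rewrite expi0 e x1E sin0 oppr0 -[in RHS](acosK x1) x1E cos0.
exists (2 * pi - acos x); split; first by lra.
  by rewrite ltrBlDr ltrDl lt_neqAle eq_sym xn1.
by rewrite expiD expi_2pi mul1r expiN /expi e acosK.
Qed.

End Expi.

(** * Tilings of the discrete torus *)

Section TorusModel.
Variables (R : realType) (tau : polyomino) (n' : nat).
Local Notation n := n'.+2.
(** The side is [n'.+2] so that the ordinals form a nonzero ring and the cast [%:~R] reduces
    integers modulo [n]. *)
Definition torus_pt := ('I_n'.+2 * 'I_n'.+2)%type.
Local Notation G := torus_pt.
HB.instance Definition _ := GRing.Zmodule.on torus_pt.
HB.instance Definition _ := Finite.on torus_pt.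
Local Notation T := (G + G)%type.
Implicit Types (q : int * int) (s v : G).

Definition reduce q : G := (q.1%:~R, q.2%:~R).

Lemma intr_ord_eq0 (w : int) : (w%:~R == 0 :> 'I_n) = (n %| w)%Z.
Proof.
have h m : (m%:R == 0 :> 'I_n) = (n %| m)%N.
  by rewrite -(inj_eq val_inj) /= Zp_nat /= /dvdn.
case: w => m; first by rewrite -pmulrn h.
by rewrite NegzE mulrNz oppr_eq0 -pmulrn h dvdzE abszN.
Qed.

Lemma intr_ord_eq (w : int) (x : 'I_n) :
  (w == (x : nat)%:Z %[mod n%:Z])%Z = (w%:~R == x).
Proof.
rewrite eqz_mod_dvd -intr_ord_eq0 intrB subr_eq0; congr (_ == _).
by rewrite -pmulrn natr_Zp.
Qed.

Lemma reduceD q q' : reduce (q.1 + q'.1, q.2 + q'.2) = reduce q + reduce q'.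
Proof. by congr (_, _); rewrite /= intrD. Qed.

Lemma reduce_ord s : reduce ((s.1 : nat)%:Z, (s.2 : nat)%:Z) = s.
Proof. by rewrite /reduce /= -!pmulrn !natr_Zp; case: s. Qed.

Lemma translateE q v :
  @translate n tau q.1 q.2 (Some v) = count (fun q' => reduce q' + reduce q == v) tau.
Proof.
case: v => x y; apply: eq_count => q' /=.
by rewrite !intr_ord_eq !intrD.
Qed.

Definition footprint : {set G} := [set g | has (fun q => reduce q == g) tau].
Local Notation A := (#|` tau|).

Hypothesis tau_ge2 : (2 <= A)%N.
Hypothesis reduce_inj : {in tau &, injective reduce}.
Hypothesis footprint_aperiodic : forall h : G,
  (forall v, (v \in footprint) = (v + h \in footprint)) -> h = 0.

Lemma big_footprint (U : nmodType) (F : G -> U) :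
  \sum_(g in footprint) F g = \sum_(q <- tau) F (reduce q).
Proof.
rewrite -(big_map reduce predT F) /=.
have um : uniq (map reduce tau) by rewrite map_inj_in_uniq ?fset_uniq.
rewrite -big_enum /=; apply: perm_big.
apply: uniq_perm; rewrite ?enum_uniq // => g; rewrite mem_enum inE.
by apply/hasP/mapP => [[q qt /eqP <-]|[q qt ->]]; exists q.
Qed.

Lemma card_footprint : #|footprint| = A.
Proof.
by rewrite -sum1_card (@big_footprint nat) sum1_size.
Qed.

Lemma translate_footprint q v :
  @translate n tau q.1 q.2 (Some v) = (v - reduce q \in footprint) :> nat.
Proof.
rewrite translateE inE -sum1_count big_mkcond /=.
rewrite (eq_bigr (fun q' => nat_of_bool (reduce q' == v - reduce q))); last first.
  by move=> q' _; rewrite (can2_eq (addrK _) (subrK _)); case: eqP.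
have [/hasP[q0 q0t /eqP e]|/hasPn h] := boolP (has _ _); last first.
  by rewrite big_seq big1 // => q' /h /negbTE ->.
rewrite (big_fsetD1 q0) //= e eqxx big_seq big1 ?addn0 // => q'.
rewrite !inE => /andP[ne q't]; case: eqP => // e'.
by rewrite (reduce_inj q't q0t (etrans e' (esym e))) eqxx in ne.
Qed.

Definition tile_type (t : T) : tile n :=
  match t with
  | inl s => @translate n tau (s.1 : nat)%:Z (s.2 : nat)%:Z
  | inr s => singleton tau s
  end.

Lemma tile_type_l s v : tile_type (inl s) (Some v) = (v - s \in footprint) :> nat.
Proof.
rewrite -{2}(reduce_ord s) -translate_footprint; by [].
Qed.

Lemma tile_type_r s v : tile_type (inr s) (Some v) = (v == s) :> nat.
Proof. by []. Qed.

Lemma footprint_neq0 : exists g, g \in footprint.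
Proof. by apply/card_gt0P; rewrite card_footprint ltnW. Qed.

(** A translate and a singleton differ above the dummy vertex because [A.-1] is positive; two equal
    translates would give a period of the footprint. *)
Lemma tile_type_inj t t' : tile_type t =1 tile_type t' -> t = t'.
Proof.
have A1 : (0 < A.-1)%N by case: A tau_ge2 => [|[]].
case: t t' => s [] s' E.
- congr inl; apply/eqP; rewrite -subr_eq0; apply/eqP/footprint_aperiodic => v.
  have := E (Some (v + s)); rewrite !tile_type_l addrK => h.
  by apply/idP/idP; move: h; rewrite addrA; case: (_ \in _); case: (_ \in _).
- by have := E None => /= e; rewrite -e in A1.
- by have := E None => /= e; rewrite e in A1.
- congr inr; have := E (Some s); rewrite !tile_type_r eqxx.
  by case: eqP.
Qed.

Lemma tile_type_neq0 t : exists w, (0 < tile_type t w)%N.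
Proof.
case: t => s; last by exists (Some s); rewrite tile_type_r eqxx.
by have [g gf] := footprint_neq0; exists (Some (g + s)); rewrite tile_type_l addrK gf.
Qed.

Variables (N N0 : nat).
Local Notation pt := (Defs.point n N N0).
Local Notation tg := (fun q : pt => tag q).
Local Notation ty := (fun t (v : vertex n) => tile_type t v).

Lemma card_fiber_point w : #|fiber tg [set: pt] w| = multiplicity N N0 w.
Proof.
rewrite -[RHS]card_ord -cardsT.
have inj : injective (fun i : 'I_(multiplicity N N0 w) => Tagged (fun w => 'I_(multiplicity N N0 w)) i : pt).
  by move=> i j /eqP; rewrite eq_Tagged /= => /eqP.
rewrite -(card_imset _ inj); apply: eq_card => q; rewrite !inE /=.
apply/eqP/imsetP => [<-|[i _ ->]] //.
by exists (tagged q); rewrite ?inE //; case: q.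
Qed.

Lemma tilings_typed : tilings n N N0 tau = typed_partitions tg ty [set: pt].
Proof.
apply/setP => P; rewrite !inE; congr (_ && _); apply: eq_forallb => B.
congr (_ ==> _); apply/existsP/existsP => [[s /orP[h|h]]|[[] s h]].
- by exists (inl s).
- by exists (inr s).
- by exists s; apply/orP; left; exact: h.
- by exists s; apply/orP; right; exact: h.
Qed.

Lemma copies_type_count q (P : {set {set pt}}) :
  copies tau q.1 q.2 P = type_count tg ty P (inl (reduce q)).
Proof.
apply: eq_card => B; rewrite !inE; congr (_ && _); apply: eq_forallb => v.
congr (_ == _); case: v => [v|] //.
by rewrite tile_type_l translate_footprint.
Qed.

Local Notation bal := (balanced tg ty [set: pt]).

Lemma balancedP (c : T -> nat) :
  reflect ((forall v, N = c (inr v) + \sum_s c (inl s) * ((v - s)%R \in footprint))%N /\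
           N0 = (A.-1 * \sum_s c (inr s))%N) (bal c).
Proof.
have E1 v : (\sum_t c t * tile_type t (Some v) =
    c (inr v) + \sum_s c (inl s) * ((v - s)%R \in footprint))%N.
  rewrite big_sumType /= addnC; congr (_ + _)%N.
    rewrite (bigD1 v) //= eqxx muln1 big1 ?addn0 // => s ne.
    by rewrite eq_sym (negbTE ne) muln0.
  by apply: eq_bigr => s _; rewrite -tile_type_l.
have E0 : (\sum_t c t * tile_type t None = A.-1 * \sum_s c (inr s))%N.
  rewrite big_sumType /= big1 ?add0n => [|s _]; last by rewrite muln0.
  by rewrite big_distrr; apply: eq_bigr => s _; rewrite mulnC.
apply: (iffP forallP) => [h|[h1 h2] [v|]].
- split=> [v|]; first by have := eqP (h (Some v)); rewrite card_fiber_point E1.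
  by have := eqP (h None); rewrite card_fiber_point E0.
- by rewrite card_fiber_point E1 -h1.
- by rewrite card_fiber_point E0 -h2.
Qed.

Lemma balanced_le_N (c : T -> nat) : bal c -> forall t, (c t <= N)%N.
Proof.
move=> /balancedP[h _] [s|s]; last by rewrite (h s) leq_addr.
have [g gf] := footprint_neq0; rewrite (h (g + s)) (bigD1 s) //= addrK gf muln1.
by rewrite addnCA leq_addr.
Qed.

(** Translates of [tau] have multiplicities 0 and 1; each singleton contributes the factorial of
    [A.-1] from the dummy vertex, and the equation there fixes the number of singletons. *)
Lemma balanced_kappa (c : T -> nat) : bal c ->
  (\prod_t (\prod_v (ty t v)`!) ^ c t = A.-1 `! ^ (N0 %/ A.-1))%N.
Proof.
move=> /balancedP[_ ->]; rewrite mulKn; last by case: A tau_ge2 => [|[]].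
rewrite big_sumType /= big1 ?mul1n => [|s _]; last first.
  rewrite big1 ?exp1n // => -[v|] _ //.
  by rewrite -[translate _ _ _ _]/(tile_type (inl s) (Some v)) tile_type_l; case: (_ \in _).
rewrite expn_sum; apply: eq_bigr => s _; rewrite (bigD1 None) //= big1 ?muln1 // => -[v|] // _.
by rewrite [singleton _ _ _]/=; case: (_ == _).
Qed.

Local Notation state := {ffun T -> 'I_N.+1}.
Definition torus_feas (c : state) : bool := bal (fun t => c t).
Local Notation W := (@count_weight R T N).

Lemma covariance_copiesE (a b : int) :
  covariance_copies R tau n N N0 a b =
  wcov torus_feas W (fun c => (c (inl 0))%:R) (fun c => (c (inl (reduce (a, b))))%:R).
Proof.
have k0 : (0 < A.-1 `! ^ (N0 %/ A.-1))%N by rewrite expn_gt0 fact_gt0.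
have mE := unif_mean_counts tile_type_inj tile_type_neq0 balanced_le_N k0 balanced_kappa.
have r0 : reduce (0, 0) = 0 by [].
have cE q (P : {set {set pt}}) : P \in tilings n N N0 tau ->
    (copies tau q.1 q.2 P)%:R = (counts_of tg ty N P (inl (reduce q)))%:R :> R.
  move=> Pt; rewrite copies_type_count (counts_ofE tile_type_inj balanced_le_N) //.
  by rewrite -tilings_typed.
have uE (f g : {set {set pt}} -> R) : {in tilings n N N0 tau, f =1 g} ->
    unif_mean (tilings n N N0 tau) f = unif_mean (tilings n N N0 tau) g.
  by move=> fg; congr (_ / _); apply: eq_bigr => P Pt; rewrite fg.
rewrite /covariance_copies /unif_cov /wcov -!mE -tilings_typed.
congr (_ - _ * _); apply: uE => P Pt; rewrite ?(cE (0, 0) P Pt) ?(cE (a, b) P Pt) //.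
Qed.

Local Notation Fp := footprint.

Lemma sum_footprint_shift (f : G -> nat) :
  (\sum_v \sum_s f s * ((v - s)%R \in Fp) = A * \sum_s f s)%N.
Proof.
rewrite exchange_big big_distrr; apply: eq_bigr => s _ /=.
rewrite -big_distrr mulnC /=; congr (_ * _)%N.
rewrite -card_footprint -sum1_card [RHS]big_mkcond /= (reindex_inj (addIr s)) /=.
by apply: eq_bigr => v _; rewrite addrK; case: (_ \in _).
Qed.

Lemma card_torus : #|{: G}| = (n * n)%N.
Proof. by rewrite card_prod card_ord. Qed.

Lemma sum_cst_torus (k : nat) : (\sum_(v : G) k = n * n * k)%N.
Proof. by rewrite sum_nat_const card_torus. Qed.

Variables (c1 : T -> nat).
Hypothesis c1_bal : bal c1.
Let M := (\sum_s c1 (inl s))%N.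
Let Y := (\sum_s c1 (inr s))%N.

Lemma N_eq : (n * n * N = Y + A * M)%N.
Proof.
have [h _] := balancedP c1 c1_bal.
by rewrite -sum_cst_torus (eq_bigr _ (fun v _ => h v)) big_split /= sum_footprint_shift.
Qed.

(** The dummy vertex determines the number of singletons, and counting all points of the torus then
    determines the number of copies of [tau]; so the totals of the reference solution [c1] are those
    of every solution. *)
Lemma balanced_sums (c : T -> nat) : bal c ->
  (\sum_s c (inl s))%N = M /\ (\sum_s c (inr s))%N = Y.
Proof.
move=> /balancedP[h e]; have [h1 e1] := balancedP c1 c1_bal.
have A1 : (0 < A.-1)%N by case: A tau_ge2 => [|[]].
have eY : (\sum_s c (inr s))%N = Y.
  by move: e1; rewrite e => /eqP; rewrite eqn_pmul2l // => /eqP.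
split=> //; have := N_eq.
rewrite -sum_cst_torus (eq_bigr _ (fun v _ => h v)) big_split /= sum_footprint_shift eY.
move=> /eqP; rewrite eqn_add2l eqn_pmul2l; first by move/eqP.
by rewrite ltnW.
Qed.

Definition mean_l : R := M%:R / (n * n)%:R.
Definition mean_r : R := Y%:R / (n * n)%:R.
Local Notation lx := mean_l.
Local Notation ly := mean_r.
Definition type_mean (t : T) : R := if t is inl _ then lx else ly.

Let m_gt0 : 0 < (n * n)%:R :> R. Proof. by rewrite ltr0n. Qed.

Lemma mean_N : N%:R = ly + A%:R * lx.
Proof.
have /(congr1 (fun k => k%:R : R)) := N_eq; rewrite (natrM _ (n * n)) natrD (natrM _ A) => h.
rewrite /mean_l /mean_r mulrA -mulrDl -h mulrAC divff ?mul1r // gt_eqF //.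
Qed.

(** An integral solution at bounded distance from the means, to serve as [c0]: the [M] copies are
    spread evenly, the remainder going one each to the first positions of an enumeration, and
    singletons fill what stays uncovered. *)
Definition near_count_l (s : G) : nat := (M %/ (n * n) + (enum_rank s < M %% (n * n))%N)%N.
Definition near_count (t : T) : nat := match t with
  | inl s => near_count_l s
  | inr v => (N - \sum_s near_count_l s * ((v - s)%R \in Fp))%N
  end.

Lemma near_count_l_mean s : `|(near_count_l s)%:R - lx| <= 1.
Proof.
have e : M%:R = (M %/ (n * n))%:R * (n * n)%:R + (M %% (n * n))%:R :> R.
  by rewrite -natrM -natrD -divn_eq.
have r0 : 0 <= (M %% (n * n))%:R / (n * n)%:R :> R by rewrite divr_ge0.
have r1 : (M %% (n * n))%:R / (n * n)%:R <= 1 :> R.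
  by rewrite ler_pdivrMr // mul1r ler_nat ltnW // ltn_mod.
have -> : lx = (M %/ (n * n))%:R + (M %% (n * n))%:R / (n * n)%:R.
  by rewrite /mean_l e mulrDl mulfK // gt_eqF.
rewrite natrD opprD addrACA subrr add0r.
move: r0 r1; move: (_%:R / _) => z z0 z1.
by case: (enum_rank s < _)%N; rewrite ler_norml /=; lra.
Qed.

Lemma sum_near_count_l : (\sum_s near_count_l s = M)%N.
Proof.
rewrite big_split /= sum_cst_torus.
have -> : (\sum_(s : G) (enum_rank s < M %% (n * n)) = \sum_(i < n * n) (i < M %% (n * n)))%N.
  rewrite -card_torus [RHS](reindex (@enum_rank G)) //.
  exact: onW_bij (@enum_rank_bij _).
have lt : (M %% (n * n) < n * n)%N by rewrite ltn_mod.
rewrite -(big_mkord predT (fun i => nat_of_bool (i < M %% (n * n))%N)).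
rewrite (big_cat_nat (leq0n _) (ltnW lt)) /=.
rewrite (eq_big_nat _ _ (F2 := fun=> 1%N)); last by move=> i /andP[_ ->].
rewrite sum_nat_const_nat muln1 subn0 big_nat big1 ?addn0; last first.
  by move=> i /andP[h _]; rewrite ltnNge h.
by rewrite mulnC -divn_eq.
Qed.

Lemma sum_near_dev v :
  `|\sum_s (near_count_l s)%:R * (v - s \in Fp)%:R - A%:R * lx| <= A%:R.
Proof.
have -> : A%:R = \sum_s (v - s \in Fp)%:R :> R.
  rewrite -card_footprint -sum1_card natr_sum big_mkcond /= (reindex_inj (subrI v)) /=.
  by apply: eq_bigr => s _; case: (_ \in _).
rewrite mulr_suml -sumrB; apply: le_trans (ler_norm_sum _ _ _) _; apply: ler_sum => s _.
rewrite mulrC -mulrBr normrM normr_nat -[leRHS]mulr1 ler_wpM2l //.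
exact: near_count_l_mean.
Qed.

Hypothesis A_le_mean : A%:R <= ly.

(** The hypothesis [A_le_mean] makes the truncated subtraction in [near_count] exact: rounding
    changes the coverage of a point by at most [A], which the mean number of singletons can
    supply. *)
Lemma near_count_r v : (near_count (inr v))%:R =
  N%:R - \sum_s (near_count_l s)%:R * (v - s \in Fp)%:R :> R.
Proof.
rewrite natrB; first by rewrite natr_sum; congr (_ - _); apply: eq_bigr => s _; rewrite natrM.
rewrite -(ler_nat R) natr_sum (eq_bigr _ (fun s _ => natrM R _ _)) mean_N.
by have := sum_near_dev v; rewrite ler_norml; move: A_le_mean; lra.
Qed.

Lemma near_count_mean t : `|(near_count t)%:R - type_mean t| <= A%:R.
Proof.
case: t => [s|v].
  by apply: le_trans (near_count_l_mean s) _; rewrite ler1n ltnW.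
rewrite near_count_r mean_N /=; have := sum_near_dev v.
by rewrite -normrN; congr (`|_| <= _); ring.
Qed.

Lemma near_count_bal : bal near_count.
Proof.
have le v : (\sum_s near_count_l s * ((v - s)%R \in Fp) <= N)%N.
  rewrite -(ler_nat R) natr_sum (eq_bigr _ (fun s _ => natrM R _ _)) mean_N.
  by have := sum_near_dev v; rewrite ler_norml; move: A_le_mean; lra.
apply/balancedP; split=> [v|/=]; first by rewrite /= subnK.
have [_ ->] := balancedP c1 c1_bal; congr (_ * _)%N.
apply/eqP; rewrite -(eqn_add2r (A * M)) -/Y -N_eq -sum_near_count_l -sum_footprint_shift.
rewrite -big_split /= -sum_cst_torus; apply/eqP/eq_bigr => v _.
by rewrite subnK.
Qed.

Definition near_state : state := [ffun t => inord (near_count t)].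

Lemma near_stateE t : near_state t = near_count t :> nat.
Proof. by rewrite ffunE inordK // ltnS (balanced_le_N near_count_bal). Qed.

Lemma near_state_feas : torus_feas near_state.
Proof.
rewrite /torus_feas; have := near_count_bal; congr (is_true _).
by apply: eq_forallb => v; congr (_ == _); apply: eq_bigr => t _; rewrite near_stateE.
Qed.

(** The means are constant on each of the two kinds of types, so the product depends on the
    conserved totals alone; this supplies [lam_prod]. *)
Lemma type_mean_prod (c : state) : torus_feas c ->
  \prod_t type_mean t ^+ c t = lx ^+ M * ly ^+ Y.
Proof.
move=> /balanced_sums[eM eY]; rewrite big_sumType /=.
by rewrite -!expr_sum eM eY.
Qed.

Lemma mean_l_le : lx <= N%:R.
Proof.
rewrite mean_N -[leLHS]add0r lerD // ?divr_ge0 // ler_peMl ?divr_ge0 //.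
by rewrite ler1n ltnW.
Qed.

Lemma mean_r_le : ly <= N%:R.
Proof. by rewrite mean_N lerDl mulr_ge0 // divr_ge0. Qed.

(* A copy of tau at s with singletons on s0 + tau covers the same points as a copy
   at s0 with singletons on s + tau; common singletons are dropped to make the
   two sets of types disjoint. *)
Definition exch_set (s s0 : G) : {set T} := [set t | match t with
  | inl g => g == s
  | inr v => (v - s0 \in Fp) && (v - s \notin Fp) end]%SET.

Lemma in_exch_l s s0 g : (inl g \in exch_set s s0) = (g == s).
Proof. by rewrite finset.in_set. Qed.

Lemma in_exch_r s s0 v :
  (inr v \in exch_set s s0) = (v - s0 \in Fp) && (v - s \notin Fp).
Proof. by rewrite finset.in_set. Qed.

Lemma exch_set_disjoint s s0 : s != s0 -> [disjoint exch_set s s0 & exch_set s0 s].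
Proof.
move=> ne; rewrite -setI_eq0; apply/eqP/setP => -[g|v]; rewrite finset.in_setI finset.in_set0 ?in_exch_l ?in_exch_r.
  by case: eqP => // ->; rewrite (negbTE ne).
by case: (_ \in _); case: (_ \in _).
Qed.

(** Either difference of the two footprints is completed to [A] points by their intersection. *)
Lemma exch_set_card s s0 :
  (\sum_v (inr v \in exch_set s s0) = \sum_v (inr v \in exch_set s0 s))%N.
Proof.
have C (a a' : G) : (\sum_v (inr v \in exch_set a' a) +
    \sum_v (((v - a)%R \in Fp) && ((v - a')%R \in Fp)) = A)%N.
  rewrite -big_split /= -card_footprint -sum1_card [RHS]big_mkcond [RHS](reindex_inj (addIr (- a))) /=.
  by apply: eq_bigr => v _; rewrite in_exch_r; case: (_ \in _); case: (_ \in _).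
apply/eqP; rewrite -(eqn_add2r (\sum_v (((v - s0)%R \in Fp) && ((v - s)%R \in Fp)))) C.
rewrite -[X in X == _](C s s0) eqn_add2l; apply/eqP/eq_bigr => v _.
by rewrite andbC.
Qed.

(** Relocating the copy changes the coverage only where exactly one of the two footprints lies, and
    there the singletons change in the opposite direction. By [exch_set_card] their total number is
    kept, which is the balance at the dummy vertex. *)
Lemma exch_set_movable s s0 : s != s0 ->
  movable torus_feas (exch_set s s0) (exch_set s0 s).
Proof.
move=> ne c fc cpos.
pose c' t := (c t + (t \in exch_set s s0) - (t \in exch_set s0 s))%N.
have c'E t : (c' t + (t \in exch_set s0 s) = c t + (t \in exch_set s s0))%N.
  rewrite /c' subnK //; have [/cpos ct|//] := boolP (t \in exch_set s0 s).
  by rewrite (leq_trans ct) ?leq_addr.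
have [h e] := balancedP _ fc.
have bc' : bal c'.
  apply/balancedP; split=> [v|].
    have E1 : (\sum_g c' (inl g) * ((v - g)%R \in Fp) + ((v - s0)%R \in Fp) =
      \sum_g c (inl g) * ((v - g)%R \in Fp) + ((v - s)%R \in Fp))%N.
      have D1 (a : G) : ((v - a)%R \in Fp) = (\sum_g (g == a) * ((v - g)%R \in Fp))%N :> nat.
        by rewrite (bigD1 a) //= eqxx mul1n big1 ?addn0 // => g /negbTE ->.
      rewrite [in LHS](D1 s0) [in RHS](D1 s) -!big_split /=; apply: eq_bigr => g _.
      by rewrite -!mulnDl; have := c'E (inl g); rewrite !in_exch_l => ->.
    apply/eqP; rewrite -(eqn_add2r ((v - s0)%R \in Fp)) -addnA E1.
    rewrite {1}(h v); have := c'E (inr v); rewrite !in_exch_r.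
    move: (\sum_g _)%N (c' _) (c _) => S a a'.
    by case: (_ \in _); case: (_ \in _); rewrite /=; clear; move=> ?; apply/eqP; lia.
  rewrite e; congr (_ * _)%N; apply/eqP.
  rewrite -(eqn_add2r (\sum_v (inr v \in exch_set s0 s))) -[X in _ == X]big_split /=.
  by rewrite (eq_bigr _ (fun v _ => c'E (inr v))) big_split /= eqn_add2l exch_set_card.
split; last first.
  by move=> t; exact: (balanced_le_N bc' t).
rewrite /torus_feas; have := bc'; congr (is_true _).
apply: eq_forallb => v; congr (_ == _); apply: eq_bigr => t _.
by rewrite ffunE inordK // ltnS (balanced_le_N bc' t).
Qed.

(** Insertion of a copy at [s] in place of singletons. Alone it violates the balance at the dummy
    vertex; in the differences [dir s - dir s0] the singletons common to both footprints cancel,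
    which gives exactly the exchanges. *)
Definition dir (s : G) (t : T) : R := match t with
  | inl g => (g == s)%:R
  | inr v => - (v - s \in Fp)%:R end.

Lemma exch_dir s s0 t : exch R (exch_set s s0) (exch_set s0 s) t = dir s t - dir s0 t.
Proof.
rewrite /exch; case: t => [g|v]; rewrite ?in_exch_l ?in_exch_r //=.
by case: (_ \in _); case: (_ \in _); rewrite /= ?mulr0n ?mulr1n; ring.
Qed.

Lemma type_mean_balance s s0 :
  \prod_(t in exch_set s s0) type_mean t = lx * ly ^+ (\sum_v (inr v \in exch_set s0 s))%N.
Proof.
rewrite big_mkcond big_sumType /= (bigD1 s) //= in_exch_l eqxx big1 ?mulr1; last first.
  by move=> g /negbTE; rewrite in_exch_l => ->.
rewrite -exch_set_card expr_sum; congr (_ * _); apply: eq_bigr => v _.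
by case: (_ \in _).
Qed.

Variable kap : R.
Hypotheses (kap_gt0 : 0 < kap) (N_gt0 : (0 < N)%N).
(** The factor 2 leaves room for rounding: the counts of [near_state] differ from the means by at
    most [A], hence stay above [kap * N]. *)
Hypotheses (kap_l : 2 * kap * N%:R <= lx) (kap_r : 2 * kap * N%:R <= ly).
Hypothesis A_le : A%:R <= kap * N%:R.

Definition torus_error : R :=
  stein_constant T kap * (1 + fourth_moment_bound T N kap A%:R) ^+ 2 / Num.sqrt N%:R.

Let kN_gt0 : 0 < kap * N%:R. Proof. by rewrite mulr_gt0 ?ltr0n. Qed.
Let lx_gt0 : 0 < lx. Proof. by apply: lt_le_trans kap_l; rewrite -mulrA mulr_gt0. Qed.
Let ly_gt0 : 0 < ly. Proof. by apply: lt_le_trans kap_r; rewrite -mulrA mulr_gt0. Qed.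

Lemma torus_exchange s s0 r : s != s0 ->
  `|wcov torus_feas W (fun c => (c r)%:R) (fun c =>
      \sum_t (dir s t - dir s0 t) * ((c t)%:R / type_mean t)) - (dir s r - dir s0 r)|
  <= torus_error.
Proof.
move=> ne; rewrite -exch_dir.
rewrite (_ : (fun c : state => \sum_t _) = fun c : state =>
    \sum_t exch R (exch_set s s0) (exch_set s0 s) t * ((c t)%:R / type_mean t)); last first.
  by apply/funext => c; apply: eq_bigr => t _; rewrite exch_dir.
have A0 : 0 <= A%:R :> R by [].
have ne' : s0 != s by rewrite eq_sym.
apply: (@exchange_covariance R T N torus_feas type_mean near_state kap A%:R N_gt0 kap_gt0 A0).
- by case=> g /=; [move: kap_l|move: kap_r]; rewrite -mulrA; move: kN_gt0; lra.
- by case=> g /=; [exact: mean_l_le|exact: mean_r_le].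
- exact: near_state_feas.
- by move=> t; rewrite near_stateE near_count_mean.
- move=> t; rewrite near_stateE; have := near_count_mean t.
  rewrite ler_norml => /andP[h _]; move: h.
  have : 2 * kap * N%:R <= type_mean t by case: t => g.
  by move: A_le; rewrite -mulrA; lra.
- by move=> c fc; rewrite (type_mean_prod fc) (type_mean_prod near_state_feas).
- exact: exch_set_disjoint.
- exact: exch_set_movable.
- exact: exch_set_movable.
- by rewrite !type_mean_balance exch_set_card.
Qed.

(** * Fourier analysis on the discrete torus *)

Definition root1 : R[i] := expi (2 * pi / n%:R).
Definition torus_char (x s : G) : R[i] := root1 ^+ (x.1 * s.1)%N * root1 ^+ (x.2 * s.2)%N.
Local Notation ch := torus_char.

Let nR : 0 < n%:R :> R. Proof. by rewrite ltr0n. Qed.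

Lemma root1X (k : nat) : root1 ^+ k = expi (2 * pi * k%:R / n%:R).
Proof. by rewrite /root1 -expiMn -[_ *+ k]mulr_natr mulrAC. Qed.

Lemma root1_n : root1 ^+ n = 1.
Proof. by rewrite root1X mulfK ?gt_eqF // expi_2pi. Qed.

Lemma root1_neq1 (i : 'I_n) : i != 0 -> root1 ^+ i != 1.
Proof.
move=> i0; apply/eqP; rewrite root1X => /expi_eq1.
have pi0 := @pi_gt0 R; have i1 : 0 < i%:R :> R by rewrite ltr0n lt0n.
have lt : 2 * pi * i%:R / n%:R < 2 * pi :> R.
  by rewrite ltr_pdivrMr // ltr_pM2l ?mulr_gt0 // ltr_nat.
have gt : 0 < 2 * pi * i%:R / n%:R :> R by rewrite divr_gt0 ?mulr_gt0.
by move=> /(_ (ltW gt) lt) h; rewrite h ltxx in gt.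
Qed.

Lemma sum_root1 (i : 'I_n) : \sum_(k < n) root1 ^+ (k * i) = (i == 0)%:R * n%:R :> R[i].
Proof.
have [->|i0] := eqVneq i 0.
  rewrite (eq_bigr (fun=> 1)) => [|k _]; last by rewrite muln0.
  by rewrite sumr_const card_ord mul1r.
rewrite mul0r; apply: (mulfI (x := root1 ^+ i - 1)); first by rewrite subr_eq0 root1_neq1.
have e : (root1 ^+ i) ^+ n = 1 by rewrite exprAC root1_n expr1n.
rewrite mulr0 -[RHS](subrr 1) -[X in _ = X - _]e [RHS]subrX1; congr (_ * _); apply: eq_bigr => k _.
by rewrite mulnC exprM.
Qed.

Lemma sum_char s : \sum_x ch x s = (s == 0)%:R * (n * n)%:R.
Proof.
rewrite -(pair_big predT predT (fun a b : 'I_n => root1 ^+ (a * s.1) * root1 ^+ (b * s.2))) /=.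
rewrite -big_distrlr /= !sum_root1 mulrACA -!natrM mulnb; congr ((_ * _)%:R).
Qed.

Lemma root1_mod (k m : nat) : root1 ^+ (k * (m %% n)) = root1 ^+ (k * m).
Proof. by rewrite !exprM expr_mod // -exprM mulnC exprM root1_n expr1n. Qed.

Lemma charD x s s' : ch x (s + s') = ch x s * ch x s'.
Proof.
rewrite /torus_char /= !root1_mod !mulnDr !exprD mulrACA //.
Qed.

Lemma char0 x : ch x 0 = 1.
Proof. by rewrite /torus_char /= !muln0 !expr0 mulr1. Qed.

Lemma normr_char x s : `|ch x s| = 1.
Proof. by rewrite normrM !normrX normr_expi !expr1n mulr1. Qed.

Lemma charN x s : ch x (- s) = (ch x s)^*.
Proof.
have h : ch x (- s) * ch x s = 1 by rewrite -charD addNr char0.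
have nz : ch x s != 0 by rewrite -normr_eq0 normr_char oner_neq0.
apply: (mulIf nz); rewrite h mulrC -normCK normr_char expr1n //.
Qed.

Definition footprint_symbol (x : G) : R[i] := \sum_(q in Fp) ch x q.
Definition normsq (z : R[i]) : R := complex.Re z ^+ 2 + complex.Im z ^+ 2.
Local Notation P := footprint_symbol.

Lemma normsq_ge0 z : 0 <= normsq z.
Proof. by rewrite addr_ge0 ?sqr_ge0. Qed.

Lemma mul_conj_normsq z : z * z^* = (normsq z)%:C.
Proof.
by case: z => x y; apply/eqP; rewrite eq_complex /normsq /=; apply/andP; split; apply/eqP; ring.
Qed.

(** Characters are eigenfunctions of the convolution with the footprint and with its reflection,
    with conjugate eigenvalues. *)
Lemma sum_re_shift x w :
  \sum_(q in Fp) \sum_(q' in Fp) complex.Re (ch x (w + q' - q)) =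
  normsq (P x) * complex.Re (ch x w).
Proof.
transitivity (complex.Re (ch x w * (P x * (P x)^*))).
  rewrite /P rmorph_sum mulrC mulr_sumr mulr_suml raddf_sum; apply: eq_bigr => q _ /=.
  rewrite mulrAC mulr_suml mulr_suml raddf_sum; apply: eq_bigr => q' _ /=.
  by rewrite !charD charN [ch x q' * _]mulrC.
rewrite mul_conj_normsq; case: (ch x w) => a b /=; ring.
Qed.

Variables (ab : G).

Definition torus_green (e : R) : R :=
  (\sum_(x | x != 0) complex.Re (ch x ab) / (e + normsq (P x))) / (n * n)%:R.

Let e := ly / lx.
Let e_gt0 : 0 < e. Proof. by rewrite divr_gt0. Qed.
Let den x : 0 < e + normsq (P x).
Proof. by rewrite ltr_pwDl // normsq_ge0. Qed.

(* The Green function of the quadratic form governing the fluctuations: by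
   [hessian_g] below, the combination of the exchange statistics with
   coefficients [g] is the centred count of the translate by [ab]. *)
Let g (u : G) : R :=
  ly / (n * n)%:R * \sum_(x | x != 0) complex.Re (ch x (u - ab)) / (e + normsq (P x)).

Lemma char_sym x s : ch x s = ch s x.
Proof. by rewrite /torus_char mulnC [(x.2 * _)%N]mulnC. Qed.

(** Every nonzero character has sum zero over the torus. Because of this the base point 0 of the
    exchanges drops out in [comb]. *)
Let sum_g : \sum_u g u = 0.
Proof.
rewrite -mulr_sumr exchange_big /= big1 ?mulr0 // => x x0; rewrite -mulr_suml.
rewrite (_ : \sum_u complex.Re _ = complex.Re (\sum_u ch x u)); last first.
  by rewrite [in RHS](reindex_inj (addIr (- ab))) raddf_sum.
rewrite (eq_bigr (fun u => ch u x)); last by move=> u _; rewrite char_sym.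
by rewrite sum_char (negbTE x0) mul0r mul0r.
Qed.

(** At most n^2 terms of size [e^-1], and [ly / e = lx]. The bound serves to sum the errors of the
    exchanges. *)
Let g_le u : `|g u| <= lx.
Proof.
rewrite normrM ger0_norm ?divr_ge0 ?(ltW ly_gt0) //.
apply: (@le_trans _ _ (ly / (n * n)%:R * \sum_(x : G) e^-1)); last first.
  rewrite sumr_const card_torus -[_^-1 *+ _]mulr_natr /e invf_div le_eqVlt; apply/orP; left.
  apply/eqP; move: lx_gt0 ly_gt0 m_gt0; move: lx ly ((n * n)%:R) => l r k l0 r0 k0.
  by field; rewrite !gt_eqF.
rewrite ler_wpM2l ?divr_ge0 ?(ltW ly_gt0) //.
apply: le_trans (ler_norm_sum _ _ _) _.
rewrite big_mkcond /=; apply: ler_sum => x _; case: ifP => _; last by rewrite invr_ge0 ltW.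
rewrite normrM normfV (gtr0_norm (den x)) -[leRHS]mul1r; apply: ler_pM => //.
- by rewrite invr_ge0 ltW.
- have := normr_char x (u - ab); case: (ch _ _) => a b; rewrite normc_def => -[/= h].
  rewrite -sqrtr_sqr -h ler_sqrt ?addr_ge0 ?sqr_ge0 //; by rewrite lerDl sqr_ge0.
- by rewrite lef_pV2 ?posrE // lerDl normsq_ge0.
Qed.

(** On the mode [x] the left side multiplies by [(e + normsq (P x)) / ly], which cancels the
    denominator of [g]. The remaining sum of characters is a delta function without its constant
    mode, hence the subtracted 1 / n^2. *)
Let hessian_g u : g u / lx + (\sum_(q in Fp) \sum_(q' in Fp) g (u + q' - q)) / ly =
  (u == ab)%:R - 1 / (n * n)%:R.
Proof.
have -> : \sum_(q in Fp) \sum_(q' in Fp) g (u + q' - q) =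
    ly / (n * n)%:R * \sum_(x | x != 0)
      normsq (P x) * complex.Re (ch x (u - ab)) / (e + normsq (P x)).
  under eq_bigr do rewrite -mulr_sumr exchange_big /=.
  rewrite -mulr_sumr exchange_big /=; congr (_ * _); apply: eq_bigr => x _.
  rewrite -sum_re_shift mulr_suml; apply: eq_bigr => q _; rewrite mulr_suml.
  apply: eq_bigr => q' _; congr (complex.Re (ch _ _) / _).
  by rewrite [u - ab + q']addrAC [RHS]addrAC.
have -> : g u / lx = (n * n)%:R^-1 * \sum_(x | x != 0) e * complex.Re (ch x (u - ab)) / (e + normsq (P x)).
  rewrite /g !mulr_sumr mulr_suml; apply: eq_bigr => x _; move: lx_gt0 (den x) m_gt0; rewrite /e.
  move: lx ly (normsq _) (complex.Re _) ((n * n)%:R) => l r p q k l0 d0 k0.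
  have d1 : 0 < r + p * l.
    by rewrite (_ : r + p * l = (r / l + p) * l) ?mulr_gt0 //; field; rewrite gt_eqF.
  by field; rewrite !gt_eqF.
have cancel S : ly / (n * n)%:R * S / ly = (n * n)%:R^-1 * S.
  move: ly_gt0 m_gt0; move: ly ((n * n)%:R) => r k r0 k0; by field; rewrite !gt_eqF.
rewrite cancel -mulrDr -big_split /=.
have S : \sum_x complex.Re (ch x (u - ab)) = (u == ab)%:R * (n * n)%:R.
  rewrite -raddf_sum sum_char subr_eq0 -!natrM /=.
  by rewrite -[X in complex.Re X](rmorph_nat (real_complex R)).
rewrite (eq_bigr (fun x => complex.Re (ch x (u - ab)))); last first.
  by move=> x _; rewrite -mulrDl -mulrDl mulrAC divff ?mul1r // gt_eqF.
move: S; rewrite (bigD1 (0 : G)) //= mulr1 mul0r subr0 => h.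
have -> : \sum_(x | x != 0) complex.Re (ch x (u - ab)) = (u == ab)%:R * (n * n)%:R - 1.
  by rewrite -h addrAC subrr add0r.
move: m_gt0; move: ((n * n)%:R) => k k0; by field; rewrite gt_eqF.
Qed.

(** The balance equations express the singleton counts by the translate counts [cl]. The statistic
    then pairs [cl] with the left side of [hessian_g], and the constant mode yields the fixed total
    [M] divided by n^2. *)
Let comb (c : state) : torus_feas c ->
  \sum_s g s * \sum_t (dir s t - dir 0 t) * ((c t)%:R / type_mean t) =
  (c (inl ab))%:R - M%:R / (n * n)%:R.
Proof.
move=> fc; have [h _] := balancedP _ fc; have [eM _] := balanced_sums fc.
pose cl s : R := (c (inl s))%:R; pose cr v : R := (c (inr v))%:R.
have crE v : cr v = N%:R - \sum_(q in Fp) cl (v - q).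
  rewrite {1}(h v) natrD natr_sum -[RHS]addrA; rewrite /cr.
  have -> : \sum_s (c (inl s) * ((v - s)%R \in Fp))%:R = \sum_(q in Fp) cl (v - q) :> R.
    rewrite [RHS]big_mkcond (reindex_inj (subrI v)) /=; apply: eq_bigr => s _.
    by rewrite natrM subKr; case: (_ \in _); rewrite ?mulr1 ?mulr0.
  by rewrite subrr addr0.
have -> : \sum_s g s * \sum_t (dir s t - dir 0 t) * ((c t)%:R / type_mean t) =
    \sum_t (\sum_s g s * dir s t) * ((c t)%:R / type_mean t).
  under eq_bigr do rewrite mulr_sumr.
  rewrite exchange_big /=; apply: eq_bigr => t _.
  under eq_bigr do rewrite mulrA mulrBr.
  by rewrite -mulr_suml sumrB -mulr_suml sum_g mul0r subr0.
rewrite big_sumType /=.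
have -> : \sum_g0 (\sum_s g s * (g0 == s)%:R) * ((c (inl g0))%:R / lx) = \sum_u cl u * (g u / lx).
  apply: eq_bigr => u _; rewrite (bigD1 u) //= eqxx mulr1 big1 ?addr0.
    by rewrite /cl; ring.
  by move=> s; rewrite eq_sym => /negbTE ->; rewrite mulr0.
have gr v : \sum_s g s * - (v - s \in Fp)%:R = - \sum_(q in Fp) g (v - q).
  rewrite [in RHS]big_mkcond [in RHS](reindex_inj (subrI v)) -sumrN; apply: eq_bigr => s _ /=.
  by rewrite subKr; case: (_ \in _); rewrite ?mulrN ?mulr1 ?mulr0.
have -> : \sum_i (\sum_s g s * - (i - s \in Fp)%:R) * ((c (inr i))%:R / ly) =
    \sum_u cl u * ((\sum_(q in Fp) \sum_(q' in Fp) g (u + q' - q)) / ly).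
  transitivity (\sum_v ((\sum_(q in Fp) g (v - q)) * (\sum_(q in Fp) cl (v - q)) / ly
      - N%:R / ly * \sum_(q in Fp) g (v - q))).
    by apply: eq_bigr => v _; rewrite gr -/(cr v) crE; ring.
  rewrite sumrB -mulr_sumr exchange_big /= [X in _ - _ * X]big1 ?mulr0 ?subr0; last first.
    move=> q _; rewrite -[RHS]sum_g [RHS](reindex_inj (addIr (- q))) //.
  rewrite -mulr_suml.
  transitivity ((\sum_(q in Fp) \sum_(q' in Fp) \sum_v g (v - q) * cl (v - q')) / ly).
    congr (_ / _); under eq_bigr do rewrite big_distrlr /=.
    rewrite exchange_big /=; apply: eq_bigr => q _; by rewrite exchange_big.
  under [in RHS]eq_bigr do rewrite mulrA mulr_sumr.
  rewrite -mulr_suml; congr (_ / _); rewrite [in RHS]exchange_big /=; apply: eq_bigr => q _.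
  under [in RHS]eq_bigr do rewrite mulr_sumr.
  rewrite [in RHS]exchange_big /=; apply: eq_bigr => q' _.
  rewrite [in LHS](reindex_inj (addIr q')) /=; apply: eq_bigr => u _.
  by rewrite addrK mulrC.
rewrite -big_split /=.
rewrite (eq_bigr (fun u => cl u * (u == ab)%:R - cl u * (1 / (n * n)%:R))); last first.
  by move=> u _; rewrite -mulrDr hessian_g mulrBr.
rewrite sumrB -mulr_suml -natr_sum eM mul1r; congr (_ - _).
rewrite (bigD1 ab) //= eqxx mulr1 big1 ?addr0 // => u /negbTE ->; by rewrite mulr0.
Qed.

(** By [comb] the second count is a combination of exchange statistics, each of whose covariances
    with the first is known by [torus_exchange]. As [g] has sum zero, the main terms add up to the
    value of [g] at 0. *)
Lemma torus_covariance :
  `|wcov torus_feas W (fun c => (c (inl 0))%:R) (fun c => (c (inl ab))%:R)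
    - ly * torus_green (ly / lx)| <= (n * n)%:R * lx * torus_error.
Proof.
have Wg : 0 < \sum_(c | torus_feas c) W c.
  exact: sum_count_weight_gt0 near_state_feas.
pose F s (c : state) := \sum_t (dir s t - dir 0 t) * ((c t)%:R / type_mean t).
have -> : wcov torus_feas W (fun c => (c (inl 0))%:R) (fun c => (c (inl ab))%:R) =
    \sum_s g s * wcov torus_feas W (fun c => (c (inl 0))%:R) (F s).
  rewrite -wcov_sumr -[LHS](wcov_addcr Wg _ _ (- (M%:R / (n * n)%:R))).
  by apply: eq_wcov => // c fc; rewrite comb.
have -> : ly * torus_green (ly / lx) = \sum_s g s * (dir s (inl 0) - dir 0 (inl 0)).
  under eq_bigr do rewrite mulrBr.
  rewrite sumrB -mulr_suml sum_g mul0r subr0 (bigD1 (0 : G)) //= ?eqxx mulr1 big1 ?addr0; last first.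
    by move=> s; rewrite eq_sym => /negbTE ->; rewrite mulr0.
  rewrite /torus_green /g -/e mulrA mulrAC; congr (_ * _).
  apply: eq_bigr => x _; rewrite sub0r charN.
  by case: (ch _ _).
rewrite -sumrB; apply: le_trans (ler_norm_sum _ _ _) _.
rewrite -mulrA mulr_natl -card_torus -sumr_const; apply: ler_sum => s _.
rewrite -mulrBr normrM; apply: ler_pM => //.
have err0 : 0 <= torus_error.
  rewrite divr_ge0 ?sqrtr_ge0 // mulr_ge0 ?sqr_ge0 //.
  have k1 : 0 <= 1 / kap by rewrite divr_ge0 // ltW.
  rewrite addr_ge0 // ?divr_ge0 ?(ltW kap_gt0) //; last by rewrite sqr_ge0.
  by rewrite mulr_ge0 // prod_remainder_ge0.
(* For [s = 0] nothing is exchanged and the statistic vanishes, so there is no error at all. *)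
have [->|s0] := eqVneq s 0; last by exact: torus_exchange.
rewrite subrr subr0 (eq_wcov W (fun c _ => erefl _) (g' := fun=> 0)); last first.
  by move=> c _; rewrite /F big1 // => t _; rewrite subrr mul0r.
rewrite /wcov wmean_cst // mulr0 subr0.
by rewrite (eq_wmean W (g := fun=> 0)) ?wmean_cst ?normr0 // => c _; rewrite mulr0.
Qed.

End TorusModel.

(** * Tori that are large compared with the polyomino *)

Section LargeTorus.
Variable tau : polyomino.
Hypothesis tau_ge2 : (2 <= #|` tau|)%N.

Definition diameter_bound : nat := \sum_(q <- tau) (`|q.1| + `|q.2|)%N.
Local Notation D := diameter_bound.

Lemma diameter_boundP (q : int * int) : q \in tau -> (`|q.1| <= D)%N /\ (`|q.2| <= D)%N.
Proof.
move=> qt; rewrite /D (big_fsetD1 q) //=.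
by split; [rewrite -addnA leq_addr|rewrite -addnA addnCA leq_addr].
Qed.

Variable n' : nat.
Hypothesis n_large : (4 * D < n'.+2)%N.
Local Notation red := (reduce n').

(** The range [4 * D] suits comparisons that involve four points of [tau], such as [q + q1 - q0]
    with [q2] in the aperiodicity argument. *)
Lemma reduce_small (q q' : int * int) :
  (`|q.1 - q'.1| <= 4 * D)%N -> (`|q.2 - q'.2| <= 4 * D)%N -> red q = red q' -> q = q'.
Proof.
have h (x y : int) : (`|x - y| <= 4 * D)%N -> x%:~R = y%:~R :> 'I_n'.+2 -> x = y.
  move=> xy /eqP; rewrite -subr_eq0 -intrB intr_ord_eq0 dvdzE absz_nat => dv.
  apply/eqP; rewrite -subr_eq0 -absz_eq0 -leqn0 leqNgt; apply/negP => pos.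
  have := dvdn_leq pos dv; lia.
by case: q q' => x y [x' y'] /= h1 h2 [e1 e2]; rewrite (h _ _ h1 e1) (h _ _ h2 e2).
Qed.

Lemma reduce_inj_large : {in tau &, injective red}.
Proof.
move=> q q' /diameter_boundP[a b] /diameter_boundP[a' b']; apply: reduce_small; lia.
Qed.

(** On a large torus a period lifts to an integer vector [k] that maps [tau] into itself. Iterating
    it would leave any bounded set unless [k] is zero. *)
Lemma footprint_aperiodic_large (h : torus_pt n') :
  (forall v, (v \in footprint tau n') = (v + h \in footprint tau n')) -> h = 0.
Proof.
move=> hF; have inF q : q \in tau -> red q \in footprint tau n'.
  by move=> qt; rewrite finset.in_set; apply/hasP; exists q.
have FP v : v \in footprint tau n' -> exists2 q, q \in tau & red q = v.
  by rewrite finset.in_set => /hasP[q qt /eqP]; exists q.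
have [q0 q0t] : exists q, q \in tau.
  by apply/fset0Pn; rewrite -cardfs_gt0 ltnW.
have [q1 q1t e1] : exists2 q, q \in tau & red q = red q0 + h by apply: FP; rewrite -hF inF.
pose k : int * int := (q1.1 - q0.1, q1.2 - q0.2).
have hk : h = red k.
  rewrite (_ : red k = red q1 - red q0); last by rewrite /k /reduce !intrB.
  by rewrite e1 addrAC subrr add0r.
have step q : q \in tau -> (q.1 + k.1, q.2 + k.2) \in tau.
  move=> qt; have [q2 q2t e2] : exists2 q', q' \in tau & red q' = red q + h.
    by apply: FP; rewrite -hF inF.
  suff -> : (q.1 + k.1, q.2 + k.2) = q2 by [].
  apply: reduce_small; last by rewrite e2 hk -reduceD.
  - have := diameter_boundP qt; have := diameter_boundP q1t; have := diameter_boundP q0t.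
    have := diameter_boundP q2t; rewrite /=; lia.
  - have := diameter_boundP qt; have := diameter_boundP q1t; have := diameter_boundP q0t.
    have := diameter_boundP q2t; rewrite /=; lia.
have iter (j : nat) : (q0.1 + k.1 *+ j, q0.2 + k.2 *+ j) \in tau.
  elim: j => [|j IH]; first by rewrite !mulr0n !addr0; case: (q0) q0t.
  by have := step _ IH; rewrite /= -!addrA -!mulrSr.
(* After [2 * D + 1] steps a nonzero coordinate of [k] has moved by more than [2 * D], while two
   points of [tau] differ by at most that. *)
have [] := diameter_boundP (iter (2 * D).+1); rewrite /= => b1 b2.
have [] := diameter_boundP q0t => b3 b4.
have z (x y : int) : (`|(x + y *+ (2 * D).+1)%R| <= D)%N -> (`|x| <= D)%N -> y = 0.
  rewrite -mulr_natr => u v; have [//|y0] := eqVneq y 0.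
  have : (`|(y * (2 * D).+1%:R)%R| <= 2 * D)%N.
    by move: u v; set w := (y * _)%R; lia.
  rewrite abszM natz absz_nat; have : (0 < `|y|)%N by rewrite absz_gt0.
  nia.
have z1 : k.1 = 0 := z _ _ b1 b3; have z2 : k.2 = 0 := z _ _ b2 b4.
by rewrite hk /reduce z1 z2.
Qed.

End LargeTorus.

Local Open Scope classical_set_scope.
Local Open Scope complex_scope.
Local Open Scope ring_scope.

(** * The covariance for a fixed torus *)

Section GreenSum.
Variables (R : realType) (tau : polyomino) (a b : int).
Implicit Types (eps x y : R).

Definition symbol x y : R := normsq (charpoly tau (expi x) (expi y)).

Definition green_integrand eps x y : R :=
  cos (a%:~R * x + b%:~R * y) / (eps + symbol x y).

Definition grid (n k : nat) : R := 2 * pi * k%:R / n%:R.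

Definition green_sum eps (n : nat) : R :=
  (\sum_(k < n) \sum_(l < n) green_integrand eps (grid n k) (grid n l)
   - green_integrand eps 0 0) / (n * n)%:R.

(** An integer and its residue differ by a multiple of [n], which an n-th root of unity does not
    see. *)
Lemma root1_intr n' (j : nat) (w : int) :
  root1 R n' ^+ (j * (w%:~R : 'I_n'.+2))%N = expi (grid n'.+2 j) ^ w.
Proof.
have zn : expi (grid n'.+2 j) ^+ n'.+2 = 1 :> R[i].
  by rewrite /grid -root1X -exprM mulnC exprM root1_n expr1n.
rewrite exprM root1X -/(grid n'.+2 j); set z := expi _ in zn *.
have := intr_ord_eq w (w%:~R : 'I_n'.+2); rewrite eqxx eqz_mod_dvd => /dvdzP[t e].
move: (w%:~R : 'I_n'.+2) e => x e.
have -> : w = (x : nat)%:Z + n'.+2%:Z * t by rewrite mulrC -e addrC subrK.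
by rewrite expfzDr ?expi_neq0 // -exprz_exp -!exprnP zn exp1rz mulr1.
Qed.

Lemma char_reduce n' (x : torus_pt n') (q : int * int) :
  torus_char R x (reduce n' q) = expi (q.1%:~R * grid n'.+2 x.1 + q.2%:~R * grid n'.+2 x.2).
Proof. by rewrite /torus_char !root1_intr expiD !expi_exprz. Qed.

Lemma footprint_symbolE n' (x : torus_pt n') : {in tau &, injective (reduce n')} ->
  footprint_symbol R tau x = charpoly tau (expi (grid n'.+2 x.1)) (expi (grid n'.+2 x.2)).
Proof.
move=> inj; rewrite /footprint_symbol big_footprint //; apply: eq_bigr => q _.
by rewrite char_reduce expiD !expi_exprz.
Qed.

Lemma torus_greenE eps n' : {in tau &, injective (reduce n')} ->
  torus_green tau (reduce n' (a, b)) eps = green_sum eps n'.+2.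
Proof.
move=> inj; rewrite /torus_green /green_sum; congr (_ / _).
have e (x : torus_pt n') : complex.Re (torus_char R x (reduce n' (a, b))) /
    (eps + normsq (footprint_symbol R tau x)) =
    green_integrand eps (grid n'.+2 x.1) (grid n'.+2 x.2).
  by rewrite char_reduce footprint_symbolE.
rewrite pair_big /= [in RHS](bigD1 (0 : torus_pt n')) //=.
have -> : grid n'.+2 0 = 0 by rewrite /grid mulr0 mul0r.
by rewrite addrAC subrr add0r; apply: eq_bigr => x _; rewrite e.
Qed.

End GreenSum.

Section CovarianceLimit.
Variables (R : realType) (tau : polyomino) (a b : int).
Hypothesis tau_ge2 : (2 <= #|` tau|)%N.
Local Notation A := (#|` tau|).

(** The moment bound is of order (ln N)^2 and enters squared, against sqrt N; any power bound on the
    logarithm with a small exponent suffices. *)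
Lemma torus_error_le n' (kap : R) : 0 < kap -> exists C : R, 0 <= C /\
  forall N, (0 < N)%N -> torus_error tau n' N kap <= C / Num.sqrt (Num.sqrt N.+1%:R).
Proof.
move=> kap0; set t := #|{: torus_pt n' + torus_pt n'}|%:R : R.
have t0 : 0 <= t by [].
have bk0 : 0 <= A%:R / kap by rewrite divr_ge0 // ltW.
set S := stein_constant (torus_pt n' + torus_pt n')%type kap.
have S0 : 0 <= S.
  rewrite addr_ge0 // ?divr_ge0 ?sqr_ge0 ?(ltW kap0) // mulr_ge0 //.
  by rewrite prod_remainder_ge0 // divr_ge0 // ltW.
pose k1 := t * (A%:R / kap + 17).
pose k2 := 64 * k1 ^+ 2 + 257 + 8 * (t * A%:R ^+ 2) ^+ 2.
have k10 : 0 <= k1 by rewrite mulr_ge0 // addr_ge0.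
exists (2 * S * k2 ^+ 2); split; first by rewrite mulr_ge0 ?sqr_ge0 // mulr_ge0.
(* [s] and [r] are the fourth and the sixteenth root of N + 1. Since ln (N + 1) <= 16 r, the
   numerator is O(r^4) = O(s), while sqrt N is at least s^2 / 2; the 17 in [k1] is 16 + 1. *)
move=> N N0; set s := Num.sqrt (Num.sqrt N.+1%:R); set r := Num.sqrt (Num.sqrt s).
have N1 : 1 <= N.+1%:R :> R by rewrite ler1n.
have sq1 (x : R) : 1 <= x -> 1 <= Num.sqrt x by move=> x1; rewrite -[leLHS]sqrtr1 ler_sqrt // (le_trans _ x1).
have s1 : 1 <= s by rewrite !sq1.
have r1 : 1 <= r by rewrite !sq1.
have r4 : r ^+ 4 = s.
  by rewrite (exprM r 2 2) !sqr_sqrtr ?sqrtr_ge0 // (le_trans _ s1).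
have s4 : s ^+ 4 = N.+1%:R.
  by rewrite (exprM s 2 2) !sqr_sqrtr ?sqrtr_ge0 // (le_trans _ N1).
have lnN : ln N.+1%:R <= 16 * r.
  rewrite -s4 -r4 -exprM lnXn ?(lt_le_trans ltr01) // -[leLHS]mulr_natl ler_pM2l //.
  by rewrite ltW // ln_sublinear // (lt_le_trans ltr01).
rewrite /torus_error -/S; set Q := fourth_moment_bound _ _ _ _.
have L0 := log_state_bound_ge0 (torus_pt n' + torus_pt n')%type N kap0 (ler0n R A).
have L1 : log_state_bound (torus_pt n' + torus_pt n')%type N kap A%:R <= k1 * r.
  rewrite /log_state_bound -/t -mulrA ler_wpM2l //.
  by have : A%:R / kap <= A%:R / kap * r := ler_peMr bk0 r1; move: lnN r1; lra.
have Q1 : 1 + Q <= k2 * r ^+ 2.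
  have L2 : log_state_bound (torus_pt n' + torus_pt n')%type N kap A%:R ^+ 2 <= k1 ^+ 2 * r ^+ 2.
    by rewrite -exprMn ler_sqr ?nnegrE // mulr_ge0 // (le_trans _ r1).
  have r2 : 1 <= r ^+ 2 by rewrite exprn_ege1.
  have T0 := sqr_ge0 (t * A%:R ^+ 2); have := ler_peMr T0 r2.
  rewrite /Q /fourth_moment_bound -/t /k2; move: L2 r2; set X := _ ^+ 2; lra.
have Q0 : 0 <= 1 + Q.
  rewrite /Q /fourth_moment_bound -/t; have := sqr_ge0 (t * A%:R ^+ 2).
  by have := sqr_ge0 (log_state_bound (torus_pt n' + torus_pt n')%type N kap A%:R); lra.
have Q2 : (1 + Q) ^+ 2 <= k2 ^+ 2 * s.
  by rewrite -r4 (exprM r 2 2) -exprMn ler_sqr ?nnegrE // (le_trans Q0).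
have sN : s ^+ 2 / 2 <= Num.sqrt N%:R.
  rewrite -(@ler_sqr _ (s ^+ 2 / 2)) ?nnegrE ?divr_ge0 ?sqr_ge0 ?sqrtr_ge0 //.
  rewrite [leRHS]sqr_sqrtr // exprMn -exprM s4 -natr1.
  have : 1 <= N%:R :> R by rewrite ler1n.
  lra.
have s0 : 0 < s by exact: lt_le_trans s1.
have sN0 : 0 < Num.sqrt N%:R :> R by rewrite sqrtr_gt0 ltr0n.
rewrite ler_pdivrMr // (le_trans (ler_wpM2l S0 Q2)) //.
have h : 2 * S * k2 ^+ 2 / s * (s ^+ 2 / 2) <= 2 * S * k2 ^+ 2 / s * Num.sqrt N%:R.
  by rewrite ler_wpM2l // divr_ge0 ?(ltW s0) // mulr_ge0 ?sqr_ge0 // mulr_ge0.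
apply: le_trans h; rewrite le_eqVlt; apply/orP; left; apply/eqP; field.
by rewrite gt_eqF.
Qed.

Lemma cvg_green_sum (n : nat) (x : nat -> R) (eps : R) : 0 < eps ->
  x m @[m --> \oo] --> eps -> green_sum tau a b (x m) n @[m --> \oo] --> green_sum tau a b eps n.
Proof.
move=> e0 xe; have tm y z : green_integrand tau a b (x m) y z @[m --> \oo] --> green_integrand tau a b eps y z.
  apply: cvgMl_tmp; apply: cvgV; first by rewrite gt_eqF // ltr_pwDl // normsq_ge0.
  by apply: cvgD => //; exact: cvg_cst.
apply: cvgMr_tmp; apply: cvgB => //.
by apply: cvg_big => [|k _]; [exact: add_continuous|apply: cvg_big => [|l _]; [exact: add_continuous|]].
Qed.

(** Divided by K w0, the main term of [torus_covariance] converges because the means divided by K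
    tend to the critical weights; the error is a bounded factor times (N + 1)^(-1/4). *)
Lemma covariance_limit_green (eps : R) : 0 < eps ->
  covariance_limit tau a b eps (green_sum tau a b eps).
Proof.
(* Beyond this threshold the torus has side at least 2 and more than four diameter bounds, as the
   aperiodicity of the footprint requires. *)
move=> eps0; exists (4 * diameter_bound tau + 2)%N => //= -[|[|n']]; rewrite /=; try lia.
move=> hn N N0 K al al0 w0 w [h1 h2 h3 h4 h5] [e1 e2] e3.
have nl : (4 * diameter_bound tau < n'.+2)%N by lia.
have inj := reduce_inj_large tau_ge2 nl; have ape := footprint_aperiodic_large tau_ge2 nl.
pose n2 : R := (n'.+2 * n'.+2)%:R; have n20 : 0 < n2 by rewrite ltr0n.
have A1 : 0 < A%:R - 1 :> R by rewrite subr_gt0 ltr1n.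
have A0 : 0 < A%:R :> R by rewrite ltr0n ltnW.
(* The means [mean_r] and [mean_l], computed from the multiplicities alone, so that no reference
   solution has to be followed along the sequence. *)
pose mr m : R := (N0 m)%:R / (A%:R - 1) / n2.
pose ml m : R := ((N m)%:R - mr m) / A%:R.
have c1P m : exists c1 : torus_pt n' + torus_pt n' -> nat,
    balanced (fun q : Defs.point n'.+2 (N m) (N0 m) => tag q)
      (fun t (v : vertex n'.+2) => tile_type tau t v) [set: Defs.point n'.+2 (N m) (N0 m)]%SET c1.
  have := h2 m; rewrite tilings_typed.
  have le := @balanced_le_N tau n' tau_ge2 inj (N m) (N0 m).
  by move=> /(card_tps_gt0 (tile_type_inj tau_ge2 inj ape) le)[c cb]; exists (fun t => c t).
have mrE m c1 : balanced (fun q : Defs.point n'.+2 (N m) (N0 m) => tag q)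
      (fun t (v : vertex n'.+2) => tile_type tau t v) [set: Defs.point n'.+2 (N m) (N0 m)]%SET c1 ->
    mean_r R c1 = mr m /\ mean_l R c1 = ml m.
  move=> c1b; have e : mean_r R c1 = mr m.
    have [_ e] := balancedP inj (N m) (N0 m) c1 c1b; rewrite /mr e natrM -subn1 natrB 1?ltnW // [(_ - _) * _]mulrC.
    by rewrite mulfK ?gt_eqF.
  split=> //; rewrite /ml -e (mean_N R inj c1b) addrAC subrr add0r mulrAC divff ?mul1r // gt_eqF //.
have cK : (K m)%:R @[m --> \oo] --> (+oo%R : set_system R) by apply/cvgrnyP.
have K0 : \forall m \near \oo, 0 < (K m)%:R :> R.
  by move/cvgryPgt : cK => /(_ 0).
have cr : mr m / (K m)%:R @[m --> \oo] --> w0.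
  have -> : w0 = al0 * ((A%:R - 1)^-1 / n2).
    rewrite -e2 /n2 natrM -expr2; field.
    by rewrite !gt_eqF //.
  rewrite (_ : (fun m => _) = fun m => (N0 m)%:R / (K m)%:R * ((A%:R - 1)^-1 / n2)).
    exact: cvgMr_tmp.
  by apply/funext => m; rewrite /mr; ring.
have cl : ml m / (K m)%:R @[m --> \oo] --> w.
  have -> : w = (al - w0) * A%:R^-1.
    by rewrite -e1 addrAC subrr add0r mulrAC divff ?mul1r // gt_eqF.
  rewrite (_ : (fun m => _) = fun m => ((N m)%:R / (K m)%:R - mr m / (K m)%:R) * A%:R^-1).
    by apply: cvgMr_tmp; apply: cvgB.
  by apply/funext => m; rewrite /ml; ring.
(* As a limit of means [w0] is nonnegative; the positive ratio [eps] then excludes zero and forces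
   [w] to be positive. *)
have w00 : 0 <= w0.
  apply: cvgr_to_ge cr _; apply: nearW => m; rewrite /mr !divr_ge0 //; exact: ltW.
have w0_gt0 : 0 < w0.
  rewrite lt_neqAle w00 andbT eq_sym; apply/eqP => w0z.
  by move: eps0; rewrite -e3 w0z mul0r ltxx.
have w_gt0 : 0 < w.
  have := eps0; rewrite -e3 pmulr_rgt0 // invr_gt0 //.
have al_gt0 : 0 < al by rewrite -e1 addr_gt0 // mulr_gt0.
(* Eventually the means are at least half of [w * K] and [w0 * K], while N is at most [2 * al * K];
   hence both exceed [2 * kap * N]. *)
pose kap := Num.min w w0 / (8 * al).
have mw : 0 < Num.min w w0 by rewrite lt_min w_gt0.
have kap0 : 0 < kap by rewrite divr_gt0 // mulr_gt0.
have [C [C0 HC]] := torus_error_le n' kap0.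
have cN : (N m)%:R @[m --> \oo] --> (+oo%R : set_system R).
  apply/cvgryPge => B; near=> m.
  have k1 : al / 2 * (K m)%:R <= (N m)%:R.
    rewrite -ler_pdivlMr; last by near: m.
    near: m; apply: cvgr_ge h4 _ _; lra.
  apply: le_trans k1; rewrite -ler_pdivrMl ?divr_gt0 //.
  by near: m; move/cvgryPge: cK; apply.
have cratio : mr m / ml m @[m --> \oo] --> eps.
  rewrite -e3; apply: cvg_trans (cvgM cr (cvgV (lt0r_neq0 w_gt0) cl)).
  apply: near_eq_cvg; near=> m; rewrite /= invf_div mulrA divfK // gt_eqF //.
  by near: m.
have cF : mr m / (K m)%:R / w0 * green_sum tau a b (mr m / ml m) n'.+2
    @[m --> \oo] --> green_sum tau a b eps n'.+2.
  have -> : green_sum tau a b eps n'.+2 = w0 / w0 * green_sum tau a b eps n'.+2.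
    by rewrite divff ?mul1r // gt_eqF.
  by apply: cvgM; [exact: cvgMr_tmp|exact: cvg_green_sum].
pose s m : R := Num.sqrt (Num.sqrt (N m).+1%:R).
have cs : (s m)^-1 @[m --> \oo] --> (0 : R).
  apply/gtr0_cvgV0; first by apply: nearW => m; rewrite !sqrtr_gt0.
  apply/cvgryPge => B; near=> m.
  apply: (@le_trans _ _ (Num.sqrt (Num.sqrt ((B ^+ 2) ^+ 2)))).
    by rewrite sqrtr_sqr ger0_norm ?sqr_ge0 // sqrtr_sqr ler_norm.
  rewrite /s !ler_sqrt ?sqrtr_ge0 // -natr1.
  apply: (@le_trans _ _ (N m)%:R); last by rewrite lerDl.
  by near: m; move/cvgryPge: cN; apply.
pose G m : R := n2 * (ml m / (K m)%:R / w0) * (C * (s m)^-1).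
have cG : G m @[m --> \oo] --> (0 : R).
  rewrite -[X in _ --> X](mulr0 (n2 * (w / w0))) -[X in _ * X](mulr0 C).
  apply: cvgM; last exact: cvgMl_tmp.
  by apply: cvgMl_tmp; exact: cvgMr_tmp.
have key : \forall m \near \oo,
   `|covariance_copies R tau n'.+2 (N m) (N0 m) a b / ((K m)%:R * w0)
    - mr m / (K m)%:R / w0 * green_sum tau a b (mr m / ml m) n'.+2| <= G m.
  near=> m; have Km : 0 < (K m)%:R :> R by near: m.
  have [c1 c1b] := c1P m; have [er el] := mrE m c1 c1b.
  have hN : (N m)%:R / (K m)%:R <= 2 * al.
    by apply: ltW; near: m; apply: cvgr_lt h4 _ _; lra.
  have bnd (y z : R) : 0 < z -> Num.min w w0 <= z -> z / 2 <= y / (K m)%:R ->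
      2 * kap * (N m)%:R <= y.
    move=> z0 mz; rewrite ler_pdivlMr // => h; apply: le_trans h.
    have -> : 2 * kap * (N m)%:R = (Num.min w w0 / (4 * al)) * ((N m)%:R / (K m)%:R) * (K m)%:R.
      by rewrite /kap; field; rewrite !gt_eqF.
    rewrite ler_pM2r //; apply: (@le_trans _ _ (Num.min w w0 / (4 * al) * (2 * al))).
      by rewrite ler_wpM2l // divr_ge0 ?(ltW mw) // mulr_ge0 // ltW.
    have -> : Num.min w w0 / (4 * al) * (2 * al) = Num.min w w0 / 2 by field; rewrite gt_eqF.
    by rewrite ler_pM2r.
  have kl : 2 * kap * (N m)%:R <= ml m.
    apply: (bnd _ w) => //; first by rewrite ge_min lexx.
    by near: m; apply: cvgr_ge cl _ _; rewrite ltr_pdivrMr // ltr_pMr // ltr1n.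
  have kr : 2 * kap * (N m)%:R <= mr m.
    apply: (bnd _ w0) => //; first by rewrite ge_min lexx orbT.
    by near: m; apply: cvgr_ge cr _ _; rewrite ltr_pdivrMr // ltr_pMr // ltr1n.
  have AN : A%:R <= kap * (N m)%:R.
    rewrite -ler_pdivrMl //.
    by near: m; move/cvgryPge: cN; apply.
  have NN : (0 < N m)%N.
    by rewrite -(ltr_nat R); near: m; move/cvgryPgt : cN => /(_ 0).
  have Am : A%:R <= mr m.
    by apply: le_trans AN _; apply: le_trans kr; rewrite -mulrA ler_peMl ?ler1n // mulr_ge0 // ltW.
  have := @torus_covariance R tau n' tau_ge2 inj (N m) (N0 m) c1 c1b.
  rewrite er el => /(_ Am kap kap0 NN kl kr AN (reduce n' (a, b))).
  rewrite -covariance_copiesE // torus_greenE // => h.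
  have -> : forall x y, x / ((K m)%:R * w0) - y / (K m)%:R / w0 * green_sum tau a b (mr m / ml m) n'.+2
      = (x - y * green_sum tau a b (mr m / ml m) n'.+2) / ((K m)%:R * w0).
    by move=> x y; field; rewrite !gt_eqF.
  rewrite normrM [X in _ * X]gtr0_norm ?invr_gt0 ?mulr_gt0 //.
  rewrite ler_pdivrMr ?mulr_gt0 //; apply: le_trans h _.
  apply: (@le_trans _ _ (n2 * ml m * (C / s m))).
    have ml0 : 0 <= ml m by apply: le_trans kl; rewrite mulr_ge0 // mulr_ge0 // ltW.
    by apply: ler_wpM2l; [exact: mulr_ge0 (ltW n20) ml0|exact: HC].
  rewrite le_eqVlt; apply/orP; left; apply/eqP; rewrite /G; field.
  by rewrite !gt_eqF // /s !sqrtr_gt0.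
have c1' : mr m / (K m)%:R / w0 * green_sum tau a b (mr m / ml m) n'.+2 - G m
    @[m --> \oo] --> green_sum tau a b eps n'.+2.
  by rewrite -[X in _ --> X]subr0; exact: cvgB.
have c2' : mr m / (K m)%:R / w0 * green_sum tau a b (mr m / ml m) n'.+2 + G m
    @[m --> \oo] --> green_sum tau a b eps n'.+2.
  by rewrite -[X in _ --> X]addr0; exact: cvgD.
apply: (squeeze_cvgr _ c1' c2'); near=> m.
have : `|covariance_copies R tau n'.+2 (N m) (N0 m) a b / ((K m)%:R * w0)
    - mr m / (K m)%:R / w0 * green_sum tau a b (mr m / ml m) n'.+2| <= G m by near: m.
by rewrite ler_distl.
Unshelve. all: by end_near.
Qed.

End CovarianceLimit.

(** * Integrals on intervals and boxes *)

Section IntervalIntegral.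
Variable R : realType.
Notation mu := (@lebesgue_measure R).
Implicit Types (p q : R) (f g H h : R -> R).

Lemma continuous_integrable p q g : continuous g -> mu.-integrable `[p, q] (EFin \o g).
Proof.
move=> cg; apply: continuous_compact_integrable; first exact: segment_compact.
exact: continuous_subspaceT.
Qed.

Lemma Rintegral_itv_split f p x q : p <= x -> x <= q -> mu.-integrable `[p, q] (EFin \o f) ->
  \int[mu]_(t in `[p, q]) f t = \int[mu]_(t in `[p, x]) f t + \int[mu]_(t in `[x, q]) f t.
Proof.
move=> px xq fi; apply/eqP; rewrite addrC -subr_eq; apply/eqP.
rewrite Rintegral_itvB // Rintegral_itv_obnd_cbnd //.
by apply: integrableS fi => //; apply: subset_itvr; rewrite bnd_simp.
Qed.

(** Mean value theorem for [H - G], where [G] is the primitive of [g]; the majorant [h] enters only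
    through its antiderivative. *)
Lemma Rintegral_le_antiderivative p q g h H : p <= q -> continuous g ->
  (forall x, p <= x <= q -> is_derive x 1 H (h x)) ->
  (forall x, p <= x <= q -> g x <= h x) ->
  \int[mu]_(x in `[p, q]) g x <= H q - H p.
Proof.
move=> pq cg dH gh; have gi a b := @continuous_integrable a b g cg.
(* The primitive starts at [p - 1] so that [p] itself is an interior point for the fundamental
   theorem. *)
pose G x := \int[mu]_(t in `[p - 1, x]) g t.
have GE : \int[mu]_(x in `[p, q]) g x = G q - G p.
  rewrite /G (@Rintegral_itv_split g (p - 1) p q) //; first by rewrite addrAC subrr add0r.
  by rewrite gerBl.
have dG x : p <= x <= q -> is_derive x 1 G (g x).
  move=> /andP[px xq]; have [|||dx <-] := @continuous_FTC1_closed R g (p - 1) x (x + 1) _ (gi _ _).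
  - by rewrite ltrDl.
  - by rewrite (lt_le_trans _ px) // gtrBl.
  - exact: cg.
  by rewrite derive1E; exact: derivableP.
have [||c cpq] := @MVT_segment R (H \- G) (h \- g) p q pq.
- by move=> x; rewrite in_itv /= => /andP[/ltW px /ltW xq]; apply: is_deriveB; [apply: dH|apply: dG]; rewrite px.
- apply: derivable_within_continuous => x; rewrite in_itv /= => xpq.
  by apply: derivableB; [have [] := dH x xpq|have [] := dG x xpq].
rewrite GE /= => e.
have : 0 <= (H q - G q) - (H p - G p).
  by rewrite e mulr_ge0 ?subr_ge0 // gh // -[_ && _]/(c \in `[p, q]).
lra.
Qed.

Lemma Rintegral_itvN g p q : continuous g ->
  \int[mu]_(x in `[p, q]) (- g x) = - (\int[mu]_(x in `[p, q]) g x).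
Proof.
move=> cg; under eq_Rintegral do rewrite -mulN1r.
by rewrite RintegralZl ?mulN1r //; exact: continuous_integrable.
Qed.

Lemma Rintegral_ge_antiderivative p q g h H : p <= q -> continuous g ->
  (forall x, p <= x <= q -> is_derive x 1 H (h x)) ->
  (forall x, p <= x <= q -> h x <= g x) ->
  H q - H p <= \int[mu]_(x in `[p, q]) g x.
Proof.
move=> pq cg dH hg.
have := @Rintegral_le_antiderivative p q (fun x => - g x) (fun x => - h x) (fun x => - H x) pq.
rewrite Rintegral_itvN // => le; have : - (\int[mu]_(x in `[p, q]) g x) <= - H q - - H p.
  apply: le.
  - by move=> x; apply: continuousN; exact: cg.
  - by move=> x xpq; apply: is_deriveN; exact: dH.
  - by move=> x xpq; rewrite lerN2; exact: hg.
lra.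
Qed.

Lemma Rintegral_antiderivative p q g H : p <= q -> continuous g ->
  (forall x, p <= x <= q -> is_derive x 1 H (g x)) ->
  \int[mu]_(x in `[p, q]) g x = H q - H p.
Proof.
move=> pq cg dH; apply/eqP; rewrite eq_le; apply/andP; split.
  by apply: Rintegral_le_antiderivative pq cg dH _.
by apply: Rintegral_ge_antiderivative pq cg dH _.
Qed.

Lemma Rintegral_itv_cst (k : R) p q : p <= q -> \int[mu]_(x in `[p, q]) k = k * (q - p).
Proof.
move=> pq; rewrite Rintegral_cst //= lebesgue_measure_itv /= lte_fin.
by case: ltP => [//|qp]; rewrite /= (@le_anti _ _ p q) ?subrr // pq.
Qed.

Lemma Rintegral_itv_bound f p q (m : R) : p <= q -> mu.-integrable `[p, q] (EFin \o f) ->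
  (forall x, p <= x <= q -> `|f x| <= m) ->
  `|\int[mu]_(x in `[p, q]) f x| <= m * (q - p).
Proof.
move=> pq fi fm; apply: le_trans (le_normr_Rintegral _ fi) _ => //.
rewrite -Rintegral_itv_cst //; apply: le_Rintegral => //.
- exact: integrable_norm.
- by apply: continuous_integrable => x; exact: cst_continuous.
Qed.

End IntervalIntegral.

Section PlaneIntegral.
Variable R : realType.
Notation mu := (@lebesgue_measure R).
Notation mu2 := (@lebesgue2 R).
Implicit Types (h k : R * R -> R) (D : set (R * R)).

Definition bounded_measurable h :=
  measurable_fun [set: R * R] h /\ exists M, forall x, `|h x| <= M.
Local Notation bm := bounded_measurable.

Lemma bm_cst (c : R) : bm (fun=> c).
Proof. by split; [exact: measurable_cst|exists `|c|]. Qed.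

Lemma bmD h k : bm h -> bm k -> bm (fun x => h x + k x).
Proof.
move=> [mh [M hM]] [mk [K kK]]; split; first exact: measurable_funD.
by exists (M + K) => x; apply: le_trans (ler_normD _ _) _; exact: lerD.
Qed.

Lemma bmM h k : bm h -> bm k -> bm (fun x => h x * k x).
Proof.
move=> [mh [M hM]] [mk [K kK]]; split; first exact: measurable_funM.
by exists (M * K) => x; rewrite normrM; exact: ler_pM.
Qed.

Lemma bmN h : bm h -> bm (fun x => - h x).
Proof.
by move=> /(bmM (bm_cst (- 1))); congr bm; apply/funext => x; rewrite mulN1r.
Qed.

Lemma bmB h k : bm h -> bm k -> bm (fun x => h x - k x).
Proof. by move=> bh /bmN; exact: bmD. Qed.

Lemma bm_norm h : bm h -> bm (fun x => `|h x|).
Proof.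
move=> [mh [M hM]]; split; last by exists M => x; rewrite normr_id.
exact: measurableT_comp.
Qed.

Lemma bm_sum (I : Type) (r : seq I) (h : I -> R * R -> R) : (forall i, bm (h i)) ->
  bm (fun x => \sum_(i <- r) h i x).
Proof.
move=> bh; elim: r => [|i r IH].
  rewrite (_ : (fun _ => _) = fun=> 0); first exact: bm_cst.
  by apply/funext => x; rewrite big_nil.
rewrite (_ : (fun _ => _) = fun x => h i x + \sum_(j <- r) h j x); first exact: bmD.
by apply/funext => x; rewrite big_cons.
Qed.

Lemma bm_indic D : measurable D -> bm (fun x => \1_D x).
Proof.
move=> mD; split; first exact: measurable_indic.
by exists 1 => x; rewrite indicE; case: (_ \in _); rewrite ?normr1 ?normr0.
Qed.

Lemma bm_swap h : bm h -> bm (fun x => h (x.2, x.1)).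
Proof.
move=> [mh [M hM]]; split; last by exists M.
by apply: (measurableT_comp mh); exact: measurable_fun_pair.
Qed.

Lemma itv_fin (r s : R) : (mu `[r, s] < +oo)%E.
Proof. by rewrite lebesgue_measure_itv /=; case: ifP => // _; rewrite -EFinB ltry. Qed.

Definition box (p q r s : R) : set (R * R) := `[p, q] `*` `[r, s].

Lemma measurable_box p q r s : measurable (box p q r s).
Proof. exact: measurableX. Qed.

Lemma box_fin p q r s : (mu2 (box p q r s) < +oo)%E.
Proof.
rewrite /lebesgue2 /box product_measure1E //= !lebesgue_measure_itv /=.
by case: ifP => _; case: ifP => _; rewrite ?mule0 ?mul0e // -!EFinB -EFinM ltry.
Qed.

Lemma bm_integrable h D : bm h -> measurable D -> (mu2 D < +oo)%E ->
  mu2.-integrable D (EFin \o h).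
Proof.
move=> [mh [M hM]] mD fD; apply: measurable_bounded_integrable => //.
  exact: measurable_funTS.
by exists M; split; rewrite ?num_real // => y My x _ /=; exact: le_trans (hM x) (ltW My).
Qed.

Lemma bm_box_integrable h p q r s : bm h -> mu2.-integrable (box p q r s) (EFin \o h).
Proof. by move=> bh; apply: bm_integrable => //; [exact: measurable_box|exact: box_fin]. Qed.

Lemma bm_section_integrable h x r s : bm h ->
  mu.-integrable `[r, s] (EFin \o (fun y => h (x, y))).
Proof.
move=> [mh [M hM]]; apply: measurable_bounded_integrable => //.
- exact: itv_fin.
- apply: measurable_funTS; apply: (measurableT_comp mh); exact: pair1_measurable.
- by exists M; split; rewrite ?num_real // => y My t _ /=; exact: le_trans (hM _) (ltW My).
Qed.

Section Fubini.
Variables (h : R * R -> R) (p q r s : R).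
Hypothesis bh : bm h.

(** Extension by zero, so that Fubini's theorem on the whole plane applies. *)
Let f (x : R * R) : \bar R := (h \_ (box p q r s) x)%:E.

Let fi : mu2.-integrable setT f.
Proof.
have [fi _] := @integrable_mkcond _ _ _ mu2 (box p q r s) (EFin \o h) (measurable_box p q r s).
have := fi (bm_box_integrable p q r s bh).
by apply: eq_integrable => // x _; rewrite /f /= restrict_EFin.
Qed.

Let fE1 x : (\int[mu]_y f (x, y) = ((fun x => \int[mu]_(y in `[r, s]) h (x, y)) \_ `[p, q] x)%:E)%E.
Proof.
rewrite /f patchE; case: ifPn => [xpq|xpq]; last first.
  by rewrite integral0_eq // => y _; rewrite patchE /box; case: ifPn => //; rewrite in_setX (negbTE xpq).
rewrite /Rintegral fineK; last exact: (integrable_fin_num _ (bm_section_integrable x r s bh)).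
rewrite [RHS]integral_mkcond; apply: eq_integral => y _ /=.
by rewrite !patchE /box in_setX xpq /=; case: ifP.
Qed.

Let fE2 y : (\int[mu]_x f (x, y) = ((fun y => \int[mu]_(x in `[p, q]) h (x, y)) \_ `[r, s] y)%:E)%E.
Proof.
rewrite /f patchE; case: ifPn => [yrs|yrs]; last first.
  by rewrite integral0_eq // => x _; rewrite patchE /box; case: ifPn => //; rewrite in_setX (negbTE yrs) andbF.
rewrite /Rintegral fineK; last exact: (integrable_fin_num _ (bm_section_integrable y p q (bm_swap bh))).
rewrite [RHS]integral_mkcond; apply: eq_integral => x _ /=.
by rewrite !patchE /box in_setX yrs andbT /=; case: ifP.
Qed.

Lemma section_integral_integrable :
  mu.-integrable `[p, q] (EFin \o (fun x => \int[mu]_(y in `[r, s]) h (x, y))).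
Proof.
have [_ mk] := @integrable_mkcond _ _ _ mu `[p, q]
  (EFin \o (fun x => \int[mu]_(y in `[r, s]) h (x, y))) (measurable_itv _).
apply: mk; have := integrable_fubini_F fi.
by apply: eq_integrable => // x _; rewrite [LHS]fE1 restrict_EFin.
Qed.

Lemma fubini_box : \int[mu2]_(x in box p q r s) h x =
  \int[mu]_(x in `[p, q]) \int[mu]_(y in `[r, s]) h (x, y).
Proof.
rewrite /Rintegral; congr fine; transitivity (\int[mu2]_x f x)%E.
  rewrite integral_mkcond; apply: eq_integral => x _.
  by rewrite /f restrict_EFin.
rewrite -(integral12_prod_meas1 fi) [RHS]integral_mkcond; apply: eq_integral => x _.
by rewrite [LHS]fE1 restrict_EFin.
Qed.

Lemma fubini_box_swap : \int[mu2]_(x in box p q r s) h x =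
  \int[mu]_(y in `[r, s]) \int[mu]_(x in `[p, q]) h (x, y).
Proof.
rewrite /Rintegral; congr fine; transitivity (\int[mu2]_x f x)%E.
  rewrite integral_mkcond; apply: eq_integral => x _.
  by rewrite /f restrict_EFin.
rewrite -(integral21_prod_meas1 fi) [RHS]integral_mkcond; apply: eq_integral => x _.
by rewrite [LHS]fE2 restrict_EFin.
Qed.

End Fubini.

End PlaneIntegral.

(** * Integral kernels of positive definite quadratic forms *)

Section ArctanLog.
Variable R : realType.
Implicit Types (x y u w k m : R).

Lemma is_derive_affine k m x : is_derive x 1 (fun t : R => k * t + m) k.
Proof.
rewrite (_ : (fun t : R => _) = (k \*: (id : R -> R)) + cst m) //.
by apply: is_derive_eq; rewrite addr0 /GRing.scale /= mulr1.
Qed.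

Lemma is_derive_linear k x : is_derive x 1 (fun t : R => k * t) k.
Proof.
rewrite (_ : (fun t : R => _) = k \*: (id : R -> R)) //.
by apply: is_derive_eq; rewrite /GRing.scale /= mulr1.
Qed.

Lemma is_derive_lam_add (f g : R -> R) x a b : is_derive x 1 f a -> is_derive x 1 g b ->
  is_derive x 1 (fun t => f t + g t) (a + b).
Proof. exact: is_deriveD. Qed.

Lemma is_derive_lam_mul (f g : R -> R) x a b : is_derive x 1 f a -> is_derive x 1 g b ->
  is_derive x 1 (fun t => f t * g t) (f x * b + g x * a).
Proof. exact: is_deriveM. Qed.

Lemma is_derive_lam_scale (f : R -> R) k x a : is_derive x 1 f a ->
  is_derive x 1 (fun t => k * f t) (k * a).
Proof. exact: is_deriveZ. Qed.

Lemma is_derive_lam_comp (f g : R -> R) x a b : is_derive (g x) 1 f a -> is_derive x 1 g b ->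
  is_derive x 1 (fun t => f (g t)) (a * b).
Proof. exact: is_derive1_comp. Qed.

Lemma atan_le w : 0 <= w -> atan w <= w.
Proof.
move=> w0; have [|c _] := @MVT_segment R atan (fun x => (1 + x ^+ 2)^-1) 0 w w0.
  by apply: continuous_subspaceT => x; exact: continuous_atan.
rewrite atan0 !subr0 => ->; rewrite ler_piMl // invf_le1; last by rewrite ltr_pwDl ?sqr_ge0.
by rewrite lerDl sqr_ge0.
Qed.

Lemma pihalf_sub_atan u : 0 < u -> pi / 2 - atan u <= u^-1.
Proof.
move=> u0; have t0 : 0 < atan u by rewrite -atan0; apply: lt_atan.
have t1 := atan_ltpi2 u; have pi0 := @pi_gt0 R.
have st : 0 < sin (atan u) by apply: sin_gt0_pi; lra.
suff -> : pi / 2 - atan u = atan u^-1 by apply: atan_le; rewrite invr_ge0 ltW.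
rewrite -[LHS](@tanK R); last by rewrite in_itv /=; apply/andP; split; lra.
congr atan; rewrite -opprB tanN /tan sinBpihalf cosBpihalf mulNr opprK.
by rewrite -[in RHS](atanK u) /tan invf_div.
Qed.

(** The logarithm is the inverse hyperbolic sine of [D * t / sqrt A], up to an additive constant. *)
Lemma is_derive_ln_sqrt (A D x : R) : 0 < A -> 0 < D ->
  is_derive x 1 (fun t => ln (D * t + Num.sqrt (A + (D * t) ^+ 2)) / D)
    (Num.sqrt (A + (D * x) ^+ 2))^-1.
Proof.
move=> A0 D0; set s := fun t : R => Num.sqrt (A + (D * t) ^+ 2).
have rad t : 0 < A + (D * t) ^+ 2 by rewrite ltr_pwDl ?sqr_ge0.
have s0 t : 0 < s t by rewrite sqrtr_gt0.
have ss t : s t ^+ 2 = A + (D * t) ^+ 2 by rewrite sqr_sqrtr // ltW.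
have pos t : 0 < D * t + s t.
  have : - (D * t) < s t.
    have [|n0] := leP (- (D * t)) 0; first by move=> h; exact: le_lt_trans h (s0 t).
    by rewrite -ltr_sqr ?nnegrE ?ltW // ss sqrrN ltrDr.
  by rewrite -subr_gt0 opprK addrC.
have dsq : is_derive x 1 (fun t : R => A + (D * t) ^+ 2) (2 * D ^+ 2 * x).
  have dx := is_derive_linear D x.
  rewrite (_ : (fun t : R => _) = fun t => D * t * (D * t) + A); last first.
    by apply/funext => t; rewrite addrC expr2.
  apply: (is_derive_eq (is_derive_lam_add (is_derive_lam_mul dx dx) (is_derive_cst A x 1))).
  by rewrite addr0; ring.
have ds : is_derive x 1 s ((2 * s x)^-1 * (2 * D ^+ 2 * x)).
  exact: (@is_derive1_comp R Num.sqrt _ x _ _ (is_derive1_sqrt (rad x)) dsq).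
have din : is_derive x 1 (fun t : R => D * t + s t) (D + (2 * s x)^-1 * (2 * D ^+ 2 * x)).
  have dx := is_derive_linear D x.
  exact: (is_deriveD dx ds).
have dl := is_derive_lam_scale D^-1 (@is_derive_lam_comp (@ln R) (fun t => D * t + s t) x _ _ (is_derive1_ln (pos x)) din).
rewrite (_ : (fun t : R => ln _ / D) = (fun t => D^-1 * ln (D * t + s t))); last first.
  by apply/funext => t; rewrite mulrC.
apply: (is_derive_eq dl).
have := pos x; have := s0 x; rewrite -/(s x); move: (s x) => r r0 p0.
by field; rewrite !gt_eqF.
Qed.

End ArctanLog.

Section QuadraticKernel.
Variables (R : realType) (al be ga : R).
Notation mu := (@lebesgue_measure R).
Notation mu2 := (@lebesgue2 R).
Hypotheses (al_gt0 : 0 < al) (ga_gt0 : 0 < ga).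
Let D2 := al * ga - be ^+ 2 / 4.
Hypothesis D2_gt0 : 0 < al * ga - be ^+ 2 / 4.
Implicit Types (x y eps rho : R).

Definition quad x y := al * x ^+ 2 + be * x * y + ga * y ^+ 2.
Definition kernel eps x y := (eps + quad x y)^-1.

(** Determinant over trace, a lower bound for the smaller eigenvalue of the form. *)
Definition quad_low : R := D2 / (al + ga).
Local Notation c := quad_low.

Lemma quad_low_gt0 : 0 < c.
Proof. by rewrite divr_gt0 // addr_gt0. Qed.

Lemma quad_ge x y : c * (x ^+ 2 + y ^+ 2) <= quad x y.
Proof.
rewrite /c mulrAC ler_pdivrMr ?addr_gt0 // /quad /D2.
have h1 := sqr_ge0 (al * x + be * y / 2); have h2 := sqr_ge0 (ga * y + be * x / 2).
nra.
Qed.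

Lemma quad_ge0 x y : 0 <= quad x y.
Proof.
by apply: le_trans (quad_ge x y); rewrite mulr_ge0 ?addr_ge0 ?sqr_ge0 // ltW // quad_low_gt0.
Qed.

Lemma kernel_gt0 eps x y : 0 < eps -> 0 < kernel eps x y.
Proof. by move=> e0; rewrite invr_gt0 ltr_pwDl // quad_ge0. Qed.

Lemma kernel_le eps x y : 0 < eps -> 0 < x ^+ 2 + y ^+ 2 ->
  kernel eps x y <= (c * (x ^+ 2 + y ^+ 2))^-1.
Proof.
move=> e0 xy; have c0 := quad_low_gt0.
have p1 : 0 < eps + quad x y by rewrite ltr_pwDl // quad_ge0.
have p2 : 0 < c * (x ^+ 2 + y ^+ 2) by exact: mulr_gt0.
rewrite lef_pV2 ?posrE //.
by apply: le_trans (quad_ge x y) _; rewrite lerDr ltW.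
Qed.

(** Completing the square in [y] gives [ga * (eps + quad x y) = disc ^ 2 + (ga * y + be * x / 2) ^
    2], so the integral of the kernel over the whole [y]-line is [pi / disc]. *)
Definition disc eps x := Num.sqrt (ga * eps + (Num.sqrt D2 * x) ^+ 2).

Lemma disc_gt0 eps x : 0 < eps -> 0 < disc eps x.
Proof. by move=> e0; rewrite sqrtr_gt0 ltr_pwDl ?sqr_ge0 // mulr_gt0. Qed.

Lemma disc_sqr eps x : 0 < eps -> disc eps x ^+ 2 = ga * eps + D2 * x ^+ 2.
Proof.
move=> e0; rewrite sqr_sqrtr ?addr_ge0 ?sqr_ge0 //; last by rewrite mulr_ge0 // ltW.
by rewrite exprMn sqr_sqrtr // ltW.
Qed.

Lemma kernelE eps x y : 0 < eps ->
  kernel eps x y = ga / (disc eps x ^+ 2 + (ga * y + be * x / 2) ^+ 2).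
Proof.
move=> e0; rewrite disc_sqr //.
have -> : ga * eps + D2 * x ^+ 2 + (ga * y + be * x / 2) ^+ 2 = ga * (eps + quad x y).
  by rewrite /quad /D2; field.
by rewrite invfM mulrA divff ?mul1r // gt_eqF.
Qed.

Lemma continuous_kernel_y eps x y0 : 0 < eps -> continuous (fun y => kernel eps x (y - y0)).
Proof.
move=> e0 y; apply: cvgV; first by rewrite gt_eqF // ltr_pwDl // quad_ge0.
apply: cvgD; first exact: cvg_cst.
have cy : (fun y => y - y0) @ y --> y - y0 by apply: cvgB; [exact: cvg_id|exact: cvg_cst].
apply: cvgD; last by apply: cvgMl_tmp; apply: (@continuous_comp _ _ _ (fun y => y - y0) (fun y => y ^+ 2)); [exact: cy|exact: exprn_continuous].
by apply: cvgD; [exact: cvg_cst|exact: cvgMl_tmp].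
Qed.

Lemma kernel_inner eps x y0 rho : 0 < eps -> 0 < rho ->
  \int[mu]_(y in `[y0 - rho, y0 + rho]) kernel eps x (y - y0) =
  (atan ((ga * rho + be * x / 2) / disc eps x) +
   atan ((ga * rho - be * x / 2) / disc eps x)) / disc eps x.
Proof.
move=> e0 r0; have s0 := disc_gt0 x e0; set s := disc eps x in s0 *.
pose H y := s^-1 * atan ((ga / s) * y + (be * x / 2 - ga * y0) / s).
have -> : \int[mu]_(y in `[y0 - rho, y0 + rho]) kernel eps x (y - y0) = H (y0 + rho) - H (y0 - rho).
  apply: Rintegral_antiderivative; [lra|exact: continuous_kernel_y|move=> y _].
  have da := is_derive_affine (ga / s) ((be * x / 2 - ga * y0) / s) y.
  have dt := @is_derive1_comp R (@atan R) _ y _ _ (is_derive1_atan _) da.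
  apply: (is_derive_eq (is_deriveZ s^-1 dt)); rewrite /GRing.scale /= kernelE // -/s.
  have h : 0 < s ^+ 2 + (ga * (y - y0) + be * x / 2) ^+ 2 by rewrite ltr_pwDl ?sqr_ge0 // exprn_gt0.
  have -> : 1 + (ga / s * y + (be * x / 2 - ga * y0) / s) ^+ 2 =
     (s ^+ 2 + (ga * (y - y0) + be * x / 2) ^+ 2) / s ^+ 2 by field; rewrite gt_eqF.
  set d := s ^+ 2 + _ in h *; move: s s0 d h {H da dt} => s s0 d h.
  by field; rewrite !gt_eqF.
rewrite /H -mulrBr mulrC; congr (_ / _).
rewrite -[- atan _]atanN; congr (atan _ + atan _); field; exact: lt0r_neq0.
Qed.

Lemma disc_ge eps x : 0 < eps -> Num.sqrt D2 * `|x| <= disc eps x.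
Proof.
move=> e0; rewrite -ler_sqr ?nnegrE ?mulr_ge0 ?sqrtr_ge0 //.
rewrite disc_sqr // exprMn sqr_sqrtr ?(ltW D2_gt0) // real_normK ?num_real //.
by rewrite lerDr mulr_ge0 // ltW.
Qed.

Let D := Num.sqrt D2.
Let D_gt0 : 0 < D. Proof. by rewrite sqrtr_gt0. Qed.

(** The loss from truncating the [y]-line. If [ga * rho + k] is at least half of [ga * rho], then
    [pi / 2 - atan] is at most the inverse argument. Otherwise |x| is at least [ga * rho / |be|], so
    [disc] is bounded below and the trivial bound [pi] suffices. *)
Lemma atan_defect eps x k rho : 0 < eps -> 0 < rho -> `|k| = `|be * x| / 2 ->
  (pi / 2 - atan ((ga * rho + k) / disc eps x)) / disc eps x <=
  2 / (ga * rho) + pi * `|be| / (D * (ga * rho)).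
Proof.
move=> e0 r0 kx; have s0 := disc_gt0 x e0; have sD := disc_ge x e0.
have gr : 0 < ga * rho by rewrite mulr_gt0.
have pi0 := @pi_gt0 R.
have t1 : 0 <= pi * `|be| / (D * (ga * rho)) by rewrite divr_ge0 ?mulr_ge0 // ltW.
have t2 : 0 <= 2 / (ga * rho) by rewrite divr_ge0 // ltW.
have [h|h] := leP (ga * rho / 2) (ga * rho + k).
  have p0 : 0 < ga * rho + k by apply: lt_le_trans h; rewrite divr_gt0.
  rewrite -[leLHS]addr0; apply: lerD => //.
  apply: (@le_trans _ _ (((ga * rho + k) / disc eps x)^-1 / disc eps x)).
    by rewrite ler_pM2r ?invr_gt0 // pihalf_sub_atan // divr_gt0.
  rewrite invf_div mulrAC divff ?gt_eqF // mul1r -[2 / _]invf_div.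
  by rewrite lef_pV2 ?posrE // divr_gt0.
rewrite -[leLHS]add0r; apply: lerD => //.
have bx : ga * rho <= `|be| * `|x|.
  rewrite -normrM; have := ler_norm (- k); rewrite normrN kx; lra.
have x0 : 0 < `|x|.
  rewrite lt_neqAle normr_ge0 andbT eq_sym; apply/eqP => xz.
  by move: bx; rewrite xz mulr0 leNgt gr.
apply: (@le_trans _ _ (pi / disc eps x)).
  rewrite ler_pM2r ?invr_gt0 //; have := atan_gtNpi2 ((ga * rho + k) / disc eps x); lra.
rewrite ler_pdivrMr //; apply: (@le_trans _ _ (pi * (`|be| * `|x|) / (ga * rho))).
  by rewrite ler_pdivlMr // ler_pM2l.
have -> : pi * (`|be| * `|x|) / (ga * rho) = pi * `|be| / (D * (ga * rho)) * (D * `|x|).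
  by field; rewrite !gt_eqF.
exact: ler_wpM2l.
Qed.

Lemma kernel_inner_bounds eps x y0 rho : 0 < eps -> 0 < rho ->
  pi / disc eps x - 2 * (2 / (ga * rho) + pi * `|be| / (D * (ga * rho)))
  <= \int[mu]_(y in `[y0 - rho, y0 + rho]) kernel eps x (y - y0) <= pi / disc eps x.
Proof.
move=> e0 r0; rewrite kernel_inner //; have s0 := disc_gt0 x e0.
have kE : `|be * x / 2| = `|be * x| / 2 by rewrite normrM normfV [X in _ / X = _]ger0_norm.
have h1 := @atan_defect eps x (be * x / 2) rho e0 r0 kE.
have h2 := @atan_defect eps x (- (be * x / 2)) rho e0 r0 (etrans (normrN _) kE).
set u1 := (ga * rho + be * x / 2) / _ in h1 *; set u2 := (ga * rho - be * x / 2) / _ in h2 *.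
have a1 := atan_ltpi2 u1; have a2 := atan_ltpi2 u2.
apply/andP; split; last by rewrite ler_pM2r ?invr_gt0 //; lra.
have e : (atan u1 + atan u2) / disc eps x =
  pi / disc eps x - (pi / 2 - atan u1) / disc eps x - (pi / 2 - atan u2) / disc eps x.
  by field; rewrite gt_eqF.
by rewrite e; move: h1 h2; lra.
Qed.

Lemma continuous_disc eps x0 : 0 < eps -> continuous (fun x => (disc eps (x - x0))^-1).
Proof.
move=> e0 x; apply: cvgV; first by rewrite gt_eqF // disc_gt0.
apply: (@continuous_comp _ _ _ (fun x => ga * eps + (D * (x - x0)) ^+ 2) Num.sqrt); last exact: sqrt_continuous.
apply: cvgD; first exact: cvg_cst.
apply: (@continuous_comp _ _ _ (fun x => D * (x - x0)) (fun y => y ^+ 2)); last exact: exprn_continuous.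
by apply: cvgMl_tmp; apply: cvgB; [exact: cvg_id|exact: cvg_cst].
Qed.

(** The boundary values are logarithms of [disc + D * rho] and [disc - D * rho], whose product is
    [ga * eps]: this is the source of the logarithmic singularity. *)
Lemma disc_integral eps x0 rho : 0 < eps -> 0 < rho ->
  \int[mu]_(x in `[x0 - rho, x0 + rho]) (disc eps (x - x0))^-1 =
  (2 * ln (D * rho + disc eps rho) - ln ga - ln eps) / D.
Proof.
move=> e0 r0; have s0 x := disc_gt0 x e0.
have ge0 : 0 < ga * eps by rewrite mulr_gt0.
pose L t := ln (D * t + disc eps t) / D.
have -> : \int[mu]_(x in `[x0 - rho, x0 + rho]) (disc eps (x - x0))^-1 =
   L ((x0 + rho) - x0) - L ((x0 - rho) - x0).
  apply: (@Rintegral_antiderivative R _ _ _ (fun x => L (x - x0))).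
  - lra.
  - exact: continuous_disc.
  - move=> x _; rewrite -[X in is_derive _ _ _ X]mulr1.
    have dx : is_derive x 1 (fun t : R => 1 * t + (- x0)) 1 by exact: is_derive_affine.
    rewrite (_ : (fun x => L (x - x0)) = L \o (fun t : R => 1 * t + (- x0))); last first.
      by apply/funext => t /=; rewrite mul1r.
    have := @is_derive1_comp R L _ x _ _ _ dx; apply.
    by rewrite mul1r; exact: is_derive_ln_sqrt.
rewrite addrAC subrr add0r addrAC subrr add0r /L -mulrBl; congr (_ / _).
have dN : disc eps (- rho) = disc eps rho by rewrite /disc mulrN sqrrN.
have sD := disc_sqr rho e0.
have p1 : 0 < D * rho + disc eps rho by rewrite addr_gt0 ?mulr_gt0.
have pr : (D * rho + disc eps rho) * (D * - rho + disc eps (- rho)) = ga * eps.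
  have DD : D ^+ 2 = D2 by rewrite sqr_sqrtr // ltW.
  have -> : (D * rho + disc eps rho) * (D * - rho + disc eps (- rho)) =
    disc eps rho ^+ 2 - D ^+ 2 * rho ^+ 2 by rewrite dN; ring.
  by rewrite sD DD; ring.
have -> : D * - rho + disc eps (- rho) = ga * eps / (D * rho + disc eps rho).
  by rewrite -pr mulrAC divff ?mul1r // gt_eqF.
by rewrite ln_div ?posrE // lnM ?posrE //; ring.
Qed.

Definition quad2 (x : R * R) : R := quad x.1 x.2.

Lemma measurable_quad : measurable_fun [set: R * R] quad2.
Proof.
have m1 := @measurable_fst _ _ (measurableTypeR R) (measurableTypeR R).
have m2 := @measurable_snd _ _ (measurableTypeR R) (measurableTypeR R).
have mc (k : R) := @measurable_cst _ _ (measurableTypeR R * measurableTypeR R)%type (measurableTypeR R) setT k.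
rewrite /quad2 /quad; apply: measurable_funD; [apply: measurable_funD|].
- by apply: measurable_funM => //; exact: measurable_funX.
- by apply: measurable_funM => //; exact: measurable_funM.
- by apply: measurable_funM => //; exact: measurable_funX.
Qed.

Lemma bm_kernel eps x0 y0 : 0 < eps -> bounded_measurable (fun z : R * R => kernel eps (z.1 - x0) (z.2 - y0)).
Proof.
move=> e0; split; last first.
  exists eps^-1 => x; rewrite gtr0_norm ?kernel_gt0 // lef_pV2 ?posrE ?ltr_pwDl ?quad_ge0 //.
  by rewrite lerDl quad_ge0.
(* The absolute value does not change the form, but makes the outer function continuous on the whole
   line. *)
rewrite (_ : (fun _ => _) = (fun t : R => (eps + `|t|)^-1) \o quad2
    \o (fun x : R * R => (x.1 - x0, x.2 - y0))); last first.
  by apply/funext => x /=; rewrite ger0_norm ?quad_ge0.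
apply: measurableT_comp; last first.
  apply: measurable_fun_pair; apply: measurable_funB; [exact: measurable_fst|exact: measurable_cst|
    exact: measurable_snd|exact: measurable_cst].
apply: measurableT_comp; last exact: measurable_quad.
apply: continuous_measurable_fun => t; apply: cvgV; first by rewrite gt_eqF // ltr_pwDl.
by apply: cvgD; [exact: cvg_cst|exact: norm_continuous].
Qed.

(** Replacing the inner integral by [pi / disc] costs a bounded error, and [disc_integral] evaluates
    the rest. What remains beside [ln eps] is a logarithm whose argument stays in a fixed compact
    part of the positive axis, since [eps < 1]. *)
Theorem box_kernel_asymptotic rho : 0 < rho -> exists C, forall eps x0 y0, 0 < eps -> eps < 1 ->
  `|\int[mu2]_(z in box (x0 - rho) (x0 + rho) (y0 - rho) (y0 + rho)) kernel eps (z.1 - x0) (z.2 - y0)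
    - pi / D * - ln eps| <= C.
Proof.
move=> r0; set E0 := 2 * (2 / (ga * rho) + pi * `|be| / (D * (ga * rho))).
pose B := 2 * (`|ln (D * rho)| + `|ln (D * rho + Num.sqrt (ga + (D * rho) ^+ 2))|).
exists (pi / D * (B + `|ln ga|) + E0 * (2 * rho)) => eps x0 y0 e0 e1.
have pi0 := @pi_gt0 R; have Dr : 0 < D * rho by rewrite mulr_gt0.
have gr : 0 < ga * rho by rewrite mulr_gt0.
have E00 : 0 <= E0 by rewrite mulr_ge0 // addr_ge0 // divr_ge0 ?mulr_ge0 // ?ltW // mulr_gt0.
rewrite (fubini_box _ _ _ _ (bm_kernel x0 y0 e0)) /=.
set F := fun x => \int[mu]_(y in `[y0 - rho, y0 + rho]) kernel eps (x - x0) (y - y0).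
have Fi : mu.-integrable `[x0 - rho, x0 + rho] (EFin \o F).
  exact: section_integral_integrable (bm_kernel x0 y0 e0).
have di : mu.-integrable `[x0 - rho, x0 + rho] (EFin \o (fun x => pi * (disc eps (x - x0))^-1)).
  apply: continuous_integrable => x; apply: cvgMl_tmp; exact: continuous_disc.
have dI : \int[mu]_(x in `[x0 - rho, x0 + rho]) (pi * (disc eps (x - x0))^-1) =
    pi * ((2 * ln (D * rho + disc eps rho) - ln ga - ln eps) / D).
  rewrite RintegralZl //; first by rewrite disc_integral.
  by apply: continuous_integrable; exact: continuous_disc.
have up : \int[mu]_(x in `[x0 - rho, x0 + rho]) F x <=
    pi * ((2 * ln (D * rho + disc eps rho) - ln ga - ln eps) / D).
  rewrite -dI; apply: le_Rintegral => // x _.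
  by have /andP[] := kernel_inner_bounds (x - x0) y0 e0 r0.
have lo : pi * ((2 * ln (D * rho + disc eps rho) - ln ga - ln eps) / D) - E0 * (2 * rho) <=
    \int[mu]_(x in `[x0 - rho, x0 + rho]) F x.
  have ci : mu.-integrable `[x0 - rho, x0 + rho] (EFin \o (fun _ : R => E0)).
    by apply: continuous_integrable => x; exact: cst_continuous.
  have -> : E0 * (2 * rho) = \int[mu]_(x in `[x0 - rho, x0 + rho]) E0.
    by rewrite Rintegral_itv_cst; [congr (_ * _); ring|lra].
  rewrite -dI -RintegralB //; apply: le_Rintegral => //.
    apply: continuous_integrable => x; apply: cvgB; last exact: cvg_cst.
    by apply: cvgMl_tmp; exact: continuous_disc.
  by move=> x _; have /andP[] := kernel_inner_bounds (x - x0) y0 e0 r0.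
have lnB : `|2 * ln (D * rho + disc eps rho)| <= B.
  have d1 : D * rho <= disc eps rho by have := disc_ge rho e0; rewrite gtr0_norm.
  have d2 : disc eps rho <= Num.sqrt (ga + (D * rho) ^+ 2).
    by rewrite /disc -/D ler_sqrt ?addr_ge0 ?sqr_ge0 ?(ltW ga_gt0) // lerD2r ler_piMr // ltW.
  have l1 : ln (D * rho) <= ln (D * rho + disc eps rho).
    by rewrite ler_ln ?posrE ?lerDl ?(le_trans _ d1) ?(ltW Dr) // addr_gt0 // (lt_le_trans Dr).
  have l2 : ln (D * rho + disc eps rho) <= ln (D * rho + Num.sqrt (ga + (D * rho) ^+ 2)).
    have p : 0 < D * rho + disc eps rho by rewrite addr_gt0 // (lt_le_trans Dr).
    have q : D * rho + disc eps rho <= D * rho + Num.sqrt (ga + (D * rho) ^+ 2) by rewrite lerD2l.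
    by rewrite ler_ln ?posrE // (lt_le_trans p).
  rewrite normrM ger0_norm // /B ler_pM2l // ler_norml.
  have := ler_norm (- ln (D * rho)); rewrite normrN.
  have := ler_norm (ln (D * rho + Num.sqrt (ga + (D * rho) ^+ 2))).
  have := normr_ge0 (ln (D * rho)); have := normr_ge0 (ln (D * rho + Num.sqrt (ga + (D * rho) ^+ 2))).
  lra.
have E1 : pi * ((2 * ln (D * rho + disc eps rho) - ln ga - ln eps) / D) - pi / D * - ln eps =
   pi / D * (2 * ln (D * rho + disc eps rho) - ln ga) by field; rewrite gt_eqF.
have b1 : `|pi / D * (2 * ln (D * rho + disc eps rho) - ln ga)| <= pi / D * (B + `|ln ga|).
  have pD : 0 < pi / D by rewrite divr_gt0.
  rewrite normrM (gtr0_norm pD) ler_pM2l //.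
  by apply: le_trans (ler_normB _ _) _; rewrite lerD2r.
have : 0 <= E0 * (2 * rho) by rewrite mulr_ge0 // mulr_ge0 // ltW.
move: b1; rewrite -E1 !ler_norml; move: up lo.
move: (pi / D * (B + `|ln ga|)) (E0 * (2 * rho)) (pi / D * - ln eps) (pi * (_ / D)) => z1 z2 z3 z4.
move: (\int[mu]_(x in _) F x) => z5.
lra.
Qed.

Section Oscillation.
Variables (a b : R).
Hypothesis a_neq0 : a != 0.

Let na : 0 < `|a|. Proof. by rewrite normr_gt0. Qed.

Lemma continuous_osc eps th y : 0 < eps -> continuous (fun x => cos (a * x + th) * kernel eps x y).
Proof.
move=> e0 x; apply: cvgM.
  apply: (@continuous_comp _ _ _ (fun x => a * x + th) (@cos R)); last exact: continuous_cos.
  by apply: cvgD; [exact: cvgMl_tmp|exact: cvg_cst].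
apply: cvgV; first by rewrite gt_eqF // ltr_pwDl // quad_ge0.
apply: cvgD; first exact: cvg_cst.
apply: cvgD; last exact: cvg_cst.
by apply: cvgD; [apply: cvgMl_tmp; exact: exprn_continuous|apply: cvgMr_tmp; exact: cvgMl_tmp].
Qed.

Lemma is_derive_kernel eps x y : 0 < eps ->
  is_derive x 1 (fun x => kernel eps x y) (- (2 * al * x + be * y) * kernel eps x y ^+ 2).
Proof.
move=> e0; have p : eps + quad x y != 0 by rewrite gt_eqF // ltr_pwDl // quad_ge0.
have dq : is_derive x 1 (fun x => eps + quad x y) (2 * al * x + be * y).
  have dl := is_derive_linear al x; have da := is_derive_affine 1 0 x.
  rewrite (_ : (fun x => eps + quad x y) =
     fun t => (al * t) * (1 * t + 0) + ((be * y) * t + (eps + ga * y ^+ 2))); last first.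
    by apply/funext => t; rewrite /quad; ring.
  apply: (is_derive_eq (is_derive_lam_add (is_derive_lam_mul dl da) (is_derive_affine _ _ _))).
  by ring.
have dv := @is_deriveV R (fun x => eps + quad x y) x _ 1 p dq.
apply: (is_derive_eq dv).
by rewrite /GRing.scale /= /kernel exprVn mulNr mulrC mulNr.
Qed.

(* H = sin (a x + th) f / a - sg f / |a| has H' >= cos (a x + th) f where f is
   monotone with sg f' <= 0; this replaces the second mean value theorem. *)
Lemma osc_upper eps th y p q sg m : 0 < eps -> p <= q -> sg = 1 \/ sg = -1 ->
  (forall x, p <= x <= q -> 0 <= sg * (2 * al * x + be * y)) ->
  (forall x, p <= x <= q -> kernel eps x y <= m) ->
  \int[mu]_(x in `[p, q]) (cos (a * x + th) * kernel eps x y) <= 2 * m / `|a|.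
Proof.
move=> e0 pq sgE mono fm.
pose f x := kernel eps x y; pose f' x := - (2 * al * x + be * y) * kernel eps x y ^+ 2.
have f0 x : 0 < f x by exact: kernel_gt0.
pose H x := (sin (a * x + th) / a - sg / `|a|) * f x.
pose h x := cos (a * x + th) * f x + (sin (a * x + th) / a - sg / `|a|) * f' x.
apply: (@le_trans _ _ (H q - H p)).
  apply: (@Rintegral_le_antiderivative R p q _ h H pq).
  - exact: continuous_osc.
  - move=> x _; have da := is_derive_affine a th x.
    have df := is_derive_kernel x y e0.
    have ds := is_derive_lam_scale a^-1 (@is_derive_lam_comp R (@sin R) (fun t => a * t + th) x _ _ (is_derive_sin _) da).
    have dm := is_derive_lam_mul (is_derive_lam_add ds (is_derive_cst (- (sg / `|a|)) x 1)) df.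
    rewrite (_ : H = fun t => (a^-1 * sin (a * t + th) + cst (- (sg / `|a|)) t) * kernel eps t y); last first.
      by apply/funext => t; rewrite /H [a^-1 * _]mulrC.
    apply: (is_derive_eq dm); rewrite /h /f' /f /=; move: (sg / _) (kernel _ _ _) => k l.
    by field.
  - move=> x xpq; rewrite /h lerDl.
    have s1 := sin_max (a * x + th).
    have -> : (sin (a * x + th) / a - sg / `|a|) * f' x =
       (sg * (2 * al * x + be * y)) * kernel eps x y ^+ 2 * ((1 - sg * (sin (a * x + th) * (`|a| / a))) / `|a|).
      rewrite /f'; have sg2 : sg * sg = 1 by case: sgE => ->; rewrite ?mulrNN mulr1.
      have aa : `|a| != 0 by rewrite gt_eqF.
      have -> : sg / `|a| = sg * (sg * sg) / `|a| by rewrite sg2 mulr1.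
      transitivity (- (2 * al * x + be * y) * kernel eps x y ^+ 2 *
         ((sg * sg) * (sin (a * x + th) * (`|a| / a)) - sg) / `|a|).
        by rewrite sg2; field; rewrite a_neq0 aa.
      by field; rewrite a_neq0 aa.
    rewrite mulr_ge0 //; first by rewrite mulr_ge0 ?sqr_ge0 // mono.
    rewrite divr_ge0 ?(ltW na) // subr_ge0.
    apply: le_trans (ler_norm _) _; rewrite !normrM normfV normr_id divff ?gt_eqF // mulr1.
    by case: sgE => ->; rewrite ?normrN normr1 mul1r.
have sa x : `|sin (a * x + th) / a| <= 1 / `|a|.
  by rewrite normrM normfV ler_pM2r ?invr_gt0 ?sin_max.
have up x : H x <= (1 - sg) * (f x / `|a|).
  have := sa x; rewrite ler_norml => /andP[_ l2].
  have -> : (1 - sg) * (f x / `|a|) = (1 / `|a| - sg / `|a|) * f x by ring.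
  by rewrite /H ler_pM2r // lerD2r.
have low x : - ((1 + sg) * (f x / `|a|)) <= H x.
  have := sa x; rewrite ler_norml => /andP[l1 _].
  have -> : - ((1 + sg) * (f x / `|a|)) = (- (1 / `|a|) - sg / `|a|) * f x by ring.
  by rewrite /H ler_pM2r // lerD2r.
have fp : f p / `|a| <= m / `|a| by rewrite ler_pM2r ?invr_gt0 // fm // lexx pq.
have fq : f q / `|a| <= m / `|a| by rewrite ler_pM2r ?invr_gt0 // fm // pq lexx.
have fp0 : 0 <= f p / `|a| by rewrite divr_ge0 // ltW.
have fq0 : 0 <= f q / `|a| by rewrite divr_ge0 // ltW.
have := up q; have := low p; rewrite -mulrA; move: fp fq fp0 fq0.
by move: (m / _) (f p / _) (f q / _) (H p) (H q) => M v1 v2 h1 h2; case: sgE => ->; lra.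
Qed.

Lemma osc_monotone eps th y p q sg m : 0 < eps -> p <= q -> sg = 1 \/ sg = -1 ->
  (forall x, p <= x <= q -> 0 <= sg * (2 * al * x + be * y)) ->
  (forall x, p <= x <= q -> kernel eps x y <= m) ->
  `|\int[mu]_(x in `[p, q]) (cos (a * x + th) * kernel eps x y)| <= 2 * m / `|a|.
Proof.
move=> e0 pq sgE mono fm; rewrite ler_norml (osc_upper th e0 pq sgE mono fm) andbT.
(* Shifting the phase by [pi] changes the sign of the integrand, so the upper bound yields the lower
   one. *)
have := osc_upper (th + pi) e0 pq sgE mono fm.
rewrite (_ : (fun x => _) = fun x => - (cos (a * x + th) * kernel eps x y)); last first.
  by apply/funext => x; rewrite addrA cosDpi mulNr.
by rewrite Rintegral_itvN; [lra|exact: continuous_osc].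
Qed.

(** For fixed [y] the kernel increases up to the vertex [xs] of the parabola and decreases
    afterwards; each monotone piece costs [2 * m / |a|]. *)
Lemma osc_segment eps th y p q m : 0 < eps -> p <= q ->
  (forall x, p <= x <= q -> kernel eps x y <= m) ->
  `|\int[mu]_(x in `[p, q]) (cos (a * x + th) * kernel eps x y)| <= 4 * m / `|a|.
Proof.
move=> e0 pq fm; pose xs := - (be * y) / (2 * al).
have xsE x : 2 * al * x + be * y = 2 * al * (x - xs) by rewrite /xs; field; rewrite gt_eqF.
have m0 : 0 <= m / `|a|.
  rewrite divr_ge0 ?(ltW na) // (le_trans _ (fm p _)) ?lexx ?pq //.
  by rewrite ltW // kernel_gt0.
have e4 : 4 * m / `|a| = 2 * (2 * m / `|a|) by ring.
have e2 : 2 * m / `|a| = 2 * (m / `|a|) by rewrite mulrA.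
have [xp|px] := leP xs p.
  have := @osc_monotone eps th y p q 1 m e0 pq (or_introl erefl) _ fm.
  rewrite e4 e2 => h; apply: le_trans (h _) _; last lra.
  by move=> x /andP[px _]; rewrite xsE mul1r !mulr_ge0 ?(ltW al_gt0) // subr_ge0 (le_trans xp).
have [qx|xq] := leP q xs.
  have := @osc_monotone eps th y p q (-1) m e0 pq (or_intror erefl) _ fm.
  rewrite e4 e2 => h; apply: le_trans (h _) _; last lra.
  move=> x /andP[_ xq]; rewrite xsE mulN1r -mulrN opprB !mulr_ge0 ?(ltW al_gt0) //.
  by rewrite subr_ge0 (le_trans xq).
rewrite (@Rintegral_itv_split _ _ p xs q) ?(ltW px) ?(ltW xq) //; last first.
  by apply: continuous_integrable; exact: continuous_osc.
have -> : 4 * m / `|a| = 2 * m / `|a| + 2 * m / `|a| by ring.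
apply: le_trans (ler_normD _ _) _; apply: lerD.
  apply: (@osc_monotone eps th y p xs (-1) m) => //; [exact: ltW|by right| |].
  - move=> x /andP[_ xq']; rewrite xsE mulN1r -mulrN opprB !mulr_ge0 ?(ltW al_gt0) //.
    by rewrite subr_ge0.
  - by move=> x /andP[px' xq']; apply: fm; rewrite px' (le_trans xq') // ltW.
apply: (@osc_monotone eps th y xs q 1 m) => //; [exact: ltW|by left| |].
- by move=> x /andP[px' _]; rewrite xsE mul1r !mulr_ge0 ?(ltW al_gt0) // subr_ge0.
- by move=> x /andP[px' xq']; apply: fm; rewrite xq' andbT (le_trans _ px') // ltW.
Qed.

Definition osc_fun eps th (z : R * R) := cos (a * z.1 + b * z.2 + th) * kernel eps z.1 z.2.

Lemma bm_osc eps th : 0 < eps -> bounded_measurable (osc_fun eps th).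
Proof.
move=> e0; apply: bmM.
  split; last by exists 1 => z; exact: cos_max.
  rewrite (_ : (fun z : R * R => _) = @cos R \o (fun z : R * R => a * z.1 + b * z.2 + th)) //.
  apply: measurableT_comp; first by apply: continuous_measurable_fun; exact: continuous_cos.
  apply: measurable_funD; last exact: measurable_cst.
  by apply: measurable_funD; apply: measurable_funM => //; exact: measurable_cst.
have := bm_kernel 0 0 e0; congr bounded_measurable.
by apply/funext => z; rewrite !subr0.
Qed.

Definition osc_square eps th t := \int[mu]_(y in `[- t, t]) \int[mu]_(x in `[- t, t]) osc_fun eps th (x, y).

(** Between the squares lie two strips with |y| >= t, where the inner integral is O(1 / (t^2 + y^2))
    and has total O(1 / t), and two strips with |y| <= t, where it is O(1 / t^2) on a length of 2 t.
    As [kernel_le] discards [eps], the constant is uniform in it. *)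
Lemma osc_square_cauchy : exists C, 0 <= C /\ forall eps th t t', 0 < eps -> 0 < t -> t <= t' ->
  `|osc_square eps th t' - osc_square eps th t| <= C / t.
Proof.
have c0 := quad_low_gt0; have pi0 := @pi_gt0 R.
have ac : 0 < `|a| * c by rewrite mulr_gt0.
exists (16 * (pi + 1) / (`|a| * c)); split.
  by rewrite divr_ge0 ?(ltW ac) // mulr_ge0 // addr_ge0 // ltW.
move=> eps th t t' e0 t0 tt'; have t'0 : 0 < t' by exact: lt_le_trans tt'.
have bo := bm_osc th e0.
pose G s y := \int[mu]_(x in `[- s, s]) osc_fun eps th (x, y).
have oE y : (fun x => osc_fun eps th (x, y)) = fun x => cos (a * x + (b * y + th)) * kernel eps x y.
  by apply/funext => x; rewrite /osc_fun /= addrA.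
have oi y p q : mu.-integrable `[p, q] (EFin \o (fun x => osc_fun eps th (x, y))).
  by rewrite oE; apply: continuous_integrable; exact: continuous_osc.
have Gi s p q : mu.-integrable `[p, q] (EFin \o G s).
  have := @section_integral_integrable R (fun z => osc_fun eps th (z.2, z.1)) p q (- s) s (bm_swap bo).
  by [].
pose bd y := 8 / (`|a| * c) / (t ^+ 2 + y ^+ 2).
have den y : 0 < t ^+ 2 + y ^+ 2 by rewrite ltr_pwDl ?sqr_ge0 // exprn_gt0.
have bdc : continuous bd.
  move=> y; apply: cvgMl_tmp; apply: cvgV; first by rewrite gt_eqF.
  by apply: cvgD; [exact: cvg_cst|exact: exprn_continuous].
have Gfar y : t <= `|y| -> `|G t' y| <= bd y.
  move=> ty; have y2 : t ^+ 2 <= y ^+ 2.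
    by rewrite -[y ^+ 2]real_normK ?num_real // ler_sqr ?nnegrE // ltW.
  have t2 : 0 < t ^+ 2 by rewrite exprn_gt0.
  (* Here y^2 >= t^2, so x^2 + y^2 is at least half of t^2 + y^2; this accounts for the inner factor
     2. *)
  have -> : bd y = 4 * (2 / (c * (t ^+ 2 + y ^+ 2))) / `|a|.
    by rewrite /bd; have := den y; move: (_ + _) => k k0; field; rewrite !gt_eqF.
  rewrite /G oE; apply: osc_segment => //; first lra.
  move=> x _; apply: (@le_trans _ _ (c * (x ^+ 2 + y ^+ 2))^-1).
    by apply: kernel_le => //; have := sqr_ge0 x; lra.
  have x2 := sqr_ge0 x; have xy0 : 0 < x ^+ 2 + y ^+ 2 by lra.
  rewrite -[2 / _]invf_div lef_pV2 ?posrE; [|exact: mulr_gt0|by rewrite divr_gt0 // mulr_gt0].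
  by rewrite -mulrA ler_pM2l //; lra.
have Gnear y : G t' y - G t y = \int[mu]_(x in `[- t', - t]) osc_fun eps th (x, y)
   + \int[mu]_(x in `[t, t']) osc_fun eps th (x, y).
  rewrite /G (@Rintegral_itv_split _ _ (- t') (- t) t') ?(oi y) //; try lra.
  by rewrite (@Rintegral_itv_split _ _ (- t) t t') ?(oi y) //; [ring|lra].
have piece y p q : p <= q -> (forall x, p <= x <= q -> t <= `|x|) ->
    `|\int[mu]_(x in `[p, q]) osc_fun eps th (x, y)| <= 4 / (`|a| * c * t ^+ 2).
  move=> pq tx; have -> : 4 / (`|a| * c * t ^+ 2) = 4 * (c * t ^+ 2)^-1 / `|a|.
    by field; rewrite !gt_eqF.
  rewrite oE; apply: osc_segment => // x xpq.
  have x2 : t ^+ 2 <= x ^+ 2.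
    by rewrite -[x ^+ 2]real_normK ?num_real // ler_sqr ?nnegrE ?tx // ltW.
  have t2 : 0 < t ^+ 2 by rewrite exprn_gt0.
  apply: (@le_trans _ _ (c * (x ^+ 2 + y ^+ 2))^-1).
    by apply: kernel_le => //; have := sqr_ge0 y; lra.
  have y2 := sqr_ge0 y; have xy0 : 0 < x ^+ 2 + y ^+ 2 by lra.
  by rewrite lef_pV2 ?posrE; [rewrite ler_pM2l //; lra|exact: mulr_gt0|exact: mulr_gt0].
have Gd y : `|G t' y - G t y| <= 8 / (`|a| * c * t ^+ 2).
  rewrite Gnear; apply: le_trans (ler_normD _ _) _.
  have -> : 8 / (`|a| * c * t ^+ 2) = 4 / (`|a| * c * t ^+ 2) + 4 / (`|a| * c * t ^+ 2) by ring.
  apply: lerD; apply: piece => [|x /andP[h1 h2]]; try lra.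
    by rewrite -normrN (le_trans _ (ler_norm _)) //; lra.
  by rewrite (le_trans _ (ler_norm _)).
have far p q : p <= q -> (forall y, p <= y <= q -> t <= `|y|) ->
    `|\int[mu]_(y in `[p, q]) G t' y| <= 8 * pi / (`|a| * c) / t.
  move=> pq ty; apply: le_trans (le_normr_Rintegral _ (Gi t' p q)) _ => //.
  apply: (@le_trans _ _ (\int[mu]_(y in `[p, q]) bd y)).
    apply: le_Rintegral => //; [exact: integrable_norm|exact: continuous_integrable|].
    by move=> y /= yp; apply: Gfar; apply: ty; rewrite in_itv in yp.
  pose H y := 8 / (`|a| * c) / t * atan (t^-1 * y).
  apply: (@le_trans _ _ (H q - H p)).
    apply: (@Rintegral_le_antiderivative R p q bd bd H) => // y _.
    have dl := is_derive_linear t^-1 y.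
    have da := @is_derive1_comp R (@atan R) _ y _ _ (is_derive1_atan _) dl.
    apply: (is_derive_eq (is_deriveZ (8 / (`|a| * c) / t) da)).
    rewrite /GRing.scale /= /bd; have := den y => d0.
    have -> : 1 + (t^-1 * y) ^+ 2 = (t ^+ 2 + y ^+ 2) / t ^+ 2 by field; rewrite gt_eqF.
    rewrite invf_div; move: (t ^+ 2 + _) d0 => k k0.
    by field; rewrite !gt_eqF.
  rewrite /H -mulrBr; have -> : 8 * pi / (`|a| * c) / t = 8 / (`|a| * c) / t * pi.
    by field; rewrite !gt_eqF.
  rewrite ler_pM2l ?divr_gt0 //.
  by have := atan_ltpi2 (t^-1 * q); have := atan_gtNpi2 (t^-1 * p); lra.
have -> : osc_square eps th t' - osc_square eps th t =
   \int[mu]_(y in `[- t', - t]) G t' y + \int[mu]_(y in `[t, t']) G t' y +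
   \int[mu]_(y in `[- t, t]) (G t' y - G t y).
  have l1 : - t' <= - t by rewrite lerN2.
  have l2 : - t <= t' by lra.
  have l3 : - t <= t by lra.
  rewrite RintegralB // /osc_square -/(G t') -/(G t).
  rewrite (Rintegral_itv_split l1 l2 (Gi t' (- t') t')) (Rintegral_itv_split l3 tt' (Gi t' (- t) t')).
  have reassoc (u1 u2 u3 u4 : R) : u1 + (u2 + u3) - u4 = u1 + u3 + (u2 - u4) by ring.
  exact: reassoc.
apply: le_trans (ler_normD _ _) _.
have m1 : `|\int[mu]_(y in `[- t, t]) (G t' y - G t y)| <= 16 / (`|a| * c) / t.
  have -> : 16 / (`|a| * c) / t = 8 / (`|a| * c * t ^+ 2) * (t - - t).
    by field; rewrite !gt_eqF.
  apply: Rintegral_itv_bound => //; first lra.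
  exact: (@integrableB _ _ _ mu `[- t, t] (measurable_itv _) (EFin \o G t') (EFin \o G t)).
have -> : 16 * (pi + 1) / (`|a| * c) / t =
  8 * pi / (`|a| * c) / t + 8 * pi / (`|a| * c) / t + 16 / (`|a| * c) / t by ring.
apply: lerD => //; apply: le_trans (ler_normD _ _) _; apply: lerD; apply: far; try lra.
- by move=> y /andP[h1 h2]; rewrite -normrN (le_trans _ (ler_norm _)) //; lra.
- by move=> y /andP[h1 h2]; rewrite (le_trans _ (ler_norm _)).
Qed.

End Oscillation.

End QuadraticKernel.

(** * Limits over growing boxes and logarithmic asymptotics *)

Section CauchyLimit.
Variable R : realType.

Lemma cauchy_tail_limit (F : R -> R) (C : R) : 0 <= C ->
  (forall t t', 0 < t -> t <= t' -> `|F t' - F t| <= C / t) ->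
  cvg (F t @[t --> +oo]) /\ forall t, 0 < t -> `|lim (F t @[t --> +oo]) - F t| <= C / t.
Proof.
move=> C0 FC; have cF : cvg (F t @[t --> +oo]).
  apply/cauchy_cvgP; apply: cauchy_exP => e e0.
  pose t := C / e + 1; have t0 : 0 < t by rewrite ltr_wpDl // divr_ge0 // ltW.
  exists (F t); suff : \forall t' \near +oo, ball (F t) e (F t') by [].
  near=> t'; rewrite /ball /= distrC.
  have tt' : t <= t' by near: t'; apply: nbhs_pinfty_ge; exact: num_real.
  apply: le_lt_trans (FC t t' t0 tt') _.
  by rewrite ltr_pdivrMr // /t mulrDr mulr1 mulrC divfK ?gt_eqF // ltrDl.
split=> // t t0.
have cn : `|F t' - F t| @[t' --> +oo] --> `|lim (F t' @[t' --> +oo]) - F t|.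
  by apply: cvg_norm; apply: cvgB => //; exact: cvg_cst.
rewrite -(cvg_lim _ cn) //; apply: limr_le; first by apply/cvg_ex; eexists; exact: cn.
by near=> t'; apply: FC => //; near: t'; apply: nbhs_pinfty_ge; exact: num_real.
Unshelve. all: by end_near. Qed.

(** The slope error [d] is given first, so that a box size may be chosen according to it; all that
    depends on the box is then hidden in [C]. *)
Definition log_asymptotic (f : R -> R) (k : R) := forall d, 0 < d ->
  exists C, forall eps, 0 < eps -> eps < 1 -> `|f eps - k * - ln eps| <= d * - ln eps + C.

Lemma log_asymptotic_cvg f k : log_asymptotic f k -> f eps / - ln eps @[eps --> 0^'+] --> k.
Proof.
move=> fk; apply/cvgrPdist_le => e e0.
have [C fC] := fk (e / 2) (divr_gt0 e0 (@ltr0n _ 2)).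
near=> eps; have e1 : 0 < eps by near: eps; exact: nbhs_right_gt.
have l1 : 2 * `|C| / e + 1 < - ln eps.
  rewrite ltrNr -[ltRHS]expRK ltr_ln ?posrE ?expR_gt0 //.
  by near: eps; apply: nbhs_right_lt; exact: expR_gt0.
have e2 : eps < 1 by near: eps; apply: nbhs_right_lt.
have h := fC eps e1 e2; move: (- ln eps) h l1 => l h l1.
have l0 : 0 < l.
  by apply: lt_trans l1; rewrite ltr_wpDl // divr_ge0 ?mulr_ge0 // ltW.
have -> : k - f eps / l = - (f eps - k * l) / l by field; rewrite gt_eqF.
rewrite normrM normrN normfV (gtr0_norm l0) ler_pdivrMr //; apply: le_trans h _.
have : 2 * `|C| < e * l by rewrite [e * l]mulrC -ltr_pdivrMr //; lra.
by have := ler_norm C; lra.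
Unshelve. all: by end_near. Qed.

End CauchyLimit.

Lemma Rintegral_reflect (R : realType) (g : R -> R) (t : R) : 0 <= t -> continuous g ->
  \int[lebesgue_measure]_(x in `[- t, t]) g x = \int[lebesgue_measure]_(x in `[- t, t]) g (- x).
Proof.
move=> t0 cg; rewrite /Rintegral; congr fine.
have := @integration_by_substitution_oppr R g (- t) t; rewrite opprK; apply; first lra.
exact: continuous_subspaceT.
Qed.

Section OscillatoryLimit.
Variables (R : realType) (al be ga a b : R).
Notation mu2 := (@lebesgue2 R).
Hypotheses (al_gt0 : 0 < al) (ga_gt0 : 0 < ga).
Hypothesis D2_gt0 : 0 < al * ga - be ^+ 2 / 4.
Local Notation D := (Num.sqrt (al * ga - be ^+ 2 / 4)).
Local Notation osc := (osc_fun al be ga a b).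
Local Notation sq t := (box (- t) t (- t) t).

(** The phase [th] treats real and imaginary part at once: 0 gives the cosine and [- (pi / 2)] the
    sine. *)
Definition osc_box eps th t := \int[mu2]_(x in sq t) osc eps th x.
Definition osc_limit eps th := lim (osc_box eps th t @[t --> +oo]).

Lemma kernel_swap eps x y : kernel al be ga eps x y = kernel ga be al eps y x.
Proof. by rewrite /kernel /quad; congr (_^-1); ring. Qed.

Let D2_sym : 0 < ga * al - be ^+ 2 / 4. Proof. by rewrite mulrC. Qed.

Lemma osc_box_cauchy : a != 0 \/ b != 0 -> exists C, 0 <= C /\
  forall eps th t t', 0 < eps -> 0 < t -> t <= t' ->
  `|osc_box eps th t' - osc_box eps th t| <= C / t.
Proof.
move=> ab.
(* The inner integral must run in a direction of oscillation; when [a = 0] the coordinates are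
   exchanged by [kernel_swap]. *)
have [a0|a0] := eqVneq a 0; last first.
  have [C [C0 h]] := osc_square_cauchy al_gt0 ga_gt0 D2_gt0 b a0.
  exists C; split=> // eps th t t' e0 t0 tt'.
  have bo := bm_osc al_gt0 ga_gt0 D2_gt0 a b th e0.
  have oE s : osc_box eps th s = osc_square al be ga a b eps th s.
    by rewrite /osc_box fubini_box_swap.
  by rewrite !oE; exact: h.
have b0 : b != 0 by case: ab; rewrite ?a0 ?eqxx.
have [C [C0 h]] := osc_square_cauchy ga_gt0 al_gt0 D2_sym a b0.
exists C; split=> // eps th t t' e0 t0 tt'.
have bo := bm_osc al_gt0 ga_gt0 D2_gt0 a b th e0.
have oE s : osc_box eps th s = osc_square ga be al b a eps th s.
  rewrite /osc_box (fubini_box _ _ _ _ bo); apply: eq_Rintegral => x _; apply: eq_Rintegral => y _.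
  by rewrite /osc_fun /= kernel_swap [b * y + _]addrC.
rewrite (oE t) (oE t').
exact (h eps th t t' e0 t0 tt').
Qed.

Lemma osc_box_cvg eps th : a != 0 \/ b != 0 -> 0 < eps -> cvg (osc_box eps th t @[t --> +oo]).
Proof.
move=> /osc_box_cauchy[C [C0 h]] e0.
by have [] := @cauchy_tail_limit R (osc_box eps th) C C0 (fun t t' => h eps th t t' e0).
Qed.

Lemma cos_lipschitz (x y : R) : `|cos x - cos y| <= `|x - y|.
Proof.
wlog xy : x y / y <= x.
  by move=> hw; have [/hw//|/ltW/hw] := leP y x; rewrite distrC [leRHS]distrC.
have [|c _ ->] := @MVT_segment R (@cos R) (fun x => - sin x) y x xy.
  by apply: continuous_subspaceT => z; exact: continuous_cos.
by rewrite normrM normrN ler_piMl // sin_max.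
Qed.

(** Outside the box of half side [rho] the contribution is bounded uniformly in [eps]; inside, the
    cosine differs from [cos th] by at most [m * rho]. The choice of [rho] turns the resulting slope
    error [m * rho * (pi / D)] into [d]. *)
Lemma osc_limit_asymptotic th : a != 0 \/ b != 0 ->
  log_asymptotic (fun eps => osc_limit eps th) (cos th * (pi / D)).
Proof.
move=> ab d d0; have [C1 [C10 cau]] := osc_box_cauchy ab.
have D0 : 0 < D by rewrite sqrtr_gt0.
have pi0 := @pi_gt0 R.
set m := `|a| + `|b|; have m0 : 0 < m.
  by rewrite /m; case: ab; rewrite -normr_gt0 => h; [rewrite ltr_pwDl|rewrite ltr_wpDl].
pose rho := d / (pi / D) / m; have r0 : 0 < rho by rewrite !divr_gt0.
have [C2 hk] := box_kernel_asymptotic al_gt0 ga_gt0 D2_gt0 r0.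
exists (C1 / rho + m * rho * C2 + C2) => eps e0 e1.
have := hk eps 0 0 e0 e1; rewrite !sub0r !add0r.
under eq_Rintegral do rewrite !subr0.
set I := Rintegral _ _ _ => hI.
have lim1 : `|osc_limit eps th - osc_box eps th rho| <= C1 / rho.
  by have [_ ->] := @cauchy_tail_limit R (osc_box eps th) C1 C10 (fun t t' => cau eps th t t' e0).
have bk : bounded_measurable (fun z : R * R => kernel al be ga eps z.1 z.2).
  have := bm_kernel al_gt0 ga_gt0 D2_gt0 0 0 e0; congr bounded_measurable.
  by apply/funext => z; rewrite !subr0.
have bo := bm_osc al_gt0 ga_gt0 D2_gt0 a b th e0.
have lim2 : `|osc_box eps th rho - cos th * I| <= m * rho * I.
  rewrite -RintegralZl ?bm_box_integrable //; last exact: measurable_box.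
  have bc := bmM (bm_cst (cos th)) bk.
  rewrite /osc_box -RintegralB ?bm_box_integrable //; last exact: measurable_box.
  apply: le_trans (le_normr_Rintegral _ _) _; [exact: measurable_box|exact: bm_box_integrable (bmB bo bc)|].
  rewrite -RintegralZl ?bm_box_integrable //; last exact: measurable_box.
  apply: le_Rintegral; first exact: measurable_box.
  - exact: bm_box_integrable (bm_norm (bmB bo bc)).
  - exact: bm_box_integrable (bmM (bm_cst _) bk).
  move=> [x y] [] /=; rewrite !in_itv /= => /andP[x1 x2] /andP[y1 y2].
  rewrite /osc_fun /= -mulrBl normrM (gtr0_norm (kernel_gt0 al_gt0 ga_gt0 D2_gt0 _ _ e0)).
  rewrite ler_pM2r ?kernel_gt0 //; apply: le_trans (cos_lipschitz _ _) _.
  rewrite addrK /m mulrDl; apply: le_trans (ler_normD _ _) _.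
  apply: lerD; rewrite normrM ler_wpM2l // ler_norml; [rewrite x1 x2|rewrite y1 y2] => //.
move: lim1 lim2 hI; set J := osc_box _ _ _; set l := - ln eps => lim1 lim2 hI.
have dE : d = m * rho * (pi / D).
  rewrite /rho; move: (m) (pi : R) (D) m0 pi0 D0 => m' p D' m1 p1 D1.
  by field; rewrite !gt_eqF.
have mI : m * rho * I <= d * l + m * rho * C2.
  rewrite dE -[_ * l]mulrA -mulrDr (ler_pM2l (mulr_gt0 m0 r0)).
  by move: hI; rewrite ler_norml => /andP[_]; rewrite lerBlDl.
have cI : `|cos th * I - cos th * (pi / D) * l| <= C2.
  rewrite -mulrA -mulrBr normrM; apply: le_trans hI.
  by rewrite ler_piMl // cos_max.
have -> : osc_limit eps th - cos th * (pi / D) * l =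
  (osc_limit eps th - J) + ((J - cos th * I) + (cos th * I - cos th * (pi / D) * l)) by ring.
apply: le_trans (ler_normD _ _) _; apply: le_trans (lerD lim1 (ler_normD _ _)) _.
by move: lim2 cI mI; lra.
Qed.

(* The variables are reflected one at a time, so that only the change of
   variables for continuous functions on an interval is needed. *)
Lemma osc_box_odd eps t : 0 < eps -> 0 <= t -> osc_box eps (- (pi / 2)) t = 0.
Proof.
move=> e0 t0.
set th := - (pi / 2).
pose f s (z : R * R) := osc eps th (s * z.1, z.2).
have bo := bm_osc al_gt0 ga_gt0 D2_gt0 a b th e0.
have bf : bounded_measurable (f (-1)).
  have [m [M fM]] := bo; split; last by exists M => z; exact: fM.
  apply: (measurableT_comp m).
  apply: measurable_fun_pair => //.
  exact: measurable_funM.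
have cx y : continuous (fun x => osc eps th (x, y)).
  rewrite (_ : (fun x => _) = fun x => cos (a * x + (b * y + th)) * kernel al be ga eps x y).
    exact: continuous_osc.
  by apply/funext => x; rewrite /osc_fun /= addrA.
have cy x : continuous (fun y => osc eps th (x, y)).
  rewrite (_ : (fun y => _) = fun y => cos (b * y + (a * x + th)) * kernel ga be al eps y x).
    exact (@continuous_osc R ga be al ga_gt0 al_gt0 D2_sym b eps (a * x + th) x e0).
  by apply/funext => y; rewrite /osc_fun /= kernel_swap addrA [b * y + _]addrC.
have e1 : osc_box eps th t = \int[mu2]_(z in sq t) f (-1) z.
  rewrite /osc_box (fubini_box_swap _ _ _ _ bo) (fubini_box_swap _ _ _ _ bf).
  apply: eq_Rintegral => y _; rewrite Rintegral_reflect //; apply: eq_Rintegral => x _.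
  by rewrite /f /= mulN1r.
have e2 : \int[mu2]_(z in sq t) f (-1) z = \int[mu2]_(z in sq t) - osc eps th z.
  rewrite (fubini_box _ _ _ _ bf) (fubini_box _ _ _ _ (bmN bo)).
  apply: eq_Rintegral => x _.
  rewrite /f /= mulN1r Rintegral_reflect //; apply: eq_Rintegral => y _.
  rewrite /osc_fun /= /th !cosBpihalf -mulNr -sinN; congr (sin _ * _); first by ring.
  by rewrite /kernel /quad; congr (_^-1); ring.
have := e1; rewrite e2.
have -> : \int[mu2]_(z in sq t) - osc eps th z = - osc_box eps th t.
  under eq_Rintegral do rewrite -mulN1r.
  by rewrite RintegralZl ?mulN1r ?bm_box_integrable //; exact: measurable_box.
by lra.
Qed.

Lemma osc_limit_odd eps : 0 < eps -> osc_limit eps (- (pi / 2)) = 0.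
Proof.
move=> e0; apply: lim_near_cst => //; near=> t; apply: osc_box_odd => //.
Unshelve. all: by end_near. Qed.

End OscillatoryLimit.

(** * Contribution of a root *)

Section RootTerm.
Variables (R : realType) (tau : polyomino) (a b : int) (z u : R[i]).
Local Notation P := (z * charpoly_z tau z u).
Local Notation Q := (u * charpoly_u tau z u).

Definition root_quad (x y : R) : R := normsq (P * x%:C + Q * y%:C).
Definition root_disc : R := `|complex.Im (P^* * Q)|.
Local Notation al := (normsq P).
Local Notation be := (2 * complex.Re (P^* * Q)).
Local Notation ga := (normsq Q).

Lemma root_quadE x y : root_quad x y = quad al be ga x y.
Proof.
rewrite /root_quad /quad /normsq.
by case: P => p1 p2; case: Q => q1 q2 /=; ring.
Qed.

(** Lagrange's identity: |P|^2 |Q|^2 is the sum of the squares of the real and the imaginary part of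
    P^* Q. *)
Lemma root_disc_sqr : al * ga - be ^+ 2 / 4 = root_disc ^+ 2.
Proof.
rewrite /root_disc real_normK ?num_real // /normsq.
by case: P => p1 p2; case: Q => q1 q2 /=; field.
Qed.

Hypothesis simple : simple_root tau z u.

(** The imaginary part of P / Q is that of P^* Q up to sign and division by |Q|^2. For Q = 0 the
    ratio is 0 by convention, which is real and therefore excluded as well. *)
Lemma root_disc_gt0 : 0 < root_disc.
Proof.
rewrite normr_gt0; apply/eqP => im0; move: simple; rewrite /simple_root.
move: im0; case: P => p1 p2; case: Q => q1 q2 /= im0; case/negP.
rewrite complex_real; apply/eqP => /=.
transitivity (- (p1 * q2 + - p2 * q1) / (q1 ^+ 2 + q2 ^+ 2)); first by ring.
by rewrite im0 oppr0 mul0r.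
Qed.

Lemma root_normsq_gt0 : 0 < al /\ 0 < ga.
Proof.
have := root_disc_sqr; have := root_disc_gt0; have := normsq_ge0 P; have := normsq_ge0 Q.
move: al ga be root_disc => s t r d t0 s0 d0 e.
have : 0 < d ^+ 2 by rewrite exprn_gt0.
by rewrite -e !lt0r s0 t0 !andbT; split; apply/eqP => h; move: e; rewrite h; have := sqr_ge0 r; nra.
Qed.

Lemma root_denominatorE eps x y :
  eps%:C + `|P * x%:C + Q * y%:C| ^+ 2 = (eps + quad al be ga x y)%:C.
Proof. by rewrite -add_Re2_Im2 -root_quadE [RHS]rmorphD. Qed.

Lemma Re_mulC (w : R[i]) (r : R) : complex.Re (w * r%:C) = complex.Re w * r.
Proof. by case: w => x y /=; rewrite mulr0 subr0. Qed.

Lemma Im_mulC (w : R[i]) (r : R) : complex.Im (w * r%:C) = complex.Im w * r.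
Proof. by case: w => x y /=; rewrite mulr0 add0r. Qed.

Lemma root_integrandE eps (x : R * R) : root_integrand tau a b eps z u x =
  expi (a%:~R * x.1 + b%:~R * x.2) * (kernel al be ga eps x.1 x.2)%:C.
Proof. by rewrite /root_integrand root_denominatorE -fmorphV. Qed.

Lemma integral2_root_integrand eps :
  (fun t => integral2 (`[- t, t] `*` `[- t, t]) (root_integrand tau a b eps z u)) =
  fun t => osc_box al be ga a%:~R b%:~R eps 0 t +i* osc_box al be ga a%:~R b%:~R eps (- (pi / 2)) t.
Proof.
apply/funext => t; rewrite /integral2 /osc_box /box; congr (_ +i* _); apply: eq_Rintegral => x _.
  by rewrite root_integrandE Re_mulC /osc_fun addr0.
by rewrite root_integrandE Im_mulC /osc_fun cosBpihalf.
Qed.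

Let D2_gt0 : 0 < al * ga - be ^+ 2 / 4.
Proof. by rewrite root_disc_sqr exprn_gt0 // root_disc_gt0. Qed.
Let al_gt0 : 0 < al. Proof. by have [] := root_normsq_gt0. Qed.
Let ga_gt0 : 0 < ga. Proof. by have [] := root_normsq_gt0. Qed.

Hypothesis ab_neq0 : (a, b) <> (0, 0).

Let abR : a%:~R != 0 :> R \/ b%:~R != 0 :> R.
Proof.
rewrite !intr_eq0; have [a0|] := eqVneq a 0; last by left.
by right; apply/eqP => b0; apply: ab_neq0; rewrite a0 b0.
Qed.

Lemma root_integrand_converges eps : 0 < eps ->
  improper_converges (root_integrand tau a b eps z u).
Proof.
move=> e0; pose J (t : R) := osc_box al be ga a%:~R b%:~R eps 0 t
  +i* osc_box al be ga a%:~R b%:~R eps (- (pi / 2)) t.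
suff h I : I = J -> cvg (complex.Re (I t) @[t --> +oo]) /\ cvg (complex.Im (I t) @[t --> +oo]).
  exact: h (integral2_root_integrand eps).
by move=> ->; split; apply: osc_box_cvg.
Qed.

(** The root term without its coefficient; the normalisation by [root_disc] makes it asymptotic to
    [(4 * pi)^-1] ln (1 / eps) at every root. *)
Definition root_weight eps : R :=
  root_disc / (2 * pi) ^+ 2 * osc_limit al be ga a%:~R b%:~R eps 0.

Lemma root_termE eps : 0 < eps ->
  root_term tau a b eps z u = root_coefficient tau a b z u * (root_weight eps)%:C.
Proof.
move=> e0; have d0 := root_disc_gt0; have pi0 := @pi_gt0 R.
have -> : root_term tau a b eps z u =
   z ^ a * u ^ b / ((2 * pi) ^+ 2)%:C * (osc_limit al be ga a%:~R b%:~R eps 0)%:C.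
  congr (_ * _); pose J (t : R) := osc_box al be ga a%:~R b%:~R eps 0 t
    +i* osc_box al be ga a%:~R b%:~R eps (- (pi / 2)) t.
  suff h I : I = J -> lim (complex.Re (I t) @[t --> +oo]) +i* lim (complex.Im (I t) @[t --> +oo]) =
      (osc_limit al be ga a%:~R b%:~R eps 0)%:C.
    exact: h (integral2_root_integrand eps).
  by move=> ->; congr (_ +i* _); apply: osc_limit_odd.
have -> : (root_weight eps)%:C =
    root_disc%:C * (((2 * pi) ^+ 2)%:C^-1 * (osc_limit al be ga a%:~R b%:~R eps 0)%:C).
  by rewrite /root_weight -mulrA rmorphM rmorphM fmorphV.
rewrite /root_coefficient -/root_disc.
move: (z ^ a * u ^ b) (_%:C) => w v.
have dC : root_disc%:C != 0 by rewrite fmorph_eq0 gt_eqF.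
by rewrite -!mulrA; congr (w * _); rewrite mulKf //.
Qed.

Lemma root_weight_asymptotic :
  root_weight eps / - ln eps @[eps --> 0^'+] --> (4 * pi)^-1.
Proof.
have pi0 := @pi_gt0 R; have d0 := root_disc_gt0.
have := log_asymptotic_cvg (osc_limit_asymptotic al_gt0 ga_gt0 D2_gt0 0 abR).
rewrite cos0 mul1r root_disc_sqr sqrtr_sqr ger0_norm ?(ltW d0) // => h.
have -> : (4 * pi)^-1 = root_disc / (2 * pi) ^+ 2 * (pi / root_disc).
  by move: root_disc d0 (pi : R) pi0 => d d0 p p0; field; rewrite !gt_eqF.
rewrite (_ : (fun eps => _) = fun eps => root_disc / (2 * pi) ^+ 2 *
  (osc_limit al be ga a%:~R b%:~R eps 0 / - ln eps)); last first.
  by apply/funext => eps; rewrite [RHS]mulrA.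
exact: cvgMl_tmp.
Qed.

End RootTerm.

(** * Riemann sums of periodic functions *)

Section Riemann.
Variable R : realType.
Notation mu := (@lebesgue_measure R).

Lemma lipschitz_continuous (f : R -> R) (M : R) : (forall x y, `|f x - f y| <= M * `|x - y|) -> continuous f.
Proof.
move=> fM x; apply/cvgrPdist_le => e e0; near=> y.
have yx : `|x - y| <= e / (`|M| + 1).
  by near: y; apply: cvgr_dist_le; [exact: cvg_id|rewrite divr_gt0 // ltr_wpDl].
apply: le_trans (fM x y) _.
apply: (@le_trans _ _ ((`|M| + 1) * (e / (`|M| + 1)))); last first.
  by rewrite mulrC divfK // gt_eqF // ltr_wpDl.
apply: le_trans (ler_wpM2r _ (_ : M <= `|M| + 1)) _ => //; first by have := ler_norm M; lra.
by rewrite ler_pM2l // ltr_wpDl.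
Unshelve. all: by end_near. Qed.

Lemma exists_antiderivative (g : R -> R) (p : R) : continuous g ->
  exists H : R -> R, forall x : R, p <= x -> is_derive x 1 H (g x).
Proof.
move=> cg; exists (fun x => \int[mu]_(t in `[p - 1, x]) g t) => x px.
have [|||dx <-] := @continuous_FTC1_closed R g (p - 1) x (x + 1) _ (continuous_integrable _ _ cg).
- by rewrite ltrDl.
- by rewrite (lt_le_trans _ px) // gtrBl.
- exact: cg.
by rewrite derive1E; exact: derivableP.
Qed.

Variables (f : R -> R) (M d : R).
Hypothesis f_lip : forall x y, `|f x - f y| <= M * `|x - y|.
Hypothesis f_periodic : forall x, f (x + 2 * pi) = f x.
Hypothesis d_ge0 : 0 <= d.

(** On each cell the mean value theorem for a primitive and the Lipschitz bound give an error
    [M * dl ^ 2], and the increments telescope. Periodicity moves the integral from the shifted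
    interval to [0, 2 pi]. *)
Lemma riemann_periodic n : (0 < n)%N ->
  `|(\sum_(k < n) f (grid R n k)) / n%:R - (2 * pi)^-1 * \int[mu]_(x in `[- d, 2 * pi - d]) f x|
  <= M * (2 * pi / n%:R).
Proof.
move=> n0; have pi0 := @pi_gt0 R; have nR : 0 < n%:R :> R by rewrite ltr0n.
have cf := lipschitz_continuous f_lip.
have [H dH] := exists_antiderivative (- d) cf.
have IE : \int[mu]_(x in `[- d, 2 * pi - d]) f x = H (2 * pi) - H 0.
  have d0 : - d <= 0 by rewrite oppr_le0.
  have e1 := @Rintegral_antiderivative R (- d) 0 f H d0 cf (fun x h => dH x (andP h).1).
  have e2 : \int[mu]_(x in `[- d, 0]) f x = H (0 + 2 * pi) - H (- d + 2 * pi).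
    apply: (@Rintegral_antiderivative R (- d) 0 f (fun x => H (x + 2 * pi)) d0 cf) => x /andP[dx _].
    have h1 : is_derive (x + 2 * pi) 1 H (f (x + 2 * pi)) by apply: dH; lra.
    have h2 : is_derive x 1 (fun x => x + 2 * pi) 1.
      by have := is_derive_affine 1 (2 * pi) x; under eq_fun do rewrite mul1r.
    have := @is_derive_lam_comp R H (fun x => x + 2 * pi) x _ _ h1 h2.
    by rewrite f_periodic mulr1.
  rewrite (@Rintegral_antiderivative R _ _ f H _ cf (fun x h => dH x (andP h).1)); last lra.
  by move: e2; rewrite e1 add0r [- d + _]addrC; lra.
set dl := 2 * pi / n%:R; have dl0 : 0 < dl by rewrite divr_gt0 // mulr_gt0.
have gS k : grid R n k.+1 = grid R n k + dl by rewrite /grid /dl -[k.+1]addn1 natrD; ring.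
have g0 k : 0 <= grid R n k by rewrite divr_ge0 // mulr_ge0 // mulr_ge0 // ltW.
have stp k : `|H (grid R n k.+1) - H (grid R n k) - dl * f (grid R n k)| <= M * dl ^+ 2.
  rewrite gS; have := g0 k; move: (grid R n k) => x x0.
  have xd : x <= x + dl by rewrite lerDl ltW.
  have dHx c : x <= c -> is_derive c 1 H (f c) by move=> xc; apply: dH; apply: le_trans xc; apply: le_trans x0; rewrite oppr_le0.
  have [||c cx ->] := @MVT_segment R H f x (x + dl) xd.
  - by move=> y; rewrite in_itv /= => /andP[/ltW xy _]; apply: dHx.
  - by apply: derivable_within_continuous => y; rewrite in_itv /= => /andP[xy _]; have [] := dHx y xy.
  move: cx; rewrite in_itv /= => /andP[xc cx].
  rewrite [x + dl]addrC addrK [_ * dl]mulrC -mulrBr normrM gtr0_norm //.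
  rewrite expr2 mulrCA ler_pM2l //; apply: le_trans (f_lip _ _) _.
  have M0 : 0 <= M by have := f_lip 1 0; rewrite subr0 normr1 mulr1; apply: le_trans.
  by rewrite ler_wpM2l // ger0_norm ?subr_ge0 // lerBlDl.
have tel : H (2 * pi) - H 0 - dl * (\sum_(k < n) f (grid R n k)) =
    \sum_(k < n) (H (grid R n k.+1) - H (grid R n k) - dl * f (grid R n k)).
  rewrite sumrB -mulr_sumr; congr (_ - _).
  rewrite -(big_mkord xpredT (fun k => H (grid R n k.+1) - H (grid R n k))) telescope_sumr //.
  by rewrite /grid mulfK ?gt_eqF // mulr0 mul0r.
have bnd : `|H (2 * pi) - H 0 - dl * (\sum_(k < n) f (grid R n k))| <= n%:R * (M * dl ^+ 2).
  rewrite tel; apply: le_trans (ler_norm_sum _ _ _) _.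
  apply: (@le_trans _ _ (\sum_(k < n) M * dl ^+ 2)); first by apply: ler_sum => k _; exact: stp.
  by rewrite sumr_const card_ord mulr_natl.
rewrite IE; move: bnd; set S := \sum_(k < n) _; set I := H _ - H _ => bnd.
have -> : S / n%:R - (2 * pi)^-1 * I = - (I - dl * S) / (2 * pi).
  by rewrite /dl; move: n%:R nR (pi : R) pi0 => m m0 p p0; field; rewrite !gt_eqF.
have p2 : 0 < 2 * pi :> R by rewrite mulr_gt0.
rewrite normrM normrN normfV (gtr0_norm p2) ler_pdivrMr //; apply: le_trans bnd _.
rewrite le_eqVlt; apply/orP; left; apply/eqP.
by rewrite /dl; move: n%:R nR (pi : R) pi0 => m m0 p p0; field; rewrite !gt_eqF.
Qed.

End Riemann.

Section Regular.
Variable R : realType.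
Notation mu := (@lebesgue_measure R).
Notation mu2 := (@lebesgue2 R).
Implicit Types (f g : R -> R -> R) (c d : R).

Definition regular f := measurable_fun [set: R * R] (fun z : R * R => f z.1 z.2) /\
  exists M, [/\ 0 <= M, forall x y, `|f x y| <= M &
    forall x x' y y', `|f x y - f x' y'| <= M * (`|x - x'| + `|y - y'|)].

Lemma regular_bm f : regular f -> bounded_measurable (fun z : R * R => f z.1 z.2).
Proof. by move=> [mf [M [_ fM _]]]; split=> //; exists M => z; exact: fM. Qed.

Lemma regular_cst c : regular (fun _ _ => c).
Proof.
split; first exact: measurable_cst.
by exists `|c|; split=> // *; rewrite subrr normr0 mulr_ge0 // addr_ge0.
Qed.

Lemma regularD f g : regular f -> regular g -> regular (fun x y => f x y + g x y).
Proof.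
move=> [mf [M [M0 fM fl]]] [mg [N [N0 gN gl]]]; split; first exact: measurable_funD.
exists (M + N); split; first exact: addr_ge0.
  by move=> x y; apply: le_trans (ler_normD _ _) _; exact: lerD.
move=> x x' y y'; rewrite opprD addrACA mulrDl; apply: le_trans (ler_normD _ _) _.
exact: lerD.
Qed.

Lemma regularM f g : regular f -> regular g -> regular (fun x y => f x y * g x y).
Proof.
move=> [mf [M [M0 fM fl]]] [mg [N [N0 gN gl]]]; split; first exact: measurable_funM.
have MN : 0 <= M * N by exact: mulr_ge0.
exists (2 * (M * N)); split; first exact: mulr_ge0.
  move=> x y; apply: (@le_trans _ _ (M * N)); last lra.
  by rewrite normrM; exact: ler_pM.
move=> x x' y y'; set s := `|x - x'| + _.
have -> : f x y * g x y - f x' y' * g x' y' =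
  f x y * (g x y - g x' y') + (f x y - f x' y') * g x' y' by ring.
have -> : 2 * (M * N) * s = M * (N * s) + M * s * N by ring.
by apply: le_trans (ler_normD _ _) _; rewrite !normrM; apply: lerD; apply: ler_pM.
Qed.

Lemma regular_sum (I : Type) (r : seq I) (f : I -> R -> R -> R) :
  (forall i, regular (f i)) -> regular (fun x y => \sum_(i <- r) f i x y).
Proof.
move=> rf; elim: r => [|i r IH].
  rewrite (_ : (fun _ _ => _) = fun _ _ => 0); first exact: regular_cst.
  by apply/funext => x; apply/funext => y; rewrite big_nil.
rewrite (_ : (fun _ _ => _) = fun x y => f i x y + \sum_(j <- r) f j x y); first exact: regularD.
by apply/funext => x; apply/funext => y; rewrite big_cons.
Qed.

Lemma regularV f c : 0 < c -> regular f -> (forall x y, c <= f x y) ->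
  regular (fun x y => (f x y)^-1).
Proof.
move=> c0 [mf [M [M0 fM fl]]] cf; have f0 x y : 0 < f x y by exact: lt_le_trans (cf x y).
have fc x y : (f x y)^-1 <= c^-1 by rewrite lef_pV2 ?posrE.
split.
  rewrite (_ : (fun _ => _) = (fun t : R => (c + `|t|)^-1) \o (fun z : R * R => f z.1 z.2 - c)); last first.
    by apply/funext => z /=; rewrite ger0_norm ?subr_ge0 // addrC subrK.
  apply: measurableT_comp; last by apply: measurable_funB => //; exact: measurable_cst.
  apply: continuous_measurable_fun => t; apply: cvgV; first by rewrite gt_eqF // ltr_pwDl.
  by apply: cvgD; [exact: cvg_cst|exact: norm_continuous].
have V0 : 0 <= c^-1 by rewrite invr_ge0 ltW.
have W0 : 0 <= M * (c^-1 * c^-1) by rewrite !mulr_ge0.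
exists (c^-1 + M * (c^-1 * c^-1)); split; first exact: addr_ge0.
  by move=> x y; rewrite gtr0_norm ?invr_gt0 // (le_trans (fc x y)) // lerDl.
move=> x x' y y'; set s := `|x - x'| + _; have s0 : 0 <= s by exact: addr_ge0.
have -> : (f x y)^-1 - (f x' y')^-1 = - ((f x y - f x' y') * ((f x y)^-1 * (f x' y')^-1)).
  by field; rewrite !gt_eqF.
rewrite normrN normrM; apply: (@le_trans _ _ (M * s * (c^-1 * c^-1))).
  apply: ler_pM => //; rewrite gtr0_norm ?mulr_gt0 ?invr_gt0 //.
  by apply: ler_pM => //; rewrite invr_ge0 ltW.
by rewrite mulrDl mulrAC lerDr mulr_ge0.
Qed.

Lemma regular_cos a b (th : R) : regular (fun x y => cos (a * x + b * y + th)).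
Proof.
split.
  rewrite (_ : (fun z : R * R => _) = @cos R \o (fun z : R * R => a * z.1 + b * z.2 + th)) //.
  apply: measurableT_comp; first by apply: continuous_measurable_fun; exact: continuous_cos.
  apply: measurable_funD; last exact: measurable_cst.
  by apply: measurable_funD; apply: measurable_funM => //; exact: measurable_cst.
exists (1 + `|a| + `|b|); split; first by rewrite !addr_ge0.
  by move=> x y; rewrite (le_trans (cos_max _)) // -addrA lerDl addr_ge0.
move=> x x' y y'; apply: le_trans (cos_lipschitz _ _) _.
have -> : a * x + b * y + th - (a * x' + b * y' + th) = a * (x - x') + b * (y - y') by ring.
apply: le_trans (ler_normD _ _) _; rewrite !normrM.
have := normr_ge0 (x - x'); have := normr_ge0 (y - y'); move: `|x - x'| `|y - y'| => s t s0 t0.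
have := normr_ge0 a; have := normr_ge0 b; nra.
Qed.

Variables (F : R -> R -> R) (d : R).
Hypothesis F_regular : regular F.
Hypothesis F_periodic_l : forall x y, F (x + 2 * pi) y = F x y.
Hypothesis F_periodic_r : forall x y, F x (y + 2 * pi) = F x y.
Hypothesis d_ge0 : 0 <= d.

(** The one-dimensional estimate is applied to the rows and then to the row integrals [G], which
    inherit the Lipschitz constant and the period. *)
Lemma riemann_periodic2 :
  (\sum_(k < n) \sum_(l < n) F (grid R n k) (grid R n l)) / (n * n)%:R @[n --> \oo] -->
  (2 * pi) ^- 2 * \int[mu2]_(z in box (- d) (2 * pi - d) (- d) (2 * pi - d)) F z.1 z.2.
Proof.
have pi0 := @pi_gt0 R; have p2 : 0 < 2 * pi :> R by rewrite mulr_gt0.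
have bF := regular_bm F_regular.
have [_ [M [M0 FM Fl]]] := F_regular.
have FlX y x x' : `|F x y - F x' y| <= M * `|x - x'|.
  by have := Fl x x' y y; rewrite subrr normr0 addr0.
have FlY x y y' : `|F x y - F x y'| <= M * `|y - y'|.
  by have := Fl x x y y'; rewrite subrr normr0 add0r.
pose G x := (2 * pi)^-1 * \int[mu]_(y in `[- d, 2 * pi - d]) F x y.
have len : 2 * pi - d - - d = 2 * pi by ring.
have Gl x x' : `|G x - G x'| <= M * `|x - x'|.
  have Fi x0 : mu.-integrable `[- d, 2 * pi - d] (EFin \o F x0).
    by apply: continuous_integrable; exact: lipschitz_continuous (FlY x0).
  rewrite /G -mulrBr -RintegralB // normrM gtr0_norm ?invr_gt0 // mulrC ler_pdivrMr //.
  rewrite -[in leRHS]len; apply: Rintegral_itv_bound => //; first lra.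
  exact: (@integrableB _ _ _ mu `[- d, 2 * pi - d] (measurable_itv _) (EFin \o F x) (EFin \o F x')).
have Gp x : G (x + 2 * pi) = G x.
  by congr (_ * _); apply: eq_Rintegral => y _; rewrite F_periodic_l.
have -> : (2 * pi) ^- 2 * \int[mu2]_(z in box (- d) (2 * pi - d) (- d) (2 * pi - d)) F z.1 z.2 =
    (2 * pi)^-1 * \int[mu]_(x in `[- d, 2 * pi - d]) G x.
  rewrite fubini_box // [X in _ = _ * X]RintegralZl; last first.
    exact: (section_integral_integrable _ _ _ _ bF).
    exact: measurable_itv.
  by rewrite mulrA -expr2 exprVn.
apply/cvgrPdist_le => e e0; near=> n.
have n0 : (0 < n)%N by near: n; exact: nbhs_infty_gt.
have nR : 0 < n%:R :> R by rewrite ltr0n.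
have ne : 2 * (M * (2 * pi / n%:R)) <= e.
  have -> : 2 * (M * (2 * pi / n%:R)) = (4 * M * pi) / n%:R by ring.
  rewrite ler_pdivrMr // [e * _]mulrC -ler_pdivrMr //; near: n; exact: nbhs_infty_ger.
have out := @riemann_periodic R G M d Gl Gp d_ge0 n n0.
have inn k := @riemann_periodic R _ M d (FlY (grid R n k)) (F_periodic_r _) d_ge0 n n0.
rewrite distrC; apply: le_trans ne.
have -> : (\sum_(k < n) \sum_(l < n) F (grid R n k) (grid R n l)) / (n * n)%:R =
   (\sum_(k < n) ((\sum_(l < n) F (grid R n k) (grid R n l)) / n%:R)) / n%:R.
  by rewrite -mulr_suml natrM invfM mulrA.
set J := _^-1 * _ in out *; set T := \sum_(k < n) _.
have TG : `|T / n%:R - (\sum_(k < n) G (grid R n k)) / n%:R| <= M * (2 * pi / n%:R).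
  rewrite -mulrBl -sumrB normrM [in X in _ * X]gtr0_norm ?invr_gt0 // ler_pdivrMr //.
  apply: le_trans (ler_norm_sum _ _ _) _.
  apply: (@le_trans _ _ (\sum_(k < n) M * (2 * pi / n%:R))).
    by apply: ler_sum => k _; exact: inn.
  by rewrite sumr_const card_ord mulr_natr.
have -> : T / n%:R - J = (T / n%:R - (\sum_(k < n) G (grid R n k)) / n%:R) +
   ((\sum_(k < n) G (grid R n k)) / n%:R - J) by ring.
apply: le_trans (ler_normD _ _) _.
by move: out TG; move: (M * _) => m; lra.
Unshelve. all: by end_near. Qed.

End Regular.

Section GreenLimit.
Variables (R : realType) (tau : polyomino) (a b : int).
Implicit Types (eps x y d : R).

Lemma symbolE x y : symbol tau x y =
  (\sum_(q <- tau) cos (q.1%:~R * x + q.2%:~R * y)) ^+ 2 +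
  (\sum_(q <- tau) sin (q.1%:~R * x + q.2%:~R * y)) ^+ 2.
Proof.
have cE : charpoly tau (expi x) (expi y) = \sum_(q <- tau) expi (q.1%:~R * x + q.2%:~R * y).
  by apply: eq_bigr => q _; rewrite expiD !expi_exprz.
by rewrite /symbol cE /normsq !raddf_sum.
Qed.

Lemma regular_symbol : regular (symbol tau : R -> R -> R).
Proof.
rewrite (_ : symbol tau = fun x y =>
  (\sum_(q <- tau) cos (q.1%:~R * x + q.2%:~R * y + 0)) *
  (\sum_(q <- tau) cos (q.1%:~R * x + q.2%:~R * y + 0)) +
  (\sum_(q <- tau) cos (q.1%:~R * x + q.2%:~R * y + - (pi / 2))) *
  (\sum_(q <- tau) cos (q.1%:~R * x + q.2%:~R * y + - (pi / 2)))).
  by apply: regularD; apply: regularM; apply: regular_sum => q; exact: regular_cos.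
apply/funext => x; apply/funext => y; rewrite symbolE !expr2.
by under eq_bigr do rewrite -[_ + _ * y]addr0; under [in X in _ + X]eq_bigr do rewrite -cosBpihalf.
Qed.

Lemma regular_green eps : 0 < eps -> regular (green_integrand tau a b eps).
Proof.
move=> e0; rewrite (_ : green_integrand _ _ _ _ =
  fun x y => cos (a%:~R * x + b%:~R * y + 0) * (eps + symbol tau x y)^-1); last first.
  by apply/funext => x; apply/funext => y; rewrite addr0.
apply: regularM; first exact: regular_cos.
apply: (@regularV _ _ eps) => // [|x y]; last by rewrite lerDl normsq_ge0.
by apply: regularD; [exact: regular_cst|exact: regular_symbol].
Qed.

Lemma green_integrand_expi eps x x' y y' : expi x = expi x' -> expi y = expi y' ->
  green_integrand tau a b eps x y = green_integrand tau a b eps x' y'.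
Proof.
move=> ex ey; rewrite /green_integrand /symbol ex ey; congr (_ / _).
by rewrite -!Re_expi !expiD !expi_exprz ex ey.
Qed.

(** The fundamental square starts at [- d] so that roots with angle 0 become interior points. *)
Definition green_limit d eps : R := (2 * pi) ^- 2 *
  \int[@lebesgue2 R]_(z in box (- d) (2 * pi - d) (- d) (2 * pi - d)) green_integrand tau a b eps z.1 z.2.

(** Besides the Riemann sum there is only the omitted zero mode, whose share is O(1 / n^2) for fixed
    [eps]. *)
Lemma green_sum_cvg d eps : 0 <= d -> 0 < eps ->
  green_sum tau a b eps n @[n --> \oo] --> green_limit d eps.
Proof.
move=> d0 e0; have shift (x : R) : expi (x + 2 * pi) = expi x by rewrite expiD expi_2pi mulr1.
have := riemann_periodic2 (regular_green e0) _ _ d0 => h.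
rewrite -[green_limit d eps]subr0.
rewrite (_ : green_sum tau a b eps = fun n =>
  (\sum_(k < n) \sum_(l < n) green_integrand tau a b eps (grid R n k) (grid R n l)) / (n * n)%:R -
  green_integrand tau a b eps 0 0 / (n * n)%:R); last first.
  by apply/funext => n; rewrite /green_sum mulrBl.
apply: cvgB; first by apply: h => x y; apply: green_integrand_expi.
set g := green_integrand _ _ _ _ _ _.
rewrite -(mulr0 g); apply: cvgMl_tmp; apply/cvgrPdist_le => e e1; near=> n.
have n0 : (0 < n)%N by near: n; exact: nbhs_infty_gt.
have nR : 0 < n%:R :> R by rewrite ltr0n.
rewrite sub0r normrN gtr0_norm ?invr_gt0 ?ltr0n ?muln_gt0 ?n0 //.
apply: (@le_trans _ _ (n%:R^-1)).
  by rewrite lef_pV2 ?posrE ?ltr0n ?muln_gt0 ?n0 // ler_nat leq_pmulr.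
rewrite -[n%:R^-1]mul1r ler_pdivrMr // mulrC -ler_pdivrMr // mul1r.
near: n; exact: nbhs_infty_ger.
Unshelve. all: by end_near. Qed.

End GreenLimit.

(** * The Green integral near and away from the roots *)

Section LocalExpansion.
Variables (R : realType) (tau : polyomino).
Implicit Types (s t x y r : R) (v w : R[i]).
Local Notation nc := Normc.normc.

Lemma normc_sqr w : nc w ^+ 2 = normsq w.
Proof. by case: w => x y; rewrite /normsq /= sqr_sqrtr // addr_ge0 ?sqr_ge0. Qed.

Lemma normc_ge0 w : 0 <= nc w. Proof. by case: w => x y; exact: sqrtr_ge0. Qed.

Lemma normc_le x y : nc (x +i* y) <= `|x| + `|y|.
Proof.
rewrite /= -(@ler_pXn2r _ 2) ?nnegrE ?sqrtr_ge0 ?addr_ge0 // sqr_sqrtr ?addr_ge0 ?sqr_ge0 //.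
rewrite -[x ^+ 2]real_normK ?num_real // -[y ^+ 2]real_normK ?num_real //.
by have := normr_ge0 x; have := normr_ge0 y; nra.
Qed.

Lemma normc_real x : nc x%:C = `|x|.
Proof. by rewrite /= expr0n /= addr0 sqrtr_sqr. Qed.

Lemma normc_expi t : nc (expi t) = 1.
Proof. by rewrite /= cos2Dsin2 sqrtr1. Qed.

Lemma normc_sum (I : Type) (l : seq I) (f : I -> R[i]) :
  nc (\sum_(i <- l) f i) <= \sum_(i <- l) nc (f i).
Proof.
elim: l => [|i l IH]; first by rewrite !big_nil Normc.normc0.
by rewrite !big_cons; apply: le_trans (le_normcD _ _) _; rewrite lerD2l.
Qed.

Lemma sin_lipschitz x y : `|sin x - sin y| <= `|x - y|.
Proof.
rewrite -!cosBpihalf; apply: le_trans (cos_lipschitz _ _) _.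
by rewrite opprB addrA subrK.
Qed.

Lemma cos_taylor t : `|cos t - 1| <= t ^+ 2.
Proof.
wlog t0 : t / 0 <= t.
  by move=> h; have [/h//|/ltW t0] := leP 0 t; rewrite -cosN -sqrrN h // oppr_ge0.
have [|c] := @MVT_segment R (@cos R) (fun x => - sin x) 0 t t0.
  by apply: continuous_subspaceT => z; exact: continuous_cos.
rewrite in_itv /= cos0 subr0 => /andP[c0 ct] ->.
rewrite normrM normrN (ger0_norm t0) expr2 ler_wpM2r //.
have := sin_lipschitz c 0; rewrite sin0 !subr0 => /le_trans; apply.
by rewrite ger0_norm.
Qed.

Lemma sin_taylor t : `|sin t - t| <= t ^+ 2.
Proof.
wlog t0 : t / 0 <= t.
  move=> h; have [/h//|/ltW t0] := leP 0 t.
  by have := h (- t); rewrite oppr_ge0 sinN sqrrN -opprD normrN; apply.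
have [|c] := @MVT_segment R (fun x => sin x - x) (fun x => cos x - 1) 0 t t0.
  by move=> x; apply: continuous_subspaceT => z; apply: cvgB; [exact: continuous_sin|exact: cvg_id].
rewrite in_itv /= sin0 !subr0 => /andP[c0 ct] ->.
rewrite normrM (ger0_norm t0) expr2 ler_wpM2r //.
have := cos_lipschitz c 0; rewrite cos0 subr0 => /le_trans; apply.
by rewrite ger0_norm.
Qed.

Lemma expi_taylor t : nc (expi t - (1 +i* t)) <= 2 * t ^+ 2.
Proof.
apply: le_trans (normc_le _ _) _.
by have := cos_taylor t; have := sin_taylor t; lra.
Qed.

Variables th ph : R.
Local Notation z := (expi th).
Local Notation u := (expi ph).
Hypothesis root : charpoly tau z u = 0.

(** Moving the point multiplies each monomial by the phase [expi (v q)]. The terms of order zero add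
    up to the value at the root, which vanishes; those of order one form the linear map;
    [expi_taylor] bounds the rest. *)
Lemma charpoly_expansion : exists B, 0 <= B /\ forall s t,
  nc (charpoly tau (expi (th + s)) (expi (ph + t)) -
      'i * (z * charpoly_z tau z u * s%:C + u * charpoly_u tau z u * t%:C)) <=
  B * (`|s| + `|t|) ^+ 2.
Proof.
pose w (q : int * int) : R[i] := z ^ q.1 * u ^ q.2.
pose m (q : int * int) : R := `|q.1%:~R| + `|q.2%:~R|.
exists (\sum_(q <- tau) 2 * m q ^+ 2); split.
  by apply: sumr_ge0 => q _; rewrite mulr_ge0 ?sqr_ge0.
move=> s t; pose v (q : int * int) : R := q.1%:~R * s + q.2%:~R * t.
have zE : z * charpoly_z tau z u = \sum_(q <- tau) q.1%:~R * w q.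
  rewrite mulr_sumr; apply: eq_bigr => q _.
  by rewrite /w expfzDr ?expi_neq0 // exprN1; have := expi_neq0 th; move: (expi th) => e e0; field.
have uE : u * charpoly_u tau z u = \sum_(q <- tau) q.2%:~R * w q.
  rewrite mulr_sumr; apply: eq_bigr => q _.
  by rewrite /w expfzDr ?expi_neq0 // exprN1; have := expi_neq0 ph; move: (expi ph) => e e0; field.
have -> : charpoly tau (expi (th + s)) (expi (ph + t)) -
      'i * (z * charpoly_z tau z u * s%:C + u * charpoly_u tau z u * t%:C) =
    \sum_(q <- tau) w q * (expi (v q) - (1 +i* v q)).
  have sub_root (x : R[i]) : x = x - charpoly tau z u by rewrite root subr0.
  have pE : charpoly tau (expi (th + s)) (expi (ph + t)) = \sum_(q <- tau) w q * expi (v q).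
    apply: eq_bigr => q _; rewrite /w.
    rewrite -(expi_exprz (th + s)) -(expi_exprz (ph + t)) -(expi_exprz th) -(expi_exprz ph).
    by rewrite -!expiD; congr expi; rewrite /v; ring.
  rewrite pE zE uE [LHS]sub_root.
  rewrite !mulr_suml -big_split /= mulr_sumr -!sumrB; apply: eq_bigr => q _.
  have -> : 1 +i* v q = 1 + 'i * (q.1%:~R * s%:C + q.2%:~R * t%:C).
    rewrite [LHS]complexE /= /v; congr (_ + _ * _).
    rewrite rmorphD; congr (_ + _); rewrite rmorphM; congr (_ * _); exact: rmorph_int.
  by rewrite -/(w q); ring.
apply: le_trans (normc_sum _ _) _; rewrite mulr_suml; apply: ler_sum => q _.
rewrite Normc.normcM /w Normc.normcM -!expi_exprz !normc_expi !mul1r.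
apply: le_trans (expi_taylor _) _; rewrite -mulrA ler_pM2l // -exprMn.
rewrite -[v q ^+ 2]real_normK ?num_real // ler_sqr ?nnegrE ?mulr_ge0 ?addr_ge0 //.
apply: le_trans (ler_normD _ _) _; rewrite !normrM /m.
have := normr_ge0 s; have := normr_ge0 t; have := normr_ge0 (q.1%:~R : R); have := normr_ge0 (q.2%:~R : R).
by nra.
Qed.

(** A difference of squares of moduli: the moduli differ by O(r^2), and their sum is O(r). *)
Lemma symbol_expansion : exists B, 0 <= B /\ forall s t, `|s| + `|t| <= 1 ->
  `|symbol tau (th + s) (ph + t) - root_quad tau z u s t| <= B * (`|s| + `|t|) ^+ 3.
Proof.
have [B [B0 hB]] := charpoly_expansion.
set P := z * _ in hB *; set Q := u * _ in hB *.
have A0 : 0 <= nc P + nc Q by rewrite addr_ge0 ?normc_ge0.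
exists (B * (2 * (nc P + nc Q) + B)); split; first by rewrite mulr_ge0 ?addr_ge0 ?mulr_ge0.
move=> s t; have := hB s t; set r := `|s| + `|t| => hr r1.
have r0 : 0 <= r by exact: addr_ge0.
rewrite /symbol /root_quad -/P -/Q -!normc_sqr.
move: hr; set p := charpoly _ _ _; set X := _ + Q * _ => hr.
have i1 : nc ('i * X) = nc X by rewrite Normc.normcM /= expr0n /= expr1n add0r sqrtr1 mul1r.
have XA : nc X <= (nc P + nc Q) * r.
  apply: le_trans (le_normcD _ _) _; rewrite (Normc.normcM P) (Normc.normcM Q) !normc_real /r.
  have := mulr_ge0 (normc_ge0 P) (normr_ge0 t); have := mulr_ge0 (normc_ge0 Q) (normr_ge0 s).
  by rewrite mulrDr !mulrDl; lra.
have d1 : nc p <= nc X + B * r ^+ 2.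
  by rewrite -[p](subrK ('i * X)) addrC; apply: le_trans (le_normcD _ _) _; rewrite i1 lerD2l.
have d2 : nc X <= nc p + B * r ^+ 2.
  rewrite -i1 -[X in nc X](subrK p) addrC; apply: le_trans (le_normcD _ _) _.
  by rewrite lerD2l -normcN opprB.
have r2 : 0 <= r ^+ 2 by exact: sqr_ge0.
have X0 := normc_ge0 X; have p0 := normc_ge0 p.
have dd : `|nc p - nc X| <= B * r ^+ 2 by rewrite ler_norml; apply/andP; split; lra.
rewrite subr_sqr normrM; apply: (@le_trans _ _ (B * r ^+ 2 * (2 * ((nc P + nc Q) * r) + B * r))).
  apply: ler_pM => //; rewrite ger0_norm ?addr_ge0 //.
  have : B * r ^+ 2 <= B * r by rewrite ler_wpM2l // expr2 ler_piMr.
  by lra.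
by rewrite le_eqVlt; apply/orP; left; apply/eqP; ring.
Qed.

End LocalExpansion.

Section LocalGreen.
Variables (R : realType) (tau : polyomino) (a b : int) (th ph : R).
Implicit Types (s t x y eps : R).
Local Notation z := (expi th).
Local Notation u := (expi ph).
Hypothesis root : charpoly tau z u = 0.
Hypothesis simple : simple_root tau z u.
Local Notation P := (z * charpoly_z tau z u).
Local Notation Q := (u * charpoly_u tau z u).

Definition root_kernel eps x y : R :=
  kernel (normsq P) (2 * complex.Re (P^* * Q)) (normsq Q) eps x y.

Lemma root_kernelE eps x y : root_kernel eps x y = (eps + root_quad tau z u x y)^-1.
Proof. by rewrite root_quadE. Qed.

Lemma root_quad_lower : exists c, 0 < c /\ forall s t, c * (`|s| + `|t|) ^+ 2 <= root_quad tau z u s t.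
Proof.
have [al0 ga0] := root_normsq_gt0 simple; have d0 := root_disc_gt0 simple.
have D2 : 0 < normsq P * normsq Q - (2 * complex.Re (P^* * Q)) ^+ 2 / 4.
  by rewrite root_disc_sqr exprn_gt0.
have c0 := quad_low_gt0 al0 ga0 D2.
exists (quad_low (normsq P) (2 * complex.Re (P^* * Q)) (normsq Q) / 2); split; first by rewrite divr_gt0.
move=> s t; rewrite root_quadE; apply: le_trans (quad_ge _ al0 ga0 s t).
rewrite mulrAC -mulrA ler_pM2l // ler_pdivrMr //.
rewrite -[s ^+ 2]real_normK ?num_real // -[t ^+ 2]real_normK ?num_real //.
by have := sqr_ge0 (`|s| - `|t|); nra.
Qed.

(** The cubic error of the symbol is O(r) relative to the quadratic form, hence also relative to the
    form plus [eps], uniformly in [eps]. The radius [r0] keeps this relative error below 1 / 2, so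
    the two denominators are comparable. *)
Lemma green_expansion : exists A r0, [/\ 0 <= A, 0 < r0 & forall eps s t, 0 < eps -> `|s| + `|t| <= r0 ->
  `|green_integrand tau a b eps (th + s) (ph + t) -
    complex.Re (z ^ a * u ^ b) * root_kernel eps s t| <= A * (`|s| + `|t|) * root_kernel eps s t].
Proof.
have [B [B0 hB]] := symbol_expansion root; have [c [c0 hc]] := root_quad_lower.
pose B' := B / c; have B'0 : 0 <= B' by rewrite divr_ge0 // ltW.
pose m : R := `|a%:~R| + `|b%:~R|; have m0 : 0 <= m by exact: addr_ge0.
pose r0 := (2 * B' + 1)^-1; have r00 : 0 < r0 by rewrite invr_gt0; lra.
have r01 : r0 <= 1 by rewrite invf_le1; lra.
exists (2 * m + 2 * B'), r0; split=> //; first by lra.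
move=> eps s t e0; have := hB s t; have := hc s t; rewrite root_kernelE /green_integrand.
have := normsq_ge0 (charpoly tau (expi (th + s)) (expi (ph + t))); rewrite -/(symbol _ _ _).
move: (symbol _ _ _) (root_quad _ _ _ _ _) => S q S0 hq hS hr.
set g := cos _; set g0 := complex.Re _; set r := `|s| + `|t| in hq hS hr *.
have rge0 : 0 <= r by exact: addr_ge0.
have q0 : 0 <= q by apply: le_trans hq; rewrite mulr_ge0 ?sqr_ge0 // ltW.
have {}hS : `|S - q| <= B' * r * q.
  apply: le_trans (hS (le_trans hr r01)) _; have -> : B * r ^+ 3 = B' * r * (c * r ^+ 2) by rewrite /B'; field; rewrite gt_eqF.
  by rewrite ler_wpM2l // mulr_ge0.
have gg : `|g - g0| <= m * r.
  have -> : g0 = cos (a%:~R * th + b%:~R * ph) by rewrite /g0 -!expi_exprz -expiD.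
  apply: le_trans (cos_lipschitz _ _) _.
  have -> : a%:~R * (th + s) + b%:~R * (ph + t) - (a%:~R * th + b%:~R * ph) =
    a%:~R * s + b%:~R * t :> R by ring.
  apply: le_trans (ler_normD _ _) _; rewrite !normrM /m /r.
  have := mulr_ge0 (normr_ge0 (a%:~R : R)) (normr_ge0 t).
  have := mulr_ge0 (normr_ge0 (b%:~R : R)) (normr_ge0 s).
  by rewrite mulrDr !mulrDl; lra.
have g01 : `|g0| <= 1 by rewrite /g0 -!expi_exprz -expiD cos_max.
have K0 : 0 < eps + q by lra. have S1 : 0 < eps + S by lra.
have br : B' * r <= 1 / 2.
  apply: (@le_trans _ _ (B' * r0)); first by rewrite ler_wpM2l.
  by rewrite /r0 ler_pdivrMr; lra.
have SK : `|(eps + S) - (eps + q)| <= B' * r * (eps + q).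
  rewrite opprD addrACA subrr add0r; apply: le_trans hS _.
  by apply: ler_wpM2l; [exact: mulr_ge0|rewrite lerDr ltW].
have S2 : (eps + q) / 2 <= eps + S.
  move: SK; rewrite ler_norml => /andP[h _].
  have : B' * r * (eps + q) <= 1 / 2 * (eps + q) by rewrite ler_wpM2r // ltW.
  by lra.
move: (eps + q) (eps + S) K0 S1 SK S2 => K T K0 T0 KT T2.
have -> : g / T - g0 / K = (g - g0) / T + g0 * ((K - T) / K) / T by field; rewrite !gt_eqF.
have iT : T^-1 <= 2 * K^-1 by rewrite -[2 * _]invf_div lef_pV2 ?posrE ?divr_gt0.
apply: le_trans (ler_normD _ _) _.
have -> : (2 * m + 2 * B') * r * K^-1 = m * r * (2 * K^-1) + 1 * (B' * r) * (2 * K^-1) by ring.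
apply: lerD; rewrite normrM normfV (gtr0_norm T0); apply: ler_pM; rewrite ?invr_ge0 ?(ltW T0) //.
rewrite !normrM normfV (gtr0_norm K0); apply: ler_pM => //; first by rewrite divr_ge0 // ltW.
by rewrite ler_pdivrMr // distrC.
Qed.

End LocalGreen.

Lemma finite_lower_bound (R : realFieldType) (T : finType) (f : T -> R) :
  (forall i, 0 < f i) -> exists m, 0 < m /\ forall i, m <= f i.
Proof.
move=> f0; exists (\big[Num.min/1]_i f i); split; last by move=> i; exact: bigmin_le_cond.
by elim/big_ind: _ => // x y x0 y0; rewrite lt_min x0.
Qed.

(** A coordinate in the shifted square and an angle of a root differ by less than a period, so they
    agree as soon as their exponentials do. *)
Lemma fundamental_close (R : realType) (d q x y : R) : 0 < d -> - d <= x -> x <= q - d ->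
  0 <= y -> y <= q - 2 * d -> `|x - y| < q.
Proof. by move=> d0 h1 h2 h3 h4; rewrite ltr_norml; apply/andP; split; lra. Qed.

Section LocalApproximation.
Variables (R : realType) (k : nat) (p0 p1 r0 r1 : R).
Notation mu2 := (@lebesgue2 R).
Local Notation Sq := (box p0 p1 r0 r1).
Variables (B : 'I_k -> set (R * R)) (K : 'I_k -> R * R -> R).
Hypothesis B_measurable : forall j, measurable (B j).
Hypothesis B_sub : forall j, B j `<=` Sq.
Hypothesis K_bm : forall j, bounded_measurable (K j).

Let bK j : bounded_measurable (fun p => \1_(B j) p * K j p).
Proof. by apply: bmM => //; exact: bm_indic. Qed.

Lemma Rintegral_local_sum (c : 'I_k -> R) :
  \int[mu2]_(p in Sq) (\sum_j c j * (\1_(B j) p * K j p)) =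
  \sum_j c j * \int[mu2]_(p in B j) K j p.
Proof.
have mSq := measurable_box p0 p1 r0 r1.
elim: (index_enum 'I_k) => [|j l IH].
  under eq_Rintegral do rewrite big_nil.
  by rewrite big_nil Rintegral_cst // mul0r.
under eq_Rintegral do rewrite big_cons.
rewrite big_cons RintegralD //; last 2 first.
- exact: bm_box_integrable (bmM (bm_cst _) (bK j)).
- apply: bm_box_integrable; apply: bm_sum => i; exact: bmM (bm_cst _) (bK i).
rewrite IH; congr (_ + _); rewrite RintegralZl ?bm_box_integrable //; congr (_ * _).
have BE : Sq `&` B j = B j by apply: setIidr.
rewrite -[in RHS]BE (@Rintegral_mkcondr _ _ _ mu2 Sq (B j) (K j)).
apply: eq_Rintegral => p _; rewrite patchE indicE.
by case: ifP => _; rewrite ?mul1r ?mul0r.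
Qed.

Lemma Rintegral_local_approximation (F : R * R -> R) (c : 'I_k -> R) (eta M : R) :
  bounded_measurable F ->
  (forall p, Sq p -> `|F p - \sum_j c j * (\1_(B j) p * K j p)| <=
     eta * (\sum_j (\1_(B j) p * K j p)) + M) ->
  `|\int[mu2]_(p in Sq) F p - \sum_j c j * \int[mu2]_(p in B j) K j p| <=
  eta * (\sum_j \int[mu2]_(p in B j) K j p) + M * fine (mu2 Sq).
Proof.
move=> bF FM; have mSq := measurable_box p0 p1 r0 r1.
have bS (e : 'I_k -> R) : bounded_measurable (fun p => \sum_j e j * (\1_(B j) p * K j p)).
  by apply: bm_sum => i; exact: bmM (bm_cst _) (bK i).
have bD := bmB bF (bS c).
rewrite -Rintegral_local_sum -RintegralB ?bm_box_integrable //.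
apply: le_trans (le_normr_Rintegral _ _) _; [exact: mSq|exact: bm_box_integrable bD|].
have bM := bmD (bS (fun=> eta)) (bm_cst M).
apply: (@le_trans _ _ (\int[mu2]_(p in Sq) (\sum_j eta * (\1_(B j) p * K j p) + M))).
  apply: le_Rintegral; [exact: mSq|exact: bm_box_integrable (bm_norm bD)|exact: bm_box_integrable bM|].
  by move=> p Sp; rewrite -mulr_sumr; exact: FM.
rewrite RintegralD ?bm_box_integrable //; last exact: bm_cst.
by rewrite Rintegral_local_sum Rintegral_cst // -mulr_sumr.
Qed.

End LocalApproximation.

Section GreenAsymptotic.
Variables (R : realType) (tau : polyomino) (a b : int) (k : nat) (th ph : 'I_k -> R) (d : R).
Notation mu2 := (@lebesgue2 R).
Implicit Types (x y eps rho : R) (p : R * R).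
Local Notation z j := (expi (th j)).
Local Notation u j := (expi (ph j)).
Hypothesis d_gt0 : 0 < d.
Hypothesis th_range : forall j, 0 <= th j <= 2 * pi - 2 * d.
Hypothesis ph_range : forall j, 0 <= ph j <= 2 * pi - 2 * d.
Hypothesis root : forall j, charpoly tau (z j) (u j) = 0.
Hypothesis simple : forall j, simple_root tau (z j) (u j).
Hypothesis root_inj : forall i j, th i = th j -> ph i = ph j -> i = j.
Hypothesis root_all : forall x y, charpoly tau (expi x) (expi y) = 0 ->
  exists j, expi x = z j /\ expi y = u j.

Local Notation Sq := (box (- d) (2 * pi - d) (- d) (2 * pi - d)).
Local Notation B rho j := (box (th j - rho) (th j + rho) (ph j - rho) (ph j + rho)).
Local Notation dist j p := (`|p.1 - th j| + `|p.2 - ph j|).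

Lemma symbol_continuous : continuous (fun p => symbol tau p.1 p.2).
Proof.
have [_ [M [M0 _ Ml]]] := regular_symbol R tau.
move=> p; apply/cvgrPdist_le => e e0; pose e' := e / (2 * (M + 1)).
have e'0 : 0 < e' by rewrite divr_gt0 // mulr_gt0 // ltr_wpDl.
near=> q.
have q1 : `|p.1 - q.1| <= e' by near: q; apply: cvgr_dist_le => //; exact: cvg_fst.
have q2 : `|p.2 - q.2| <= e' by near: q; apply: cvgr_dist_le => //; exact: cvg_snd.
apply: le_trans (Ml _ _ _ _) _.
apply: (@le_trans _ _ ((M + 1) * (e' + e'))); last first.
  by rewrite /e' le_eqVlt; apply/orP; left; apply/eqP; field; rewrite gt_eqF // ltr_wpDl.
by apply: ler_pM; rewrite ?addr_ge0 ?lerD // lerDl.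
Unshelve. all: by end_near. Qed.

Lemma symbol_away rho : 0 < rho -> exists m, 0 < m /\
  forall p, Sq p -> (forall j, rho <= dist j p) -> m <= symbol tau p.1 p.2.
Proof.
move=> r0; have pi0 := @pi_gt0 R.
pose t j p := rho - dist j p.
(* The second term vanishes far from the roots and is positive at them. *)
pose h p := symbol tau p.1 p.2 + \sum_j (t j p + `|t j p|).
have t0 j p : 0 <= t j p + `|t j p| by have := ler_norm (- t j p); rewrite normrN; lra.
have ch : continuous h.
  move=> p; apply: cvgD; first exact: symbol_continuous.
  apply: cvg_big => [|j _]; first exact: add_continuous.
  have ct : t j q @[q --> p] --> t j p.
    apply: cvgB; first exact: cvg_cst.
    apply: cvgD; apply: cvg_norm; apply: cvgB; [exact: cvg_fst|exact: cvg_cst|exact: cvg_snd|exact: cvg_cst].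
  by apply: cvgD => //; apply: cvg_norm.
have h0 p : Sq p -> 0 < h p.
  move=> [] /=; rewrite !in_itv /= => /andP[x1 x2] /andP[y1 y2].
  have S0 := normsq_ge0 (charpoly tau (expi p.1) (expi p.2)); rewrite -/(symbol _ _ _) in S0.
  have T0 : 0 <= \sum_j (t j p + `|t j p|) by apply: sumr_ge0.
  rewrite lt_neqAle addr_ge0 // andbT eq_sym paddr_eq0 //; apply/negP => /andP[/eqP s0 T1].
  have [j [ex ey]] : exists j, expi p.1 = z j /\ expi p.2 = u j.
    apply: root_all; apply/eqP; rewrite eq_complex /=.
    by move: s0; rewrite /symbol /normsq => /eqP; rewrite paddr_eq0 ?sqr_ge0 // !sqrf_eq0.
  have /andP[a1 a2] := th_range j; have /andP[b1 b2] := ph_range j.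
  have e1 : p.1 = th j by apply: expi_inj ex; exact: (fundamental_close d_gt0).
  have e2 : p.2 = ph j by apply: expi_inj ey; exact: (fundamental_close d_gt0).
  move: T1; rewrite psumr_eq0 // => /allP /(_ j (mem_index_enum j)) /=.
  by rewrite /t e1 e2 !subrr normr0 addr0 subr0 gtr0_norm // gt_eqF // addr_gt0.
have cS : compact Sq by apply: compact_setX; exact: segment_compact.
have S0 : Sq !=set0.
  by exists (- d, - d); split; rewrite /= in_itv /= lexx /=; lra.
have [c cS' min] := compact_EVT_min S0 cS (continuous_subspaceT ch).
exists (h c); split; first by apply: h0; rewrite inE in cS'.
move=> p Sp far; have := min p; rewrite inE => /(_ Sp) => /le_trans; apply.
rewrite /h gerDl; apply: sumr_le0 => j _.
by rewrite ler0_norm ?subrr // subr_le0.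
Qed.

(** Centres of two intersecting boxes are within [2 * rho] in each coordinate, hence [4 * rho] in
    all, which explains [m / 4]. The value 1 on the diagonal only keeps [f] positive. *)
Lemma boxes_disjoint : exists m, 0 < m /\ forall rho i j p, rho < m -> B rho i p -> B rho j p -> i = j.
Proof.
pose f (q : 'I_k * 'I_k) := if q.1 == q.2 then 1 else `|th q.1 - th q.2| + `|ph q.1 - ph q.2|.
have [|m [m0 mf]] := @finite_lower_bound R _ f.
  move=> [i j]; rewrite /f /=; case: eqVneq => // ij.
  rewrite lt_neqAle addr_ge0 // andbT eq_sym paddr_eq0 // !normr_eq0 !subr_eq0.
  by apply: contra ij => /andP[/eqP h1 /eqP h2]; apply/eqP; exact: root_inj.
exists (m / 4); split; first by rewrite divr_gt0.
move=> rho i j [x y] rm [] /=; rewrite !in_itv /= => /andP[x1 x2] /andP[y1 y2] [] /=.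
rewrite !in_itv /= => /andP[x3 x4] /andP[y3 y4]; apply/eqP; apply/negPn/negP => ij.
have := mf (i, j); rewrite /f /= (negbTE ij).
have h1 : `|th i - th j| <= 2 * rho by rewrite ler_norml; apply/andP; split; lra.
have h2 : `|ph i - ph j| <= 2 * rho by rewrite ler_norml; apply/andP; split; lra.
by lra.
Qed.

Definition box_green j rho eps : R :=
  \int[mu2]_(p in B rho j) root_kernel tau (th j) (ph j) eps (p.1 - th j) (p.2 - ph j).

Let disc j := root_disc tau (z j) (u j).

Lemma box_green_asymptotic j rho : 0 < rho ->
  exists C, forall eps, 0 < eps -> eps < 1 -> `|box_green j rho eps - pi / disc j * - ln eps| <= C.
Proof.
move=> r0; have [al0 ga0] := root_normsq_gt0 (simple j); have d0 := root_disc_gt0 (simple j).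
have D2 := root_disc_sqr tau (z j) (u j).
have D20 : 0 < root_disc tau (z j) (u j) ^+ 2 by rewrite exprn_gt0.
rewrite -D2 in D20; have [C hC] := box_kernel_asymptotic al0 ga0 D20 r0.
exists C => eps e0 e1; have := hC eps (th j) (ph j) e0 e1.
by rewrite D2 sqrtr_sqr (gtr0_norm d0).
Qed.

Let c j : R := complex.Re (z j ^ a * u j ^ b).

Lemma green_local_approximation eta : 0 < eta -> exists rho M, [/\ 0 < rho, 0 <= M,
  forall j, B rho j `<=` Sq & forall eps p, 0 < eps -> Sq p ->
  `|green_integrand tau a b eps p.1 p.2 - \sum_j c j * (\1_(B rho j) p *
      root_kernel tau (th j) (ph j) eps (p.1 - th j) (p.2 - ph j))| <=
  eta * (\sum_j (\1_(B rho j) p *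
      root_kernel tau (th j) (ph j) eps (p.1 - th j) (p.2 - ph j))) + M].
Proof.
move=> eta0.
have /choice[Ar hA] j : exists Ar : R * R, [/\ 0 <= Ar.1, 0 < Ar.2 & forall eps s t, 0 < eps ->
    `|s| + `|t| <= Ar.2 -> `|green_integrand tau a b eps (th j + s) (ph j + t) -
    c j * root_kernel tau (th j) (ph j) eps s t| <=
    Ar.1 * (`|s| + `|t|) * root_kernel tau (th j) (ph j) eps s t].
  by have [A [r h]] := green_expansion a b (root j) (simple j); exists (A, r).
have [m0 [m00 disj]] := boxes_disjoint.
have [|m1 [m10 hm1]] := @finite_lower_bound R _ (fun j => Num.min ((Ar j).2 / 2) (eta / (2 * ((Ar j).1 + 1)))).
  move=> j; have [A0 r0 _] := hA j.
  by rewrite lt_min !divr_gt0 // mulr_gt0 // ltr_wpDl.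
(* The three bounds keep the boxes inside the square, make them disjoint, and place them where the
   expansion holds with relative error at most [eta]. *)
pose rho := Num.min d (Num.min (m0 / 2) m1).
have r0 : 0 < rho by rewrite !lt_min d_gt0 divr_gt0.
have rd : rho <= d by rewrite ge_min lexx.
have rm : rho < m0.
  apply: (@le_lt_trans _ _ (m0 / 2)); first by rewrite !ge_min lexx orbT.
  lra.
have rA j : 2 * rho <= (Ar j).2 /\ (Ar j).1 * (2 * rho) <= eta.
  have [A0 _ _] := hA j; have := hm1 j; rewrite le_min => /andP[h1 h2].
  have rm1 : rho <= m1 by rewrite !ge_min lexx !orbT.
  split; first lra.
  have A1 : 0 < (Ar j).1 + 1 by lra.
  have h3 : rho * (2 * ((Ar j).1 + 1)) <= eta.
    by rewrite -ler_pdivlMr ?mulr_gt0 //; exact: le_trans rm1 h2.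
  apply: le_trans h3.
  have -> : rho * (2 * ((Ar j).1 + 1)) = (Ar j).1 * (2 * rho) + 2 * rho by ring.
  by lra.
have [m [mp hm]] := symbol_away r0.
exists rho, m^-1; split=> //; first by rewrite invr_ge0 ltW.
  move=> j [x y] [] /=; rewrite !in_itv /= => /andP[x1 x2] /andP[y1 y2].
  have /andP[a1 a2] := th_range j; have /andP[b1 b2] := ph_range j.
  by split; rewrite /= in_itv /=; apply/andP; split; lra.
move=> eps p e0 Sp; have K0 j s t : 0 < root_kernel tau (th j) (ph j) eps s t.
  have [al0 ga0] := root_normsq_gt0 (simple j).
  rewrite root_kernelE invr_gt0 ltr_pwDl //; exact: normsq_ge0.
have [[j Bj]|nB] := pselect (exists j, B rho j p).
  have off i : i != j -> \1_(B rho i) p = 0 :> R.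
    by move=> ij; rewrite indicE memNset // => Bi; case/eqP: ij; exact: disj rm Bi Bj.
  have on : \1_(B rho j) p = 1 :> R by rewrite indicE mem_set.
  rewrite (bigD1 j) //= [in X in _ + X]big1 ?addr0; last first.
    by move=> i ij; rewrite off // mul0r mulr0.
  rewrite [X in _ <= _ * X + _](bigD1 j) //= [X in _ <= _ * (_ + X) + _]big1 ?addr0; last first.
    by move=> i ij; rewrite off // mul0r.
  rewrite on !mul1r.
  move: Bj; case: p Sp {off on} => x y Sp [] /=; rewrite !in_itv /= => /andP[x1 x2] /andP[y1 y2].
  have [A0 _ hj] := hA j; have [h1 h2] := rA j.
  have d1 : `|x - th j| <= rho by rewrite ler_norml; apply/andP; split; lra.
  have d2 : `|y - ph j| <= rho by rewrite ler_norml; apply/andP; split; lra.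
  have := hj eps (x - th j) (y - ph j) e0.
  rewrite [th j + _]addrC subrK [ph j + _]addrC subrK => h.
  apply: le_trans (h _) _; first lra.
  have := K0 j (x - th j) (y - ph j); move: (root_kernel _ _ _ _ _ _) => K K1.
  have : (Ar j).1 * (`|x - th j| + `|y - ph j|) * K <= eta * K.
    rewrite ler_pM2r //; apply: le_trans h2; rewrite ler_wpM2l //; lra.
  have : 0 < m^-1 by rewrite invr_gt0.
  by move: (_ * K) => X; lra.
have off j : \1_(B rho j) p = 0 :> R.
  by rewrite indicE memNset // => Bj; apply: nB; exists j.
rewrite big1 ?subr0; last by move=> j _; rewrite off mul0r mulr0.
rewrite big1 ?mulr0 ?add0r; last by move=> j _; rewrite off mul0r.
have far j : rho <= dist j p.
  rewrite leNgt; apply/negP => near; apply: nB; exists j; case: p near {Sp off} => x y /= near.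
  have := normr_ge0 (x - th j); have := normr_ge0 (y - ph j) => n1 n2.
  have : `|x - th j| <= rho by lra. have : `|y - ph j| <= rho by lra.
  rewrite !ler_norml => /andP[y1 y2] /andP[x1 x2].
  by split; rewrite /= in_itv /=; apply/andP; split; lra.
have S := hm p Sp far; have S0 : 0 < eps + symbol tau p.1 p.2 by lra.
rewrite /green_integrand normrM normfV (gtr0_norm S0) -[m^-1]mul1r.
apply: ler_pM; rewrite ?invr_ge0 ?cos_max ?(ltW S0) //.
by rewrite lef_pV2 ?posrE //; lra.
Qed.

Theorem green_limit_asymptotic : log_asymptotic (green_limit tau a b d)
  ((4 * pi)^-1 * \sum_j complex.Re (root_coefficient tau a b (z j) (u j))).
Proof.
have pi0 := @pi_gt0 R; have p2 : 0 < (2 * pi) ^+ 2 :> R by rewrite exprn_gt0 // mulr_gt0.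
have disc0 j : 0 < disc j by exact: root_disc_gt0.
pose kap := \sum_j pi / disc j; have kap0 : 0 <= kap.
  by apply: sumr_ge0 => j _; rewrite divr_ge0 // ltW.
have cE : (4 * pi)^-1 * (\sum_j complex.Re (root_coefficient tau a b (z j) (u j))) =
    (2 * pi) ^- 2 * (\sum_j c j * (pi / disc j)).
  rewrite !mulr_sumr; apply: eq_bigr => j _.
  rewrite /root_coefficient -fmorphV Re_mulC -/(c j) -/(root_disc _ _ _) -/(disc j).
  by move: (disc j) (disc0 j) (pi : R) pi0 => D D0 q q0; field; rewrite !gt_eqF.
(* With this [eta] the slope error [eta * kap] is at most [e * (2 * pi) ^ 2]; the summand 1 keeps
   the denominator positive even without roots. *)
rewrite cE => e e0; pose eta := e * (2 * pi) ^+ 2 / (1 + kap).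
have eta0 : 0 < eta by rewrite divr_gt0 ?mulr_gt0 // ltr_wpDr.
have [rho [M [r0 M0 sub loc]]] := green_local_approximation eta0.
have /choice[C hC] j := @box_green_asymptotic j rho r0.
pose E := \sum_j C j; pose E' := \sum_j `|c j| * C j.
exists ((2 * pi) ^- 2 * (eta * E + M * fine (mu2 Sq) + E')) => eps e1 e2.
set l := - ln eps; have l0 : 0 < l by rewrite oppr_gt0 ln_lt0 // e1.
have Kb j : bounded_measurable (fun p => root_kernel tau (th j) (ph j) eps (p.1 - th j) (p.2 - ph j)).
  have [al0 ga0] := root_normsq_gt0 (simple j).
  by apply: bm_kernel => //; rewrite root_disc_sqr exprn_gt0 // -/(disc j).
have mB j : measurable (B rho j) by exact: measurable_box.
have bF := regular_bm (regular_green tau a b e1).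
have main := Rintegral_local_approximation mB sub Kb bF (fun p Sp => loc eps p e1 Sp).
have g1 : \sum_j box_green j rho eps <= kap * l + E.
  rewrite /kap mulr_suml -big_split /=; apply: ler_sum => j _.
  by have := hC j eps e1 e2; rewrite ler_norml => /andP[_]; rewrite lerBlDl.
have g2 : `|\sum_j c j * box_green j rho eps - (\sum_j c j * (pi / disc j)) * l| <= E'.
  rewrite mulr_suml -sumrB; apply: le_trans (ler_norm_sum _ _ _) _; apply: ler_sum => j _.
  by rewrite -mulrA -mulrBr normrM ler_wpM2l // hC.
rewrite /green_limit -mulrA -mulrBr normrM ger0_norm ?invr_ge0 ?(ltW p2) //.
have -> : e * l = (2 * pi) ^- 2 * (e * (2 * pi) ^+ 2 * l).
  by move: ((2 * pi) ^+ 2) p2 => q q0; field; rewrite gt_eqF.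
rewrite -mulrDr ler_pM2l ?invr_gt0 //.
move: main; rewrite -/(box_green _ _ _); set I := Rintegral _ _ _; set Z := \sum_j c j * _ => main.
have ek : eta * kap <= e * (2 * pi) ^+ 2.
  rewrite /eta mulrAC ler_pdivrMr ?ltr_wpDr // ler_pM2l ?mulr_gt0 //; lra.
have e3 : eta * (kap * l + E) <= e * (2 * pi) ^+ 2 * l + eta * E.
  by rewrite mulrDr lerD2r mulrA ler_wpM2r // ltW.
have e4 := ler_wpM2l (ltW eta0) g1.
rewrite -[I](subrK Z) -addrA; apply: le_trans (ler_normD _ _) _.
by apply: le_trans (lerD main g2) _; move: e3 e4; lra.
Qed.

End GreenAsymptotic.

(** * Comparison of the logarithmic singularities *)

Section ConjugateRoot.
Variables (R : realType) (tau : polyomino) (a b : int).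
Implicit Types z u : R[i].

Lemma conjc_exprz z (q : int) : (z ^ q)^* = z^* ^ q.
Proof. exact: fmorphXz. Qed.

Lemma charpoly_conj z u : charpoly tau z^* u^* = (charpoly tau z u)^*.
Proof.
rewrite /charpoly rmorph_sum; apply: eq_bigr => q _.
by rewrite rmorphM /= !conjc_exprz.
Qed.

Lemma charpoly_z_conj z u : charpoly_z tau z^* u^* = (charpoly_z tau z u)^*.
Proof.
rewrite /charpoly_z rmorph_sum; apply: eq_bigr => q _.
by rewrite !rmorphM /= rmorph_int !conjc_exprz.
Qed.

Lemma charpoly_u_conj z u : charpoly_u tau z^* u^* = (charpoly_u tau z u)^*.
Proof.
rewrite /charpoly_u rmorph_sum; apply: eq_bigr => q _.
by rewrite !rmorphM /= rmorph_int !conjc_exprz.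
Qed.

Lemma torus_root_conj z u : torus_root tau z u -> torus_root tau z^* u^*.
Proof. by case=> hz hu h0; split; rewrite ?normcJ // charpoly_conj h0 rmorph0. Qed.

Lemma root_disc_conj z u : root_disc tau z^* u^* = root_disc tau z u.
Proof.
rewrite /root_disc charpoly_z_conj charpoly_u_conj -[z^* * _]rmorphM -[u^* * _]rmorphM.
move: (z * _) (u * _) => [p1 p2] [q1 q2] /=.
by rewrite -normrN; congr `|_|; ring.
Qed.

Lemma root_coefficient_conj z u :
  root_coefficient tau a b z^* u^* = (root_coefficient tau a b z u)^*.
Proof.
rewrite /root_coefficient -!/(root_disc _ _ _) root_disc_conj -!conjc_exprz -!fmorphV.
move: (z ^ a) (u ^ b) (_^-1) => [x1 x2] [y1 y2] r; apply/eqP.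
by rewrite eq_complex /=; apply/andP; split; apply/eqP; ring.
Qed.

Lemma root_weight_conj z u eps : root_weight tau a b z^* u^* eps = root_weight tau a b z u eps.
Proof.
rewrite /root_weight root_disc_conj charpoly_z_conj charpoly_u_conj.
rewrite -[z^* * _]rmorphM -[u^* * _]rmorphM.
move: (z * _) (u * _) (root_disc _ _ _) => P Q r.
have step (A A' B B' C C' : R) : A = A' -> B = B' -> C = C' ->
    r / (2 * pi) ^+ 2 * osc_limit A B C a%:~R b%:~R eps 0 =
    r / (2 * pi) ^+ 2 * osc_limit A' B' C' a%:~R b%:~R eps 0 by move=> -> -> ->.
by apply: step; case: P => p1 p2; case: Q => q1 q2; rewrite /normsq /=; ring.
Qed.

End ConjugateRoot.

Section LogarithmicTerms.
Variables (R : realType) (k : nat) (cf : 'I_k -> R[i]) (w : 'I_k -> R -> R) (L : R -> R) (kap : R).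
Variable sigma : 'I_k -> 'I_k.
Hypotheses (sigma_inj : injective sigma) (cf_conj : forall j, cf (sigma j) = (cf j)^*).
Hypothesis w_conj : forall j, w (sigma j) = w j.
Hypothesis kap_gt0 : 0 < kap.
Hypothesis w_log : forall j, w j eps / - ln eps @[eps --> 0^'+] --> kap.
Hypothesis L_log : L eps / - ln eps @[eps --> 0^'+] --> kap * \sum_j complex.Re (cf j).
Hypothesis cf_neq0 : forall j, cf j != 0.
Local Notation nc := Normc.normc.

(** Reindexing by the involution of conjugate roots shows that the sum equals its own conjugate. *)
Lemma conj_symmetric_sum_real (v : 'I_k -> R) : (forall j, v (sigma j) = v j) ->
  \sum_j cf j * (v j)%:C = (\sum_j complex.Re (cf j) * v j)%:C.
Proof.
move=> v_conj; have e : \sum_j cf j * (v j)%:C = (\sum_j cf j * (v j)%:C)^*.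
  rewrite rmorph_sum [LHS](reindex_inj sigma_inj) /=; apply: eq_bigr => j _.
  rewrite cf_conj v_conj; case: (cf j) => x y; apply/eqP.
  by rewrite eq_complex /=; apply/andP; split; apply/eqP; ring.
have re : complex.Re (\sum_j cf j * (v j)%:C) = \sum_j complex.Re (cf j) * v j.
  by rewrite raddf_sum; apply: eq_bigr => j _; exact: Re_mulC.
move: e re; case: (\sum_j cf j * _) => x y; case=> /eqP; rewrite -addr_eq0 -mulr2n mulrn_eq0 /=.
by move=> /eqP -> ->.
Qed.

Local Notation T eps := (\sum_j cf j * (w j eps)%:C).
Local Notation reT eps := (\sum_j complex.Re (cf j) * w j eps).

Let TE eps : T eps = (reT eps)%:C.
Proof. by apply: conj_symmetric_sum_real => j; rewrite w_conj. Qed.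

Lemma neg_ln_gt0_near : \forall eps \near (0 : R)^'+, 0 < - ln eps.
Proof.
near=> eps; rewrite oppr_gt0 ln_lt0 //; apply/andP; split.
  by near: eps; exact: nbhs_right_gt.
by near: eps; exact: nbhs_right_lt.
Unshelve. all: by end_near. Qed.

Lemma reT_log : reT eps / - ln eps @[eps --> 0^'+] --> kap * \sum_j complex.Re (cf j).
Proof.
rewrite mulr_sumr (_ : (fun eps => _) = fun eps => \sum_j complex.Re (cf j) * (w j eps / - ln eps)).
  apply: cvg_big => [|j _]; first exact: add_continuous.
  by rewrite mulrC; exact: cvgMl_tmp.
by apply/funext => eps; rewrite mulr_suml; apply: eq_bigr => j _; rewrite mulrA.
Qed.

Lemma w_neq0_near j : \forall eps \near 0^'+, w j eps != 0.
Proof.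
have h := w_log j; have : \forall eps \near 0^'+, w j eps / - ln eps != 0.
  by apply: cvgr_neq0 h _; rewrite gt_eqF.
by apply: filterS => eps; apply: contra => /eqP ->; rewrite mul0r.
Qed.

(** The whole discrepancy is put into the factor of the root [j0]. It is o(ln (1 / eps)), while the
    term of [j0] is of exact order ln (1 / eps), whatever cancellation occurs in the sum. *)
Lemma individual_factors : (0 < k)%N -> exists r : 'I_k -> R -> R[i],
  (forall j, complex.Re `|r j eps - 1| @[eps --> 0^'+] --> (0 : R)) /\
  \forall eps \near 0^'+, (L eps)%:C = \sum_j r j eps * (cf j * (w j eps)%:C).
Proof.
move=> k0; pose j0 := Ordinal k0.
pose q eps := ((L eps)%:C - T eps) / (cf j0 * (w j0 eps)%:C).
exists (fun j eps => if j == j0 then 1 + q eps else 1); split; last first.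
  apply: filterS (w_neq0_near j0) => eps w0.
  have c0 : cf j0 * (w j0 eps)%:C != 0 by rewrite mulf_neq0 // fmorph_eq0.
  rewrite (bigD1 j0) //= ?eqxx mulrDl mul1r /q divfK // -addrAC.
  rewrite (eq_bigr (fun j => cf j * (w j eps)%:C)); last first.
    by move=> j /negbTE ->; rewrite mul1r.
  by rewrite -(bigD1 j0 (P := xpredT) (F := fun j => cf j * (w j eps)%:C)) //= addrC subrK.
move=> j; case: eqVneq => [_|jn]; last first.
  by under eq_fun do rewrite subrr normr0 /=; exact: cvg_cst.
have nc0 : 0 < nc (cf j0).
  by rewrite lt_neqAle normc_ge0 andbT eq_sym; apply: contra (cf_neq0 j0) => /eqP /Normc.eq0_normc ->.
have ncE (x : R[i]) : complex.Re `|x| = nc x by case: x.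
have lim : `|L eps / - ln eps - reT eps / - ln eps| / (nc (cf j0) * `|w j0 eps / - ln eps|)
    @[eps --> 0^'+] --> (0 : R).
  have num : `|L eps / - ln eps - reT eps / - ln eps| @[eps --> 0^'+] --> (0 : R).
    have h : L eps / - ln eps - reT eps / - ln eps @[eps --> 0^'+] -->
        kap * (\sum_j complex.Re (cf j)) - kap * (\sum_j complex.Re (cf j)).
      by apply: cvgB => //; exact: reT_log.
    by rewrite subrr in h; have := cvg_norm h; rewrite normr0; apply.
  have den : (nc (cf j0) * `|w j0 eps / - ln eps|)^-1 @[eps --> 0^'+] --> (nc (cf j0) * `|kap|)^-1.
    apply: cvgV; first by rewrite mulf_neq0 ?normr_eq0 ?gt_eqF.
    by apply: cvgMl_tmp; apply: cvg_norm; exact: w_log.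
  by have := cvgM num den; rewrite mul0r; apply.
apply: cvg_trans lim; apply: near_eq_cvg.
near=> eps; have l0 : 0 < - ln eps by near: eps; exact: neg_ln_gt0_near.
rewrite [1 + _]addrC addrK ncE /q TE -rmorphB /= Normc.normcM Normc.normcV Normc.normcM.
rewrite !normc_real -mulrBl !normrM normfV (gtr0_norm l0) !invfM invrK.
move: (nc _)^-1 `|w _ _|^-1 `|L _ - _| (- ln _) l0 => n v x l l0.
by field; rewrite gt_eqF.
Unshelve. all: by end_near. Qed.

(** Divided by ln (1 / eps), both sides have the same limit, which is nonzero by hypothesis. *)
Lemma common_factor : \sum_j cf j != 0 -> exists r : R -> R, r eps @[eps --> 0^'+] --> (1 : R) /\
  \forall eps \near 0^'+, (L eps)%:C = (r eps)%:C * T eps.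
Proof.
move=> S0; set S := \sum_j complex.Re (cf j).
have SE : \sum_j cf j = S%:C.
  have := @conj_symmetric_sum_real (fun=> 1) (fun=> erefl).
  by under eq_bigr do rewrite mulr1; under [in RHS]eq_bigr do rewrite mulr1.
have kS : kap * S != 0.
  by rewrite mulf_neq0 ?(gt_eqF kap_gt0) //; move: S0; rewrite SE fmorph_eq0.
exists (fun eps => L eps / reT eps); split.
  rewrite -(divff kS).
  apply: (@cvg_trans _ ((L eps / - ln eps) / (reT eps / - ln eps) @[eps --> 0^'+])); last first.
    by apply: cvgM => //; apply: cvgV => //; exact: reT_log.
  apply: near_eq_cvg; near=> eps; have l0 : 0 < - ln eps by near: eps; exact: neg_ln_gt0_near.
  by rewrite invfM invrK mulrACA mulVf ?mulr1 // gt_eqF.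
have : \forall eps \near 0^'+, reT eps / - ln eps != 0 by apply: cvgr_neq0 reT_log _.
apply: filterS => eps; rewrite mulf_eq0 negb_or => /andP[t0 _].
by rewrite TE -rmorphM divfK.
Unshelve. all: by end_near. Qed.

End LogarithmicTerms.

Theorem theorem6p1 (R : realType) (tau : polyomino)
    (k : nat) (z u : 'I_k -> R[i]) (a b : int)
    (tau_ge2 : (2 <= #|` tau|)%N)
    (roots_inj : injective (fun j => (z j, u j)))
    (rootsE : forall z' u' : R[i],
       torus_root tau z' u' <-> exists j, z' = z j /\ u' = u j)
    (roots_simple : forall j, simple_root tau (z j) (u j))
    (ab_neq0 : (a, b) <> (0, 0)) :
  (forall (eps : R) (j : 'I_k), 0 < eps ->
     improper_converges (root_integrand tau a b eps (z j) (u j))) /\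
  exists (C : R -> nat -> R) (L : R -> R),
  [/\ forall eps : R, 0 < eps -> covariance_limit tau a b eps (C eps),
      forall eps : R, 0 < eps -> C eps n @[n --> \oo] --> L eps,
      (* each root contributes its term up to a factor 1 + o(1) *)
      (0 < k)%N ->
        exists r : 'I_k -> R -> R[i],
          (forall j, complex.Re `|r j eps - 1| @[eps --> 0^'+] --> (0 : R)) /\
          \forall eps \near 0^'+,
            (L eps)%:C = \sum_(j < k) r j eps * root_term tau a b eps (z j) (u j)
    & (* a single factor 1 + o(1) when the leading terms do not cancel *)
      \sum_(j < k) root_coefficient tau a b (z j) (u j) != 0 ->
        exists r : R -> R,
          r eps @[eps --> 0^'+] --> (1 : R) /\
          \forall eps \near 0^'+,
            (L eps)%:C =
            (r eps)%:C * \sum_(j < k) root_term tau a b eps (z j) (u j)].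
Proof.
have arg (w : R[i]) : `|w| = 1 -> exists t, 0 <= t < 2 * pi /\ expi t = w.
  by case/expi_surj => t [t0 t1 e]; exists t; rewrite t0 t1.
have rootP j : torus_root tau (z j) (u j) by apply/rootsE; exists j.
have /choice[th thP] j : exists t, 0 <= t < 2 * pi /\ expi t = z j.
  by apply: arg; have [] := rootP j.
have /choice[ph phP] j : exists t, 0 <= t < 2 * pi /\ expi t = u j.
  by apply: arg; have [] := rootP j.
have zE : z = fun j => expi (th j) by apply/funext => j; have [_ ->] := thP j.
have uE : u = fun j => expi (ph j) by apply/funext => j; have [_ ->] := phP j.
have [|m [m0 mP]] := @finite_lower_bound R _ (fun j => Num.min (2 * pi - th j) (2 * pi - ph j)).
  move=> j; have [/andP[_ h1] _] := thP j; have [/andP[_ h2] _] := phP j.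
  by rewrite lt_min !subr_gt0 h1.
(* Twice [d] is at most the gap between any angle of a root and [2 * pi], so the shifted square
   contains all roots with a margin [d]. *)
pose d := m / 2; have d0 : 0 < d by rewrite divr_gt0.
have thd j : 0 <= th j <= 2 * pi - 2 * d.
  have [/andP[-> _] _] := thP j; have := mP j; rewrite le_min => /andP[h _].
  by rewrite /d /=; move: h; lra.
have phd j : 0 <= ph j <= 2 * pi - 2 * d.
  have [/andP[-> _] _] := phP j; have := mP j; rewrite le_min => /andP[_ h].
  by rewrite /d /=; move: h; lra.
have root0 j : charpoly tau (expi (th j)) (expi (ph j)) = 0.
  by have [_ _] := rootP j; rewrite zE uE.
have simple j : simple_root tau (expi (th j)) (expi (ph j)).
  by have := roots_simple j; rewrite zE uE.
have inj i j : th i = th j -> ph i = ph j -> i = j.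
  by move=> h1 h2; apply: roots_inj; rewrite zE uE h1 h2.
have all x y : charpoly tau (expi x) (expi y) = 0 ->
    exists j, expi x = expi (th j) /\ expi y = expi (ph j).
  move=> h; have [|j [e1 e2]] := (rootsE (expi x) (expi y)).1.
    by split; rewrite ?normr_expi.
  by exists j; rewrite e1 e2 zE uE.
(* The characteristic polynomial has real coefficients, so conjugation permutes its roots on the
   torus. *)
have /choice[sigma sigmaP] j : exists i, z i = (z j)^* /\ u i = (u j)^*.
  have [i [e1 e2]] := (rootsE _ _).1 (torus_root_conj (rootP j)).
  by exists i; rewrite -e1 -e2.
have sigma_inj : injective sigma.
  move=> i j e; have [e1 e2] := sigmaP i; have [e3 e4] := sigmaP j.
  apply: roots_inj; congr pair; apply: (inv_inj (@conjCK _)).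
    by rewrite -e1 -e3 e.
  by rewrite -e2 -e4 e.
pose cf j := root_coefficient tau a b (z j) (u j).
pose w j := root_weight tau a b (z j) (u j).
have cf_conj j : cf (sigma j) = (cf j)^*.
  by have [e1 e2] := sigmaP j; rewrite /cf e1 e2 root_coefficient_conj.
have w_conj j : w (sigma j) = w j.
  by have [e1 e2] := sigmaP j; apply/funext => eps; rewrite /w e1 e2 root_weight_conj.
have kap0 : 0 < (4 * pi)^-1 :> R by rewrite invr_gt0 mulr_gt0 // pi_gt0.
have w_log j : w j eps / - ln eps @[eps --> 0^'+] --> (4 * pi)^-1.
  exact: root_weight_asymptotic (roots_simple j) ab_neq0.
have L_log : green_limit tau a b d eps / - ln eps @[eps --> 0^'+] -->
    (4 * pi)^-1 * \sum_j complex.Re (cf j).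
  rewrite (_ : \sum_j _ = \sum_j complex.Re (root_coefficient tau a b (expi (th j)) (expi (ph j)))).
    exact: log_asymptotic_cvg (green_limit_asymptotic a b d0 thd phd root0 simple inj all).
  by apply: eq_bigr => j _; rewrite /cf zE uE.
have cf_neq0 j : cf j != 0.
  rewrite /cf /root_coefficient mulf_neq0 //.
    by have [_ <-] := thP j; have [_ <-] := phP j; rewrite mulf_neq0 // expfz_neq0 // expi_neq0.
  by rewrite invr_eq0 fmorph_eq0 gt_eqF //; exact: root_disc_gt0 (roots_simple j).
have termE : \forall eps \near (0 : R)^'+, forall j,
    cf j * (w j eps)%:C = root_term tau a b eps (z j) (u j).
  near=> eps; have e0 : 0 < eps by near: eps; exact: nbhs_right_gt.
  by move=> j; rewrite root_termE.
split; first by move=> eps j e0; apply: root_integrand_converges.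
exists (fun eps => green_sum tau a b eps), (green_limit tau a b d); split.
- by move=> eps; exact: covariance_limit_green.
- by move=> eps e0; apply: green_sum_cvg => //; exact: ltW.
- move=> k0; have [r [r1 rE]] := @individual_factors R k cf w (green_limit tau a b d) _ sigma sigma_inj cf_conj w_conj kap0 w_log L_log cf_neq0 k0.
  exists r; split=> //; near=> eps.
  have -> : (green_limit tau a b d eps)%:C = \sum_j r j eps * (cf j * (w j eps)%:C) by near: eps.
  have tE : forall j, cf j * (w j eps)%:C = root_term tau a b eps (z j) (u j) by near: eps.
  by apply: eq_bigr => j _; rewrite tE.
- move=> S0; have [r [r1 rE]] := @common_factor R k cf w (green_limit tau a b d) _ sigma sigma_inj cf_conj w_conj kap0 w_log L_log S0.
  exists r; split=> //; near=> eps.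
  have -> : (green_limit tau a b d eps)%:C = (r eps)%:C * \sum_j cf j * (w j eps)%:C by near: eps.
  have tE : forall j, cf j * (w j eps)%:C = root_term tau a b eps (z j) (u j) by near: eps.
  by congr (_ * _); apply: eq_bigr => j _; rewrite tE.
Unshelve. all: by end_near. Qed.
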